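(* Let $\mathcal{M},\mathcal{N}$ be von Neumann algebras, $\Phi,\Psi\in\mathrm{CP}(\mathcal{M},\mathcal{N})$, and $\Gamma=\Phi+\Psi$. Let $(\pi,V,\mathcal{H}_\gamma)$ be a minimal Stinespring representation of $\Gamma$, and let $A',B'\in\pi(\mathcal{M})'$ be the Arveson Radon–Nikodym derivatives of $\Phi$ and $\Psi$, respectively (with respect to $\Gamma$), so that \[ \Phi(x)=V^*A'\pi(x)V,\qquad\Psi(x)=V^*B'\pi(x)V\quad(x\in\mathcal{M}),\qquad A'+B'=I . \] Let $P'_\Phi=s(A')$ and $P'_\Psi=s(B')$ be the support projections, and put $E_\Phi=P'_\Phi\mathcal{H}_\gamma$, $E_\Psi=P'_\Psi\mathcal{H}_\gamma$. Then, for all $x\in\mathcal{M}$, \[ \Psi_{\mathrm{ac}}(x)=V^*P'_\Phi B'P'_\Phi\pi(x)V,\qquad \Psi_{\mathrm{s}}(x)=V^*(I-P'_\Phi)B'(I-P'_\Phi)\pi(x)V . \] Moreover: (1) $\Psi\ll\Phi$ if and only if $E_\Psi\subseteq E_\Phi$, equivalently $P'_\Psi\le P'_\Phi$; (2) $\Psi\perp\Phi$ if and only if $E_\Psi\perp E_\Phi$, equivalently $P'_\Psi P'_\Phi=0$.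
   Context: $\mathrm{CP}(\mathcal{M},\mathcal{N})$ is the set of all completely positive (CP) maps $\mathcal{M}\to\mathcal{N}$ (not assumed normal). $\Phi\le_{\mathrm{cp}}\Psi$ means $\Psi-\Phi$ is CP. Limits of CP maps, including $\Psi_n\uparrow\Psi$ (an $\le_{\mathrm{cp}}$-increasing sequence converging to $\Psi$), are in the point-ultraweak topology. Let $L^2(\mathcal{N})$ be the standard form Hilbert space of $\mathcal{N}$, so $\mathcal{N}\subseteq\mathbb{B}(L^2(\mathcal{N}))$. A minimal Stinespring representation of $\Gamma$ consists of a unital $*$-representation $\pi$ of $\mathcal{M}$ on $\mathcal{H}_\gamma$ and a bounded $V:L^2(\mathcal{N})\to\mathcal{H}_\gamma$ with $\Gamma(x)=V^*\pi(x)V$ and $\pi(\mathcal{M})VL^2(\mathcal{N})$ having dense linear span. By Arveson, for each CP map $\Phi\le_{\mathrm{cp}}\Gamma$ there is a unique positive $A'\in\pi(\mathcal{M})'$ (with $A'\le I$) such that $\Phi(x)=V^*A'\pi(x)V$; it is called the Radon–Nikodym derivative of $\Phi$. The support projection $s(T)$ of a positive operator $T$ is the projection onto $(\ker T)^\perp$. $\Psi\ll\Phi$: there exist a sequence $(\Psi_n)$ in $\mathrm{CP}(\mathcal{M},\mathcal{N})$ and positive reals $(\alpha_n)$ with $\Psi_n\uparrow\Psi$ and $\Psi_n\le_{\mathrm{cp}}\alpha_n\Phi$ for all $n$. $\Psi\perp\Phi$: every $\Theta\in\mathrm{CP}(\mathcal{M},\mathcal{N})$ with $\Theta\le_{\mathrm{cp}}\Phi$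 and $\Theta\le_{\mathrm{cp}}\Psi$ is $0$. Lebesgue parts: $\Psi_{\mathrm{ac}}:=\lim_{n\to\infty}(n\Phi:\Psi)$ (the point-ultraweak limit of an increasing sequence bounded by $\Psi$) and $\Psi_{\mathrm{s}}:=\Psi-\Psi_{\mathrm{ac}}$, where the parallel sum is defined as follows. For positive sesquilinear forms $\alpha,\beta$ on a complex vector space $\mathcal{V}$ (linear in the first variable), a compatible representation consists of a linear map $h$ from $\mathcal{V}$ onto a dense subspace of a Hilbert space $\mathcal{H}$ and commuting positive $A,B\in\mathbb{B}(\mathcal{H})$ with $\alpha(x,y)=\langle Ah(x),h(y)\rangle$, $\beta(x,y)=\langle Bh(x),h(y)\rangle$; by Pusz–Woronowicz such representations exist and $(\alpha:\beta)(x,y):=\langle g(A,B)h(x),h(y)\rangle$, with $g(r,s)=\frac{rs}{r+s}$ ($0/0=0$), does not depend on the choice. For $\Phi\in\mathrm{CP}(\mathcal{M},\mathcal{N})$, $s_\Phi$ is the positive sesquilinear form on the algebraic tensor product $\mathcal{M}\odot L^2(\mathcal{N})$ with $s_\Phi(x\otimes\xi,y\otimes\eta)=\langle\Phi(y^*x)\xi,\eta\rangle$. Then $\Phi:\Psi\in\mathrm{CP}(\mathcal{M},\mathcal{N})$ is the unique CP map with $\langle(\Phi:\Psi)(y^*x)\xi,\eta\rangle=(s_\Phi:s_\Psi)(x\otimes\xi,y\otimes\eta)$ for all $x,y\in\mathcal{M}$, $\xi,\eta\in L^2(\mathcal{N})$. *)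

(* Defs.v *)
From HB Require Import structures.
From mathcomp Require Import all_boot all_order all_algebra complex.
From mathcomp Require Import all_classical all_reals all_analysis.

Set Implicit Arguments.
Unset Strict Implicit.
Unset Printing Implicit Defensive.

Import Order.TTheory GRing.Theory Num.Theory.
Import numFieldNormedType.Exports.

Local Open Scope classical_set_scope.
Local Open Scope ring_scope.

(* R[i] is packed as a numClosedFieldType so that the canonical norm and
   topology of a numFieldType apply to it. *)
Definition Cplx (R : realType) : numClosedFieldType := R[i].

Definition rc (R : realType) (r : R) : Cplx R := (r%:C)%C.

(* Convention: inner x y = <x, y> is linear in the first variable. *)
HB.mixin Record isHilbert (C : numClosedFieldType) H
    of CompleteNormedModule C H := {
  inner : H -> H -> C;
  inner_scalar : forall y, scalar (inner^~ y);
  inner_conj : forall x y, inner y x = (inner x y)^*;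
  inner_norm : forall x, inner x x = `|x| ^+ 2
}.

#[short(type="hilbertType")]
HB.structure Definition Hilbert (C : numClosedFieldType) :=
  { H of CompleteNormedModule C H & isHilbert C H }.

Definition orthc (C : numClosedFieldType) (H : hilbertType C) (E : set H) :
    set H :=
  [set x | forall y, E y -> inner x y = 0].

Section LinearSpan.
Variables (C : numClosedFieldType) (E : lmodType C).

Definition lin_span (S : set E) : set E :=
  [set v | exists n (a : 'I_n -> C) (s : 'I_n -> E),
     (forall i, S (s i)) /\ v = \sum_i a i *: s i].

Lemma lin_span_submod (S : set E) : submod_closed (mem (lin_span S)).
Proof.
split=> [|a u v].
  rewrite inE; exists 0%N, (fun=> 0), (fun=> 0); split=> [[]//|].
  by rewrite big_ord0.
rewrite !inE => -[n [b [s [Ss ->]]]] [m [c [t [St ->]]]].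
exists (n + m)%N.
exists (fun i => match fintype.split i with inl j => a * b j | inr j => c j end).
exists (fun i => match fintype.split i with inl j => s j | inr j => t j end).
split=> [i|]; first by case: (fintype.split i).
rewrite big_split_ord/= scaler_sumr; congr +%R; apply: eq_bigr => i _.
  by rewrite (unsplitK (inl i)) scalerA.
by rewrite (unsplitK (inr i)).
Qed.

End LinearSpan.

Section BoundedOperators.
Variable C : numClosedFieldType.
Implicit Types H K G : hilbertType C.

Section OperatorSpace.
Variables H K : hilbertType C.

Definition bounded_op : {pred H -> K} :=
  mem [set f : H -> K | linear f /\ continuous f].

Lemma bounded_op_submod : submod_closed bounded_op.
Proof.
split=> [|a f g].
  rewrite inE; split=> [b x y|x]; first by rewrite /= scaler0 addr0.
  exact: cvg_cst.
rewrite !inE => -[lf cf] [lg cg]; split=> [b x y|x].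
  rewrite !fctE lf lg !scalerDr !scalerA (mulrC a) -!addrA; congr +%R.
  by rewrite addrCA.
by apply: cvgD; [apply: cvgZr; exact: cf | exact: cg].
Qed.

HB.instance Definition _ :=
  GRing.isSubmodClosed.Build C (H -> K) bounded_op bounded_op_submod.

Record bop := Bop { bop_fun :> H -> K; _ : bop_fun \in bounded_op }.

HB.instance Definition _ := [isSub for bop_fun].
HB.instance Definition _ := [Choice of bop by <:].
HB.instance Definition _ := [SubChoice_isSubLmodule of bop by <:].

Lemma bopP (T : bop) : linear T /\ continuous T.
Proof. by case: T => f fP; exact: (set_mem fP). Qed.

End OperatorSpace.

Lemma bop_comp_subproof H K G (S : bop K G) (T : bop H K) :
  S \o T \in @bounded_op H G.
Proof.
have [[lS cS] [lT cT]] := (bopP S, bopP T).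
rewrite inE; split=> [a x y|x]; first by rewrite /= lT lS.
by apply: continuous_comp; [exact: cT | exact: cS].
Qed.

Definition bcomp H K G (S : bop K G) (T : bop H K) : bop H G :=
  Bop (bop_comp_subproof S T).

Lemma bop_id_subproof H : idfun \in @bounded_op H H.
Proof. by rewrite inE; split=> // x; exact: cvg_id. Qed.

Definition bid H : bop H H := Bop (bop_id_subproof H).

(* Here and below, an object determined by a property is selected by xget; the
   default value is returned only if no object has the property. *)
Definition adj H K (T : bop H K) : bop K H :=
  xget 0 [set S : bop K H | forall x y, inner (T x) y = inner x (S y)].

Definition psd H (T : bop H H) : Prop := forall x, 0 <= inner (T x) x.

Definition op_le H (S T : bop H H) : Prop := psd (T - S).

Definition bpow H (T : bop H H) (n : nat) : bop H H :=
  iter n (bcomp T) (bid H).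

Definition commutant H (S : set (bop H H)) : set (bop H H) :=
  [set T | forall x, S x -> bcomp T x = bcomp x T].

(* Meaningful for closed subspaces E only. *)
Definition proj_onto H (E : set H) : bop H H :=
  xget 0 [set P : bop H H | forall x, E (P x) /\ orthc E (x - P x)].

Definition supp_proj H (T : bop H H) : bop H H :=
  proj_onto (orthc [set x | T x = 0]).

End BoundedOperators.

Arguments bid {C} H.
Notation "S \ob T" := (bcomp S T)
  (at level 40, left associativity, format "S  \ob  T") : ring_scope.

Section VonNeumannAlgebra.
Variable C : numClosedFieldType.
Variable H : hilbertType C.

Definition von_neumann_algebra (M : set (bop H H)) : Prop :=
  (forall x, M x -> M (adj x)) /\ commutant (commutant M) = M.

Definition self_dual_cone (P : set H) : Prop :=
  P = [set x | forall y, P y -> 0 <= inner x y].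

(* Haagerup's axioms: (N, H, J, P) is a standard form of N. *)
Definition standard_form (N : set (bop H H)) (J : H -> H) (P : set H) : Prop :=
  [/\ von_neumann_algebra N,
      [/\ forall a x y, J (a *: x + y) = a^* *: J x + J y,
          forall x y, inner (J x) (J y) = inner y x &
          involutive J],
      self_dual_cone P &
      [/\ forall y : bop H H,
            commutant N y <-> exists2 x, N x & forall v, y v = J (x (J v)),
          forall z, N z -> commutant N z -> forall v, J (z (J v)) = adj z v,
          forall v, P v -> J v = v &
          forall x v, N x -> P v -> P (x (J (x (J v))))]].

End VonNeumannAlgebra.

Section Ultraweak.
Variable C : numClosedFieldType.

Definition sq_summable (H : hilbertType C) (xi : nat -> H) : Prop :=
  cvgn (series (fun k => `|xi k| ^+ 2 : C)).

Definition uw_functional (H : hilbertType C) (xi eta : nat -> H)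
    (T : bop H H) : C :=
  limn (series (fun k => inner (T (xi k)) (eta k))).

Definition uw_cvg (H : hilbertType C) (T_ : nat -> bop H H) (T : bop H H) :
    Prop :=
  forall xi eta : nat -> H, sq_summable xi -> sq_summable eta ->
    (uw_functional xi eta (T_ n) @[n --> \oo] --> uw_functional xi eta T).

Definition pt_uw_cvg (H L : hilbertType C) (M : set (bop H H))
    (T_ : nat -> bop H H -> bop L L) (T : bop H H -> bop L L) : Prop :=
  forall x, M x -> uw_cvg (T_^~ x) (T x).

End Ultraweak.

(* A map from M to N is represented by a function on all of B(H), of which only
   the values on M are ever used. *)

Section CompletelyPositive.
Variable C : numClosedFieldType.

Definition linear_on (H : hilbertType C) (M : set (bop H H)) (E : lmodType C)
    (f : bop H H -> E) : Prop :=
  forall a x y, M x -> M y -> f (a *: x + y) = a *: f x + f y.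

(* X acts on the n-fold direct sum of H. *)
Definition psd_mx (H : hilbertType C) n (X : 'M[bop H H]_n) : Prop :=
  forall v : 'I_n -> H, 0 <= \sum_i \sum_j inner (X i j (v j)) (v i).

Variables H L : hilbertType C.
Variables (M : set (bop H H)) (N : set (bop L L)).

Definition CP (Phi : bop H H -> bop L L) : Prop :=
  [/\ forall x, M x -> N (Phi x),
      linear_on M Phi &
      forall n (X : 'M[bop H H]_n), (forall i j, M (X i j)) ->
        psd_mx X -> psd_mx (map_mx Phi X)].

Definition cp_le (Phi Psi : bop H H -> bop L L) : Prop := CP (Psi - Phi).

Definition cp_increases_to (Psi_ : nat -> bop H H -> bop L L)
    (Psi : bop H H -> bop L L) : Prop :=
  (forall n, cp_le (Psi_ n) (Psi_ n.+1)) /\ pt_uw_cvg M Psi_ Psi.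

Definition cp_singular (Psi Phi : bop H H -> bop L L) : Prop :=
  forall Theta, CP Theta -> cp_le Theta Phi -> cp_le Theta Psi ->
    forall x, M x -> Theta x = 0.

End CompletelyPositive.

Definition cp_abs_cont (R : realType) (H L : hilbertType (Cplx R))
    (M : set (bop H H)) (N : set (bop L L)) (Psi Phi : bop H H -> bop L L) :
    Prop :=
  exists (Psi_ : nat -> bop H H -> bop L L) (alpha : nat -> R),
    [/\ forall n, CP M N (Psi_ n),
        forall n, 0 < alpha n,
        cp_increases_to M N Psi_ Psi &
        forall n, cp_le M N (Psi_ n) (rc (alpha n) *: Phi)].

Section Stinespring.
Variable C : numClosedFieldType.
Variables H L G : hilbertType C.
Variable M : set (bop H H).

Definition star_rep (pi : bop H H -> bop G G) : Prop :=
  [/\ linear_on M pi,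
      forall x y, M x -> M y -> pi (x \ob y) = pi x \ob pi y,
      forall x, M x -> pi (adj x) = adj (pi x) &
      pi (bid H) = bid G].

Definition minimal_stinespring (Gamma : bop H H -> bop L L)
    (pi : bop H H -> bop G G) (V : bop L G) : Prop :=
  [/\ star_rep pi,
      forall x, M x -> Gamma x = adj V \ob pi x \ob V &
      closure (lin_span [set v | exists x xi, M x /\ v = pi x (V xi)])
        = [set: G]].

Definition radon_nikodym (pi : bop H H -> bop G G) (V : bop L G)
    (Phi : bop H H -> bop L L) (A : bop G G) : Prop :=
  [/\ psd A, op_le A (bid G), commutant (pi @` M) A &
      forall x, M x -> Phi x = adj V \ob A \ob pi x \ob V].

End Stinespring.

Section FunctionalCalculus.
Variable R : realType.
Variable H : hilbertType (Cplx R).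
Implicit Types A B T : bop H H.

(* p(A, B), with the convention of p.[r, s] for the order of the variables. *)
Definition poly2_op (p : {poly {poly R}}) A B : bop H H :=
  \sum_(i < size p) \sum_(j < size p`_i)
    rc p`_i`_j *: (bpow A i \ob bpow B j).

Definition op_norm_cvg (T_ : nat -> bop H H) T : Prop :=
  forall e : R, 0 < e ->
    \forall n \near \oo, forall x, `|T_ n x - T x| <= rc e * `|x|.

(* Continuous functional calculus: f(A, B) is the norm limit of p_n(A, B) for
   polynomials p_n converging to f uniformly on a rectangle [0, a] x [0, b]
   containing the joint spectrum of (A, B). *)
Definition is_funcalc2 (f : R -> R -> R) A B T : Prop :=
  exists a b : R,
    [/\ op_le A (rc a *: bid H), op_le B (rc b *: bid H) &
    exists2 p : nat -> {poly {poly R}},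
      (forall e : R, 0 < e -> \forall n \near \oo,
         forall r s, 0 <= r <= a -> 0 <= s <= b ->
           `|(p n).[r, s] - f r s| <= e) &
      op_norm_cvg (fun n => poly2_op (p n) A B) T].

Definition funcalc2 (f : R -> R -> R) A B : bop H H :=
  xget 0 [set T | is_funcalc2 f A B T].

End FunctionalCalculus.

Section FormParallelSum.
Variable R : realType.
Variable V : lmodType (Cplx R).
Implicit Types s : V -> V -> Cplx R.

Definition positive_sesquilinear s : Prop :=
  [/\ forall v, scalar (s^~ v),
      forall w a u v, s w (a *: u + v) = a^* * s w u + s w v &
      forall v, 0 <= s v v].

Definition compatible_rep s t (H : hilbertType (Cplx R)) (h : V -> H)
    (A B : bop H H) : Prop :=
  [/\ linear h /\ closure (range h) = [set: H],
      [/\ psd A, psd B & A \ob B = B \ob A],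
      forall u v, s u v = inner (A (h u)) (h v) &
      forall u v, t u v = inner (B (h u)) (h v)].

(* Division by zero is zero in R, so that par_fun 0 0 = 0. *)
Definition par_fun (r s : R) : R := r * s / (r + s).

Definition form_par s t : V -> V -> Cplx R :=
  xget (fun _ _ => 0)
    [set q | exists (H : hilbertType (Cplx R)) (h : V -> H) (A B : bop H H),
       compatible_rep s t h A B /\
       forall u v, q u v = inner (funcalc2 par_fun A B (h u)) (h v)].

End FormParallelSum.

(* The algebraic tensor product of M and L: x (x) xi is the evaluation
   f |-> f(x, xi) on the space of bilinear forms f on M x L, and the tensor
   product is the span of these in the algebraic dual of that space. *)
Section Tensor.
Variable C : numClosedFieldType.
Variables H L : hilbertType C.
Variable M : set (bop H H).

Definition bilinear_form_on (f : bop H H -> L -> C) : Prop :=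
  (forall xi, linear_on (E := C^o) M (f^~ xi)) /\
  (forall x, M x -> scalar (f x)).

Definition bilinear_form := {f : bop H H -> L -> C | bilinear_form_on f}.

Definition evaluation (x : bop H H) (xi : L) : bilinear_form -> C^o :=
  fun f => sval f x xi.

Definition tensor_pred : {pred bilinear_form -> C^o} :=
  mem (lin_span [set t | exists x xi, M x /\ t = evaluation x xi]).

HB.instance Definition _ :=
  GRing.isSubmodClosed.Build C (bilinear_form -> C^o) tensor_pred
    (lin_span_submod _).

Record tensor :=
  Tensor { tensor_val :> bilinear_form -> C^o; _ : tensor_val \in tensor_pred }.

HB.instance Definition _ := [isSub for tensor_val].
HB.instance Definition _ := [Choice of tensor by <:].
HB.instance Definition _ := [SubChoice_isSubLmodule of tensor by <:].

Definition pure (x : bop H H) (xi : L) : tensor :=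
  insubd (0 : tensor) (evaluation x xi).

Lemma pureE x xi : M x -> tensor_val (pure x xi) = evaluation x xi.
Proof.
move=> Mx; rewrite [LHS]val_insubd ifT//; apply: mem_set.
exists 1%N, (fun=> 1), (fun=> evaluation x xi).
by split=> [_|]; [exists x, xi | rewrite big_ord1 scale1r].
Qed.

End Tensor.

Section CPParallelSum.
Variable R : realType.
Variables H L : hilbertType (Cplx R).
Variables (M : set (bop H H)) (N : set (bop L L)).

Definition cp_form (Phi : bop H H -> bop L L) :
    tensor L M -> tensor L M -> Cplx R :=
  xget (fun _ _ => 0)
    [set s | positive_sesquilinear s /\
       forall x y xi eta, M x -> M y ->
         s (pure M x xi) (pure M y eta) = inner (Phi (adj y \ob x) xi) eta].

Definition cp_par (Phi Psi : bop H H -> bop L L) : bop H H -> bop L L :=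
  xget 0
    [set Theta | CP M N Theta /\
       forall x y xi eta, M x -> M y ->
         inner (Theta (adj y \ob x) xi) eta
         = form_par (cp_form Phi) (cp_form Psi) (pure M x xi) (pure M y eta)].

Definition cp_ac (Phi Psi : bop H H -> bop L L) : bop H H -> bop L L :=
  xget 0 [set Theta | pt_uw_cvg M (fun n => cp_par (n%:R *: Phi) Psi) Theta].

Definition cp_s (Phi Psi : bop H H -> bop L L) : bop H H -> bop L L :=
  Psi - cp_ac Phi Psi.

End CPParallelSum.

(* Main.v *)
Require Import Defs.
From HB Require Import structures.
From mathcomp Require Import all_boot all_order all_algebra complex.
From mathcomp Require Import all_classical all_reals all_analysis.
From mathcomp Require Import polyXY ring lra zify.

(** Write T_n = g(n A, B) and let P be the support projection of A.  The forms
    of n Phi and Psi on M (x) L are <n A h(t), h(t')> and <B h(t), h(t')>, where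
    h(x (x) xi) = pi(x) V xi has dense range by minimality, so (h, n A, B) is a
    compatible representation and (n Phi : Psi)(x) = V* T_n pi(x) V.  That the
    parallel sum of forms does not depend on the representation follows from
    <g(A, B) x, x> = inf_y <A y, y> + <B (x - y), x - y>, whose right-hand side
    may be computed on a dense subspace.  From n A (B - T_n) = B T_n, T_n <= n A
    and A + B = 1 one gets T_n -> B P strongly, which is the formula for the
    absolutely continuous part.  The operators T_n commute with whatever
    commutes with A and B, in particular with pi(M) and with the representation
    of N' on the Stinespring space, so they define CP maps into N.  These
    witness Psi << Phi when ker A <= ker B, and T_1 detects singularity, since
    T_1 = 0 forces A B = (A + B) T_1 = 0. *)

Set Implicit Arguments.
Unset Strict Implicit.
Unset Printing Implicit Defensive.

Import Order.TTheory GRing.Theory Num.Theory.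
Import numFieldNormedType.Exports.

Local Open Scope classical_set_scope.
Local Open Scope ring_scope.

(** Two obstacles shape the proof. The operators A and B commute, but no joint spectral measure is
    at hand, so order relations between functions of (A, B) come from Bernstein polynomials: p(A, B)
    is close to a sum of grid values of p times products of Bernstein operators, and these are
    positive because commuting positive operators have a positive product. A Neumann series then
    produces g(A, B), of which only the five properties in [is_par_op] are used afterwards. The
    other obstacle is that the maps Psi_n and Theta in the definitions of absolute continuity and
    singularity are arbitrary CP maps. Instead of giving them derivatives, the proof evaluates them
    as quadratic forms on tuples (y_a, xi_a), which stand for the vectors sum_a pi(y_a) V xi_a.
    These vectors are only dense, so elements of ker A, or A w, have to be approximated, with errors
    controlled by Gamma, that is, by the norm of the Stinespring space. Hence the explicit
    constants. *)

Local Notation Re := complex.Re.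
Local Notation Im := complex.Im.

(** * Complex scalars through their real and imaginary parts *)

Section ComplexScalars.
Variable R : realType.
Implicit Types (z w : Cplx R) (r s : R).

Lemma conjE z : z^* = Complex (Re z) (- Im z).
Proof. by case: z. Qed.

Lemma ReD z w : Re (z + w : Cplx R) = Re z + Re w.
Proof. by case: z w => a b []. Qed.

Lemma ImD z w : Im (z + w : Cplx R) = Im z + Im w.
Proof. by case: z w => a b []. Qed.

Lemma ReN z : Re (- z : Cplx R) = - Re z.
Proof. by case: z. Qed.

Lemma ImN z : Im (- z : Cplx R) = - Im z.
Proof. by case: z. Qed.

Lemma ReM z w : Re (z * w : Cplx R) = Re z * Re w - Im z * Im w.
Proof. by case: z w => a b []. Qed.

Lemma ImM z w : Im (z * w : Cplx R) = Re z * Im w + Im z * Re w.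
Proof. by case: z w => a b []. Qed.

Lemma Re_sum (I : Type) (r : seq I) (Q : pred I) (f : I -> Cplx R) :
  Re (\sum_(i <- r | Q i) f i) = \sum_(i <- r | Q i) Re (f i).
Proof. by apply: (big_morph (fun z : Cplx R => Re z)) => //; exact: ReD. Qed.

Lemma eq_cplx z w : Re z = Re w -> Im z = Im w -> z = w.
Proof. by case: z w => a b [c d] /= -> ->. Qed.

Lemma cplx_ge0 z : (0 <= z) = (0 <= Re z) && (Im z == 0).
Proof. by case: z => a b; rewrite lecE /= andbC. Qed.

Lemma cplx_ge0E z : 0 <= z -> z = rc (Re z).
Proof. by case: z => a b; rewrite cplx_ge0 /= => /andP[_ /eqP->]. Qed.

Lemma cplx_gt0E z : 0 < z -> z = rc (Re z) /\ 0 < Re z.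
Proof.
move=> z0; have zE := cplx_ge0E (ltW z0); split=> //.
by move: z0; rewrite zE /rc ltcR.
Qed.

Lemma rc_ge0 r : (0 <= rc r) = (0 <= r).
Proof. by rewrite /rc ler0c. Qed.

Lemma rc_le r s : (rc r <= rc s) = (r <= s).
Proof. by rewrite /rc lecR. Qed.

Lemma rc_lt r s : (rc r < rc s) = (r < s).
Proof. by rewrite /rc ltcR. Qed.

Lemma rcM r s : rc (r * s) = rc r * rc s.
Proof. by apply: eq_cplx => /=; ring. Qed.

Lemma rcD r s : rc (r + s) = rc r + rc s.
Proof. by apply: eq_cplx => /=; ring. Qed.

Lemma rcN r : rc (- r) = - rc r.
Proof. by apply: eq_cplx => /=; ring. Qed.

Lemma rc1 : rc 1 = 1 :> Cplx R.
Proof. by []. Qed.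

Lemma rc0 : rc 0 = 0 :> Cplx R.
Proof. by []. Qed.

Lemma rcX r n : rc (r ^+ n) = rc r ^+ n.
Proof. by elim: n => // n ih; rewrite !exprS rcM ih. Qed.

Lemma rc_nat n : rc n%:R = n%:R :> Cplx R.
Proof. by elim: n => // n ih; rewrite !mulrS rcD ih. Qed.

Lemma rc_conj r : (rc r)^* = rc r.
Proof. by rewrite conjE /= oppr0. Qed.

Definition cn z : R := Re `|z|.

Lemma normE z : `|z| = rc (cn z).
Proof. exact/cplx_ge0E/normr_ge0. Qed.

Lemma cn_ge0 z : 0 <= cn z.
Proof. by rewrite -rc_ge0 -normE. Qed.

Lemma cnD z w : cn (z + w) <= cn z + cn w.
Proof. by rewrite -rc_le rcD -!normE ler_normD. Qed.

Lemma cn_sqr z : cn z ^+ 2 = Re z ^+ 2 + Im z ^+ 2.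
Proof.
by apply: (@complexI R); rewrite -![_%:C%C]/(rc _) rcX -normE -add_Re2_Im2.
Qed.

Lemma cn_sum (I : Type) (r : seq I) (Q : pred I) (f : I -> Cplx R) :
  cn (\sum_(i <- r | Q i) f i) <= \sum_(i <- r | Q i) cn (f i).
Proof.
elim/big_ind2: _ => [|a b c d ab cd|//]; first by rewrite /cn normr0.
exact: le_trans (cnD _ _) (lerD ab cd).
Qed.

Lemma Re_le_cn z : Re z <= cn z.
Proof.
rewrite -[leRHS]ger0_norm ?cn_ge0// -sqrtr_sqr cn_sqr.
apply: le_trans (ler_norm _) _; rewrite -sqrtr_sqr ler_wsqrtr//.
by rewrite lerDl sqr_ge0.
Qed.

Lemma Im_le_cn z : Im z <= cn z.
Proof.
rewrite -[leRHS]ger0_norm ?cn_ge0// -sqrtr_sqr cn_sqr.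
apply: le_trans (ler_norm _) _; rewrite -sqrtr_sqr ler_wsqrtr//.
by rewrite lerDr sqr_ge0.
Qed.

Lemma cn0 : cn 0 = 0. Proof. by rewrite /cn normr0. Qed.

Lemma cnN z : cn (- z) = cn z. Proof. by rewrite /cn normrN. Qed.

Lemma cn_rc r : cn (rc r) = `|r|.
Proof.
apply/eqP; rewrite -(@eqrXn2 _ 2)// ?cn_ge0// cn_sqr /= real_normK ?num_real//.
by rewrite expr0n addr0.
Qed.

Lemma cn_le z : cn z <= `|Re z| + `|Im z|.
Proof.
rewrite -(@ler_pXn2r _ 2) ?nnegrE ?addr_ge0 ?cn_ge0// cn_sqr sqrrD.
rewrite !real_normK ?num_real// lerD2r lerDl mulrn_wge0//.
Qed.

(** The half-line is closed in C: half the size of a negative real part, or of a nonzero imaginary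
    part, is a tolerance that no nonnegative w can meet. Positivity of double sums passes to limits
    by this. *)
Lemma cplx_ge0_approx z :
  (forall e : R, 0 < e -> exists2 w, 0 <= w & cn (z - w) <= e) -> 0 <= z.
Proof.
move=> zw; rewrite cplx_ge0; apply/andP; split.
  rewrite leNgt; apply/negP => z0.
  have [|w w0 zwe] := zw (- Re z / 2); first by rewrite divr_gt0// oppr_gt0.
  have := Re_le_cn (w - z); rewrite -cnN opprB ReD ReN => h.
  move: w0; rewrite cplx_ge0 => /andP[w0 _]; lra.
rewrite -normr_le0 leNgt; apply/negP => z0.
have [|w w0 zwe] := zw (`|Im z| / 2); first by rewrite divr_gt0.
have := Im_le_cn (w - z); rewrite -cnN opprB ImD ImN => h1.
have := Im_le_cn (z - w); rewrite ImD ImN => h2.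
move: w0; rewrite cplx_ge0 => /andP[_ /eqP w0].
have [zp|zn] := lerP 0 (Im z); first by move: zwe z0; rewrite ger0_norm//; lra.
by move: zwe z0; rewrite ltr0_norm//; lra.
Qed.

(** Discriminant argument, tested at the vertex t = - b / c. The Cauchy-Schwarz inequalities and the
    orthogonality of a nearest point all go through it. *)
Lemma sqr_disc (a b c : R) : 0 <= c ->
  (forall t : R, 0 <= a + t * b *+ 2 + t ^+ 2 * c) -> b ^+ 2 <= a * c.
Proof.
rewrite le_eqVlt => /orP[/eqP <-|c0] h.
  rewrite mulr0 leNgt; apply/negP => b0.
  have bn : b != 0 by apply/eqP => be; rewrite be expr0n ltxx in b0.
  (* For c = 0 this t gives the affine function a + 2 t b the value -1. *)
  have := h (- (a + 1) / (b *+ 2)).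
  have -> : - (a + 1) / (b *+ 2) * b *+ 2 = - (a + 1) by field.
  rewrite mulr0; lra.
have := h (- b / c); have -> : a + - b / c * b *+ 2 + (- b / c) ^+ 2 * c
   = (a * c - b ^+ 2) / c by field; lra.
by rewrite pmulr_lge0 ?invr_gt0// subr_ge0.
Qed.

End ComplexScalars.

Local Notation hilb R := (hilbertType (Cplx R)) (only parsing).

(** * The real inner product and the real norm *)

Section RealInner.
Variable R : realType.
Variable H : hilb R.
Implicit Types (x y z : H) (a : Cplx R) (r : R).

Lemma innerDl x y z : inner (x + y) z = inner x z + inner y z.
Proof. by have := inner_scalar z 1 x y; rewrite scale1r mul1r. Qed.

Lemma inner0l x : inner 0 x = 0.
Proof. by have := innerDl 0 0 x; rewrite addr0 -{1}[inner 0 x]addr0 => /addrI. Qed.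

Lemma innerZl a x z : inner (a *: x) z = a * inner x z.
Proof. by have := inner_scalar z a x 0; rewrite addr0 inner0l addr0. Qed.

Lemma innerNl x z : inner (- x) z = - inner x z.
Proof. by rewrite -scaleN1r innerZl mulN1r. Qed.

Lemma innerBl x y z : inner (x - y) z = inner x z - inner y z.
Proof. by rewrite innerDl innerNl. Qed.

Lemma innerDr x y z : inner x (y + z) = inner x y + inner x z.
Proof. by rewrite inner_conj innerDl rmorphD /= -!inner_conj. Qed.

Lemma inner0r x : inner x 0 = 0.
Proof. by rewrite inner_conj inner0l conjC0. Qed.

Lemma innerZr a x z : inner x (a *: z) = a^* * inner x z.
Proof. by rewrite inner_conj innerZl rmorphM /= -inner_conj. Qed.

Lemma innerNr x z : inner x (- z) = - inner x z.
Proof. by rewrite inner_conj innerNl rmorphN /= -inner_conj. Qed.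

Lemma innerBr x y z : inner x (y - z) = inner x y - inner x z.
Proof. by rewrite innerDr innerNr. Qed.

Lemma inner_suml (I : Type) (r : seq I) (Q : pred I) (f : I -> H) z :
  inner (\sum_(i <- r | Q i) f i) z = \sum_(i <- r | Q i) inner (f i) z.
Proof.
apply: (big_morph (fun x => inner x z)) => [x y|]; first exact: innerDl.
exact: inner0l.
Qed.

Lemma inner_sumr (I : Type) (r : seq I) (Q : pred I) (f : I -> H) z :
  inner z (\sum_(i <- r | Q i) f i) = \sum_(i <- r | Q i) inner z (f i).
Proof.
apply: (big_morph (inner z)) => [x y|]; first exact: innerDr.
exact: inner0r.
Qed.

(* The underlying real inner product and norm, so that estimates take place in
   the ordered field R. *)
Definition hi x y : R := Re (inner x y).
Definition hn x : R := Re `|x|.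

Lemma hnE x : `|x| = rc (hn x).
Proof. exact/cplx_ge0E/normr_ge0. Qed.

Lemma hn_ge0 x : 0 <= hn x.
Proof. by rewrite -rc_ge0 -hnE. Qed.

Lemma hnD x y : hn (x + y) <= hn x + hn y.
Proof. by rewrite -rc_le rcD -!hnE ler_normD. Qed.

Lemma hnN x : hn (- x) = hn x.
Proof. by rewrite /hn normrN. Qed.

Lemma hnB x y : hn (x - y) = hn (y - x).
Proof. by rewrite -hnN opprB. Qed.

Lemma hn0 : hn 0 = 0.
Proof. by rewrite /hn normr0. Qed.

Lemma hn_eq0 x : hn x = 0 -> x = 0.
Proof. by move=> h; apply/eqP; rewrite -normr_eq0 hnE h. Qed.

Lemma hnZ a x : hn (a *: x) = cn a * hn x.
Proof.
by apply: (@complexI R); rewrite -![_%:C%C]/(rc _) rcM -!hnE -normE normrZ.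
Qed.

Lemma inner_sqr x : inner x x = rc (hn x ^+ 2).
Proof. by rewrite inner_norm hnE rcX. Qed.

Lemma hi_sqr x : hi x x = hn x ^+ 2.
Proof. by rewrite /hi inner_sqr. Qed.

Lemma hiDl x y z : hi (x + y) z = hi x z + hi y z.
Proof. by rewrite /hi innerDl ReD. Qed.
Lemma hiDr x y z : hi x (y + z) = hi x y + hi x z.
Proof. by rewrite /hi innerDr ReD. Qed.
Lemma hiNl x y : hi (- x) y = - hi x y.
Proof. by rewrite /hi innerNl ReN. Qed.
Lemma hiNr x y : hi x (- y) = - hi x y.
Proof. by rewrite /hi innerNr ReN. Qed.
Lemma hi0l x : hi 0 x = 0. Proof. by rewrite /hi inner0l. Qed.
Lemma hi0r x : hi x 0 = 0. Proof. by rewrite /hi inner0r. Qed.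
Lemma hiZl r x y : hi (rc r *: x) y = r * hi x y.
Proof. by rewrite /hi innerZl ReM /= mul0r subr0. Qed.
Lemma hiZr r x y : hi x (rc r *: y) = r * hi x y.
Proof. by rewrite /hi innerZr rc_conj ReM /= mul0r subr0. Qed.
Lemma hiC x y : hi x y = hi y x.
Proof. by rewrite /hi inner_conj conjE. Qed.

Definition hiE := (hiDl, hiDr, hiNl, hiNr, hiZl, hiZr, hi0l, hi0r).

Lemma hi_eqP x y : (forall z, hi x z = hi y z) -> x = y.
Proof.
move=> xy; apply/eqP; rewrite -subr_eq0; apply/eqP/hn_eq0/eqP.
by rewrite -sqrf_eq0 -hi_sqr hiDl hiNl xy subrr.
Qed.

Lemma hi_le x y : hi x y <= hn x * hn y.
Proof.
apply: le_trans (ler_norm _) _.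
rewrite -(@ler_pXn2r _ 2) ?nnegrE ?mulr_ge0 ?hn_ge0// real_normK ?num_real//.
rewrite exprMn; apply: sqr_disc => [|t]; first exact: sqr_ge0.
rewrite -!hi_sqr; suff -> : hi x x + t * hi x y *+ 2 + t ^+ 2 * hi y y
  = hi (x + rc t *: y) (x + rc t *: y) by rewrite hi_sqr sqr_ge0.
by rewrite !hiE (hiC y x); ring.
Qed.

Lemma abs_hi_le x y : `|hi x y| <= hn x * hn y.
Proof. by rewrite ler_norml lerNl -hiNl -{1}hnN !hi_le. Qed.

(** The real inequality is applied to Re <x, y> and to Im <x, y> = Re <x, i y>. The factor 2 is
    harmless in the estimates below and spares a rotation by a phase. *)
Lemma cn_inner_le x y : cn (inner x y) <= 2 * (hn x * hn y).
Proof.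
apply: le_trans (cn_le _) _; rewrite mulr_natl mulr2n lerD ?abs_hi_le//.
have -> : Im (inner x y) = hi x ('i%C *: y).
  by rewrite /hi innerZr ReM conjE /=; ring.
apply: le_trans (abs_hi_le _ _) _; rewrite hnZ.
suff -> : cn 'i%C = 1 :> R by rewrite mul1r.
apply/eqP; rewrite -(@eqrXn2 _ 2)// ?cn_ge0// cn_sqr /= expr0n expr1n.
by rewrite add0r.
Qed.

Lemma parallelogram x y :
  hn (x + y) ^+ 2 + hn (x - y) ^+ 2 = 2 * (hn x ^+ 2 + hn y ^+ 2).
Proof. by rewrite -!hi_sqr !hiE; ring. Qed.

End RealInner.

(** * Metric form of closure, convergence and boundedness *)

Section Topology.
Variable R : realType.
Implicit Types (H K G : hilb R).

Lemma closureP H (S : set H) x :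
  closure S x <-> forall e : R, 0 < e -> exists2 y, S y & hn (x - y) < e.
Proof.
split=> [clx e e0|h B].
  have /clx[y [Sy By]] : nbhs x (ball x (rc e)) by apply: nbhsx_ballx; rewrite (rc_lt 0).
  exists y => //; move: By; rewrite -ball_normE /= hnE.
  by rewrite rc_lt.
move=> /nbhs_ballP[e /= /cplx_gt0E[-> e0]] xB; have [y Sy xy] := h _ e0.
exists y; split=> //; apply: xB; rewrite -ball_normE /= hnE.
by rewrite rc_lt.
Qed.

Lemma hcvgP H (u : nat -> H) l :
  (u n @[n --> \oo] --> l) <->
  forall e : R, 0 < e -> exists N, forall n, (N <= n)%N -> hn (l - u n) < e.
Proof.
split=> [/cvgrPdist_lt h e e0|h].
  have := h (rc e); rewrite (rc_lt 0) => /(_ e0)[N _ NP].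
  by exists N => n /NP /=; rewrite hnE rc_lt.
apply/cvgrPdist_lt => e /cplx_gt0E[-> e0]; have [N NP] := h _ e0.
by exists N => // n /= /NP; rewrite hnE rc_lt.
Qed.

Lemma hcauchy_cvg H (u : nat -> H) :
  (forall e : R, 0 < e -> exists N, forall m n, (N <= m)%N -> (N <= n)%N ->
     hn (u m - u n) < e) ->
  exists l, forall e : R, 0 < e ->
    exists N, forall n, (N <= n)%N -> hn (l - u n) < e.
Proof.
move=> cu; suff /cvg_ex[l /= ul] : cvgn u by exists l; apply/hcvgP.
apply/cauchy_cvgP/cauchy_ballP => e /cplx_gt0E[-> e0].
have [N NP] := cu _ e0.
exists (u @` [set n | (N <= n)%N], u @` [set n | (N <= n)%N]) => /=.
  by split; exists N => // n Nn; exists n.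
move=> [_ _] /= [[m Nm <-] [n Nn <-]]; rewrite -ball_normE /= hnE.
by rewrite rc_lt NP.
Qed.

Lemma bounded_opI H K (f : H -> K) (c : R) (lf : linear f)
  (fc : forall x, hn (f x) <= c * hn x) : f \in @bounded_op _ H K.
Proof.
rewrite inE; split=> //.
pose g : {linear H -> K} := HB.pack f (GRing.isLinear.Build _ _ _ _ f lf).
have : continuous g.
  apply/linear_bounded_continuous/linear_boundedP.
  exists (rc `|c|); split; first by rewrite ger0_real// rc_ge0.
  move=> r cr x; apply: (@le_trans _ _ (rc `|c| * `|x|)).
    rewrite !hnE -rcM rc_le; apply: le_trans (fc x) _.
    by rewrite ler_wpM2r ?hn_ge0// ler_norm.
  by rewrite ler_wpM2r// ltW.
by [].
Qed.

Section Bop.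
Variables H K : hilb R.
Implicit Types T S : bop H K.

Lemma bopD T x y : T (x + y) = T x + T y.
Proof. by have [l _] := bopP T; have := l 1 x y; rewrite !scale1r. Qed.
Lemma bop0 T : T 0 = 0.
Proof. by have := bopD T 0 0; rewrite addr0 -{1}[T 0]addr0 => /addrI. Qed.
Lemma bopZ T a x : T (a *: x) = a *: T x.
Proof. by have [l _] := bopP T; have := l a x 0; rewrite !addr0 bop0 addr0. Qed.
Lemma bopN T x : T (- x) = - T x.
Proof. by rewrite -scaleN1r bopZ scaleN1r. Qed.
Lemma bopB T x y : T (x - y) = T x - T y.
Proof. by rewrite bopD bopN. Qed.
Lemma bop_sum T (I : Type) (r : seq I) (Q : pred I) (f : I -> H) :
  T (\sum_(i <- r | Q i) f i) = \sum_(i <- r | Q i) T (f i).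
Proof. by apply: (big_morph T) => [x y|]; rewrite ?bopD ?bop0. Qed.

Lemma bop_eqP T S : (forall x, T x = S x) -> T = S.
Proof. by move=> TS; apply: val_inj; apply/funext. Qed.

Lemma bopDE T S x : (T + S) x = T x + S x. Proof. by []. Qed.
Lemma bopNE T x : (- T) x = - T x. Proof. by []. Qed.
Lemma bopBE T S x : (T - S) x = T x - S x. Proof. by []. Qed.
Lemma bopZE a T x : (a *: T) x = a *: T x. Proof. by []. Qed.
Lemma bop0E x : (0 : bop H K) x = 0. Proof. by []. Qed.
Lemma bop_sumE (I : Type) (r : seq I) (Q : pred I) (f : I -> bop H K) x :
  (\sum_(i <- r | Q i) f i) x = \sum_(i <- r | Q i) f i x.
Proof. exact: (big_morph (fun T : bop H K => T x)). Qed.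

Lemma bop_bounded T : exists2 c : R, 0 <= c & forall x, hn (T x) <= c * hn x.
Proof.
have [lT cT] := bopP T.
pose g : {linear H -> K} := HB.pack (T : H -> K) (GRing.isLinear.Build _ _ _ _ (T : H -> K) lT).
have /linear_bounded_continuous/linear_boundedP[M [Mr MP]] : continuous g by [].
exists (Re (`|M| + 1)).
  by rewrite -rc_ge0 -cplx_ge0E addr_ge0.
move=> x; rewrite -rc_le rcM -cplx_ge0E ?addr_ge0// -!hnE.
by apply: MP; rewrite ltr_pwDr// real_ler_norm.
Qed.

Lemma bop_bounded_gt0 T : exists2 c : R, 0 < c & forall x, hn (T x) <= c * hn x.
Proof.
have [c c0 cP] := bop_bounded T; exists (c + 1) => [|x]; first lra.
by apply: le_trans (cP x) _; rewrite ler_wpM2r ?hn_ge0//; lra.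
Qed.

End Bop.

End Topology.

(** * Orthogonal projections and the Riesz representation *)

Section Subspaces.
Variable R : realType.
Variable H : hilb R.
Implicit Types (E D : set H) (x y : H).

Definition subsp E := E 0 /\ forall (a : Cplx R) x y, E x -> E y -> E (a *: x + y).

Lemma subspD E x y : subsp E -> E x -> E y -> E (x + y).
Proof. by move=> [_ h] Ex Ey; have := h 1 _ _ Ex Ey; rewrite scale1r. Qed.

Lemma subspZ E a x : subsp E -> E x -> E (a *: x).
Proof. by move=> [E0 h] Ex; have := h a _ _ Ex E0; rewrite addr0. Qed.

Lemma subspB E x y : subsp E -> E x -> E y -> E (x - y).
Proof.
by move=> sE Ex Ey; apply: subspD => //; rewrite -scaleN1r; apply: subspZ.
Qed.

Lemma subsp_orthc (E : set H) : subsp (orthc E).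
Proof.
split=> [y _|a x y xE yE z Ez]; first exact: inner0l.
by rewrite innerDl innerZl xE// yE// mulr0 addr0.
Qed.

Lemma subsp_closure E : subsp E -> subsp (closure E).
Proof.
move=> sE; split; first by apply: subset_closure; case: sE.
move=> a x y /closureP xE /closureP yE; apply/closureP => e e0.
have c0 := cn_ge0 a.
have [|x' Ex' xx'] := xE (e / 2 / (cn a + 1)); first by rewrite !divr_gt0//; lra.
have [|y' Ey' yy'] := yE (e / 2); first by rewrite divr_gt0.
exists (a *: x' + y'); first by case: sE => _; apply.
rewrite opprD addrACA -scalerBr; apply: le_lt_trans (hnD _ _) _.
rewrite hnZ [e]splitr ler_ltD//.
apply: le_trans (_ : (cn a + 1) * hn (x - x') <= _).
  by rewrite ler_wpM2r ?hn_ge0//; lra.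
by rewrite mulrC -ler_pdivlMr ?ltW//; lra.
Qed.

Lemma closure_closed E x : closure (closure E) x -> closure E x.
Proof. by rewrite -(closure_id _).1//; exact: closed_closure. Qed.

(** A complex subspace contains i y along with y, and Re <v, i y> = Im <v, y>. *)
Lemma orthc_hi E v : subsp E -> (forall y, E y -> hi v y = 0) -> orthc E v.
Proof.
move=> sE h y Ey; apply: eq_cplx; first exact: h.
have := h ('i%C *: y) (subspZ _ sE Ey).
by rewrite /hi innerZr conjE ReM /= mul0r sub0r mulN1r opprK.
Qed.

(** Nearest-point argument: a minimising sequence for the distance from x to E is Cauchy by the
    parallelogram law and converges to some p in E; perturbing p along y in E shows that x - p is
    orthogonal to y. *)
Lemma projection_point E x : subsp E -> (forall y, closure E y -> E y) ->
  exists2 p, E p & orthc E (x - p).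
Proof.
move=> sE clE; pose S := [set r | exists2 y, E y & r = hn (x - y) ^+ 2].
have S0 : has_inf S.
  split; first by exists (hn (x - 0) ^+ 2), 0 => //; case: sE.
  by exists 0 => _ [y _ ->]; exact: sqr_ge0.
pose d := inf S.
have dle y : E y -> d <= hn (x - y) ^+ 2.
  by move=> Ey; apply: ge_inf; [case: S0|exists y].
have /choice[u uP] (n : nat) : exists y, E y /\ hn (x - y) ^+ 2 < d + n.+1%:R^-1.
  have [|_ [y Ey ->] ylt] := @inf_adherent _ S n.+1%:R^-1 _ S0.
    by rewrite invr_gt0 ltr0n.
  by exists y.
(* The midpoint of y and z lies in E, so its squared distance to x is at least d. *)
have parE y z : E y -> E z ->
    hn (y - z) ^+ 2 <= 2 * (hn (x - y) ^+ 2 + hn (x - z) ^+ 2) - 4 * d.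
  move=> Ey Ez; have := parallelogram (x - y) (x - z).
  have -> : x - y - (x - z) = - (y - z) by rewrite opprB addrC subrKA opprB.
  have -> : x - y + (x - z) = rc 2 *: (x - rc (2^-1) *: (y + z)).
    rewrite scalerBr scalerA -rcM divff ?pnatr_eq0// rc1 scale1r.
    have -> : rc 2 = 1 + 1 :> Cplx R by rewrite -rc1 -rcD.
    by rewrite scalerDl scale1r opprD addrACA.
  rewrite hnZ cn_rc ger0_norm// exprMn hnN.
  have := @dle (rc (2^-1) *: (y + z)) (subspZ _ sE (subspD sE Ey Ez)).
  lra.
have [e e0|p pP] := hcauchy_cvg (u := u).
  have [N NP] : exists N : nat, (4 / e ^+ 2 < N.+1%:R :> R).
    exists (Num.truncn (4 / e ^+ 2)); exact: truncnS_gt.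
  exists N => m n Nm Nn; rewrite -(@ltr_pXn2r _ 2) ?nnegrE ?hn_ge0 ?(ltW e0)//.
  apply: le_lt_trans (parE _ _ (uP m).1 (uP n).1) _.
  have hN k : (N <= k)%N -> hn (x - u k) ^+ 2 < d + N.+1%:R^-1.
    move=> Nk; apply: lt_le_trans (uP k).2 _; rewrite lerD2l lef_pV2 ?posrE ?ltr0n//.
    by rewrite ler_nat.
  have := hN _ Nm; have := hN _ Nn.
  have : 4 * N.+1%:R^-1 < e ^+ 2.
    by move: NP; rewrite ltr_pdivrMr ?exprn_gt0// ltr_pdivrMr ?ltr0n// mulrC.
  set w := N.+1%:R^-1; lra.
have Ep : E p.
  apply: clE; apply/closureP => e /pP[N NP]; exists (u N); first exact: (uP N).1.
  exact: NP.
have pd : hn (x - p) ^+ 2 <= d.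
  suff h e : 0 < e -> hn (x - p) <= Num.sqrt (d + e) + e.
    have d0 : 0 <= d by apply: lb_le_inf => [|_ [y _ ->]]; [case: S0|exact: sqr_ge0].
    rewrite leNgt; apply/negP => dlt.
    have : Num.sqrt d < hn (x - p).
      by rewrite -[ltRHS]ger0_norm ?hn_ge0// -sqrtr_sqr ltr_sqrt// (le_lt_trans d0).
    set s := Num.sqrt d; set h' := hn _ => sh.
    have s0 : 0 <= s by exact: sqrtr_ge0.
    (* With this e one has sqrt (d + e) + e <= s + (h' - s) / 3 + (h' - s) / 2 < h', against [h]. *)
    pose e := Num.min ((h' - s) / 2) (((h' - s) / 3) ^+ 2).
    have e0 : 0 < e by rewrite lt_min divr_gt0/= ?exprn_gt0 ?divr_gt0 ?subr_gt0.
    have := h e e0.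
    have : Num.sqrt (d + e) <= s + (h' - s) / 3.
      rewrite -[leRHS]ger0_norm; last lra.
      rewrite -sqrtr_sqr ler_wsqrtr// sqrrD sqr_sqrtr//.
      have : e <= ((h' - s) / 3) ^+ 2 by rewrite ge_min lexx orbT.
      have : 0 <= s * ((h' - s) / 3) by rewrite mulr_ge0//; lra.
      lra.
    have : e <= (h' - s) / 2 by rewrite ge_min lexx.
    lra.
  move=> e0; have [N NP] := pP e e0.
  have [M MP] : exists M : nat, (e^-1 < M.+1%:R :> R).
    by exists (Num.truncn e^-1); exact: truncnS_gt.
  have := NP (maxn N M) (leq_maxl _ _); have := (uP (maxn N M)).2.
  set v := u _ => h1 h2.
  apply: le_trans (_ : hn (x - v) + hn (p - v) <= _).
    by rewrite (hnB p) -[x - p](subrKA v) hnD.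
  apply: lerD; last exact: ltW.
  rewrite -[leLHS]ger0_norm ?hn_ge0// -sqrtr_sqr ler_wsqrtr//.
  apply: le_trans (ltW h1) _; rewrite lerD2l.
  rewrite -[leRHS]invrK lef_pV2 ?posrE ?ltr0n ?invr_gt0//.
  by apply: le_trans (ltW MP) _; rewrite ler_nat ltnS leq_maxr.
exists p => //; apply: orthc_hi => // y Ey; apply/eqP; rewrite -sqrf_eq0.
rewrite -sqrrN eq_le sqr_ge0 andbT -(mul0r (hn y ^+ 2)).
apply: sqr_disc => [|t]; first exact: sqr_ge0.
have := dle (p + rc t *: y) (subspD sE Ep (subspZ _ sE Ey)).
move/(le_trans pd); rewrite opprD addrA -!hi_sqr; move: (x - p) => w.
by rewrite !hiE (hiC y w); lra.
Qed.

Lemma projection_ex E : subsp E -> (forall y, closure E y -> E y) ->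
  exists P : bop H H, forall x, E (P x) /\ orthc E (x - P x).
Proof.
move=> sE clE.
have /choice[f fP] x : exists p, E p /\ orthc E (x - p).
  by have [p Ep xp] := projection_point x sE clE; exists p.
have uniq x p : E p -> orthc E (x - p) -> f x = p.
  move=> Ep xp; have [Ef xf] := fP x.
  have Efp := subspB sE Ef Ep; apply/eqP; rewrite -subr_eq0; apply/eqP/hn_eq0.
  apply/eqP; rewrite -sqrf_eq0 -hi_sqr /hi.
  have {1}-> : f x - p = (x - p) - (x - f x) by rewrite opprB [RHS]addrC subrKA.
  by rewrite innerBl xp// xf// subrr.
have lf : linear f.
  move=> a x y; apply: uniq; first by have [_ sl] := sE; exact: sl (fP x).1 (fP y).1.
  have -> : a *: x + y - (a *: f x + f y) = a *: (x - f x) + (y - f y).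
    by rewrite opprD addrACA -scalerBr.
  by have [_ sl] := subsp_orthc E; exact: sl (fP x).2 (fP y).2.
have fc x : hn (f x) <= 1 * hn x.
  have [Ef xf] := fP x; rewrite mul1r -(@ler_pXn2r _ 2) ?nnegrE ?hn_ge0//.
  have h := xf _ Ef.
  have -> : hn x ^+ 2 = hn (x - f x) ^+ 2 + hn (f x) ^+ 2.
    rewrite -{1}(subrK (f x) x) -!hi_sqr; move: h; move: (x - f x) => w h.
    by rewrite !hiE (hiC (f x) w) {2 3}/hi h /= addr0 add0r.
  by rewrite lerDr sqr_ge0.
by exists (Bop (bounded_opI lf fc)).
Qed.

(** The residual of x after projection onto the closure of D is orthogonal to D, hence zero. *)
Lemma dense_orth D : subsp D ->
  (forall v, (forall y, D y -> inner v y = 0) -> v = 0) -> closure D = [set: H].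
Proof.
move=> sD h; apply/seteqP; split=> // x _.
have [P PP] := projection_ex (subsp_closure sD) (@closure_closed D).
have [Dx xD] := PP x; suff -> : x = P x by [].
by apply/eqP; rewrite -subr_eq0; apply/eqP/h => y /subset_closure Dy; apply: xD.
Qed.

Lemma eq_on_dense D (K : hilb R) (S T : bop H K) :
  closure D = [set: H] -> (forall x, D x -> S x = T x) -> S = T.
Proof.
move=> clD ST; apply: bop_eqP => x; apply/eqP; rewrite -subr_eq0; apply/eqP/hn_eq0.
apply/le_anti; rewrite hn_ge0 andbT; apply/ler_addgt0Pl => e e0; rewrite addr0.
have [c c0 cP] := bop_bounded_gt0 (S - T).
have /closureP/(_ (e / c))[|y Dy xy] : closure D x by rewrite clD.
  by rewrite divr_gt0.
have -> : S x - T x = (S - T) (x - y).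
  by rewrite bopB !bopBE (ST y)// subrr subr0.
by apply: le_trans (cP _) _; rewrite mulrC -ler_pdivlMr// ltW.
Qed.

(** Let w be the residual, after projection onto the kernel, of a vector outside it. Then x - (f x /
    f w) w lies in the kernel, and pairing it with w expresses f x as a multiple of <x, w>. *)
Lemma riesz (f : H -> Cplx R) (c : R) : scalar f ->
  (forall x, cn (f x) <= c * hn x) -> exists z, forall x, f x = inner x z.
Proof.
move=> lf fc.
have f0 : f 0 = 0.
  by have := lf 1 0 0; rewrite scale1r addr0 mul1r -{1}[f 0]addr0 => /addrI.
have fB x y : f (x - y) = f x - f y.
  by have := lf (-1) y x; rewrite scaleN1r mulN1r [- y + x]addrC => ->; rewrite addrC.
have fZ a x : f (a *: x) = a * f x by have := lf a x 0; rewrite !addr0 f0 addr0.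
pose K := [set x | f x = 0].
have sK : subsp K by split=> // a x y /= fx fy; rewrite /K /= lf fx fy mulr0 addr0.
have clK y : closure K y -> K y.
  move=> /closureP yK; apply/eqP; rewrite -normr_eq0 normE; apply/eqP.
  congr rc; apply/le_anti; rewrite cn_ge0 andbT.
  apply/ler_addgt0Pl => e e0; rewrite addr0.
  have c1 : 0 < `|c| + 1 by rewrite ltr_wpDl.
  have [|z Kz yz] := yK (e / (`|c| + 1)); first by rewrite divr_gt0.
  have -> : f y = f (y - z) by rewrite fB Kz subr0.
  apply: le_trans (fc _) _; apply: le_trans (_ : (`|c| + 1) * hn (y - z) <= _).
    by rewrite ler_wpM2r ?hn_ge0//; have := ler_norm c; lra.
  by rewrite mulrC -ler_pdivlMr// ltW.
have [P PP] := projection_ex sK clK.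
have [h|] := pselect (forall x, f x = 0); first by exists 0 => x; rewrite inner0r h.
move=> /existsNP[x0 fx0]; pose w := x0 - P x0.
have fw : f w != 0.
  by rewrite fB (PP x0).1 subr0; apply/eqP.
have w0 : inner w w != 0.
  apply: contra fw => /eqP; rewrite inner_norm => /eqP.
  by rewrite sqrf_eq0 normr_eq0 => /eqP->; rewrite f0.
exists ((f w / inner w w)^* *: w) => x.
rewrite innerZr conjCK.
have : inner w (x - (f x / f w) *: w) = 0.
  by apply: (PP x0).2; rewrite /K /= fB fZ divfK// subrr.
rewrite inner_conj => /eqP; rewrite conjC_eq0 innerBl innerZl subr_eq0 => /eqP->.
by field; rewrite fw w0.
Qed.

End Subspaces.

(** * Adjoints *)

Section Adjoint.
Variable R : realType.
Variables H K : hilb R.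

(** Since [adj] is selected by [xget], existence has to be supplied: Riesz for each functional x |->
    <T x, y>, then linearity and a bound in y. *)
Lemma adj_ex (T : bop H K) :
  exists S : bop K H, forall x y, inner (T x) y = inner x (S y).
Proof.
have [c c0 cP] := bop_bounded T.
have /choice[f fP] y : exists z, forall x, inner (T x) y = inner x z.
  apply: (@riesz _ _ _ (2 * c * hn y)) => [a u v|x].
    by rewrite bopD bopZ innerDl innerZl.
  apply: le_trans (cn_inner_le _ _) _.
  rewrite -!mulrA ler_wpM2l// mulrC [hn y * _]mulrC mulrA.
  by rewrite mulrC ler_wpM2r ?hn_ge0.
have lf : linear f.
  move=> a x y; apply: hi_eqP => z; rewrite /hi inner_conj -fP [in RHS]inner_conj.
  by congr (Re (_^*)); rewrite !(innerDr, innerZr) -!fP.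
have fc x : hn (f x) <= c * hn x.
  have [->|fx0] := eqVneq (hn (f x)) 0; first by rewrite mulr_ge0 ?hn_ge0.
  have fx1 : 0 < hn (f x) by rewrite lt_neqAle eq_sym fx0 hn_ge0.
  rewrite -(ler_pM2r fx1) -expr2 -hi_sqr {1}/hi -fP -/(hi _ _).
  apply: le_trans (hi_le _ _) _; rewrite mulrAC ler_wpM2r ?hn_ge0//.
by exists (Bop (bounded_opI lf fc)).
Qed.

Lemma adjP (T : bop H K) x y : inner (T x) y = inner x (adj T y).
Proof. by have := xgetPex 0 (adj_ex T); apply. Qed.

End Adjoint.

Lemma adjP' (R : realType) (H K : hilb R) (T : bop H K) x y :
  inner (adj T y) x = inner y (T x).
Proof. by rewrite inner_conj -adjP -inner_conj. Qed.

Lemma adj_uniq (R : realType) (H K : hilb R) (T : bop H K) (S : bop K H) :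
  (forall x y, inner (T x) y = inner x (S y)) -> adj T = S.
Proof.
move=> h; apply: bop_eqP => y; apply: hi_eqP => z.
by rewrite hiC [RHS]hiC /hi -adjP h.
Qed.

Lemma adjK (R : realType) (H K : hilb R) (T : bop H K) : adj (adj T) = T.
Proof. by apply: adj_uniq => x y; rewrite adjP'. Qed.

(** * Positive operators and the sequence of F. Riesz *)

Section PsdOperators.
Variable R : realType.
Variable H : hilb R.
Implicit Types (S T A B : bop H H) (x y z : H).

Lemma bcompE (K G : hilb R) (S : bop K G) (T : bop H K) x : (S \ob T) x = S (T x).
Proof. by []. Qed.

Lemma bidE x : bid H x = x. Proof. by []. Qed.

Definition sym T := forall x y, hi (T x) y = hi x (T y).

Lemma sym_inner T : sym T -> forall x y, inner (T x) y = inner x (T y).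
Proof.
move=> sT x y; apply: eq_cplx; first exact: sT.
have := sT x ('i%C *: y); rewrite /hi bopZ !innerZr !conjE !ReM /=.
by rewrite !mul0r !sub0r !mulN1r !opprK.
Qed.

(** Complex polarisation: once <T x, x> is always real, its value at x + i y has zero imaginary part
    exactly when Re <T x, y> = Re <T y, x>. In this form later inequalities become linear arithmetic
    in R. *)
Lemma psdP T : psd T <-> sym T /\ forall x, 0 <= hi (T x) x.
Proof.
split=> [pT|[sT T0] x]; last first.
  rewrite cplx_ge0; apply/andP; split; first exact: T0.
  apply/eqP; have := sym_inner sT x x.
  rewrite [in RHS]inner_conj conjE => /(congr1 (@Im R)) /=; lra.
have im x : Im (inner (T x) x) = 0.
  by have := pT x; rewrite cplx_ge0 => /andP[_ /eqP].
split=> [x y|x]; last by have := pT x; rewrite cplx_ge0 => /andP[].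
have := im (x + 'i%C *: y).
rewrite bopD bopZ !innerDl !innerDr !innerZl !innerZr conjE !ImD !ImM !ReM /=.
by rewrite !im (hiC x (T y)) /hi; lra.
Qed.

Lemma psd_sym T : psd T -> sym T. Proof. by move/psdP => []. Qed.

Lemma psd_hi T x : psd T -> 0 <= hi (T x) x. Proof. by move/psdP => []. Qed.

Lemma sym_id : sym (bid H). Proof. by []. Qed.
Lemma symB S T : sym S -> sym T -> sym (S - T).
Proof. by move=> sS sT x y; rewrite !bopBE !hiE sS sT. Qed.
Lemma symD S T : sym S -> sym T -> sym (S + T).
Proof. by move=> sS sT x y; rewrite !bopDE !hiE sS sT. Qed.
Lemma symZ r T : sym T -> sym (rc r *: T).
Proof. by move=> sT x y; rewrite !bopZE !hiE sT. Qed.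
Lemma symM S T : sym S -> sym T -> S \ob T = T \ob S -> sym (S \ob T).
Proof. by move=> sS sT ST x y; rewrite {1}ST !bcompE sT sS. Qed.

Lemma psd_op_le S T : sym S -> sym T ->
  (forall x, hi (S x) x <= hi (T x) x) -> op_le S T.
Proof.
move=> sS sT h; apply/psdP; split; first exact: symB.
by move=> x; rewrite bopBE !hiE subr_ge0.
Qed.

Lemma op_le_hi S T x : op_le S T -> hi (S x) x <= hi (T x) x.
Proof. by move/(psd_hi x); rewrite bopBE !hiE subr_ge0. Qed.

Lemma psdD S T : psd S -> psd T -> psd (S + T).
Proof. by move=> pS pT x; rewrite bopDE innerDl addr_ge0. Qed.

Lemma psdZ r T : 0 <= r -> psd T -> psd (rc r *: T).
Proof. by move=> r0 pT x; rewrite bopZE innerZl mulr_ge0// rc_ge0. Qed.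

Lemma psd_id : psd (bid H).
Proof. by move=> x; rewrite bidE inner_sqr rc_ge0 sqr_ge0. Qed.

Lemma psd0 : psd (0 : bop H H).
Proof. by move=> x; rewrite inner0l. Qed.

Lemma psd_CS T x y : psd T -> hi (T x) y ^+ 2 <= hi (T x) x * hi (T y) y.
Proof.
move=> pT; apply: sqr_disc => [|t]; first exact: psd_hi.
have := psd_hi (x + rc t *: y) pT; rewrite bopD bopZ !hiE.
rewrite (psd_sym pT y x) (hiC y); lra.
Qed.

Lemma psd_ker T x : psd T -> hi (T x) x = 0 -> T x = 0.
Proof.
move=> pT h; have := psd_CS x (T x) pT; rewrite h mul0r hi_sqr => h1.
apply: hn_eq0; apply/eqP; rewrite -sqrf_eq0 -sqrf_eq0.
by rewrite eq_le h1 sqr_ge0.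
Qed.

(** Cauchy-Schwarz for the form of T at x and T x gives |T x|^4 <= <T x, x> <T T x, T x>, and the
    last factor is at most c |T x|^2. *)
Lemma psd_norm T c x : 0 <= c -> psd T -> (forall y, hi (T y) y <= c * hn y ^+ 2) ->
  hn (T x) ^+ 2 <= c * hi (T x) x.
Proof.
move=> c0 pT cT; have := psd_CS x (T x) pT; rewrite hi_sqr.
have [->|Tx0] := eqVneq (hn (T x)) 0.
  by rewrite expr0n mulr_ge0 ?psd_hi.
have n0 : 0 < hn (T x) ^+ 2 by rewrite exprn_gt0// lt_neqAle eq_sym Tx0 hn_ge0.
move=> h; rewrite -(ler_pM2r n0) -expr2; apply: le_trans h _.
by rewrite mulrAC [leRHS]mulrC ler_wpM2l ?psd_hi.
Qed.

Lemma psd_norm_le T c x : 0 <= c -> psd T ->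
  (forall y, hi (T y) y <= c * hn y ^+ 2) -> hn (T x) <= c * hn x.
Proof.
move=> c0 pT cT; rewrite -(@ler_pXn2r _ 2) ?nnegrE ?mulr_ge0 ?hn_ge0//.
apply: le_trans (psd_norm x c0 pT cT) _.
by rewrite exprMn expr2 -mulrA ler_wpM2l.
Qed.

Lemma psd_bounded T : exists2 c : R, 0 < c & forall x, hi (T x) x <= c * hn x ^+ 2.
Proof.
have [c c0 cP] := bop_bounded_gt0 T; exists c => // x.
apply: le_trans (hi_le _ _) _; rewrite expr2 mulrA.
by rewrite ler_wpM2r ?hn_ge0.
Qed.

(* A - A^2 = A (1 - A) A + (1 - A) A (1 - A) when 0 <= A <= 1. *)
Lemma sub_sqr_hi A x : sym A -> (forall y, 0 <= hi (A y) y <= hn y ^+ 2) ->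
  0 <= hi ((A - A \ob A) x) x <= hn x ^+ 2 - hn (A x) ^+ 2 /\
  hi ((A - A \ob A) x) x = hi (A x) x - hn (A x) ^+ 2.
Proof.
move=> sA A01; have := A01 (A x); have := A01 (x - A x); have := A01 x.
rewrite bopBE bcompE -!hi_sqr bopB !hiE.
rewrite (sA (A x) x) (hiC x (A x)) => /andP[h1 h2] /andP[h3 h4] /andP[h5 h6].
by split=> //; apply/andP; split; lra.
Qed.

(** F. Riesz's sequence; it replaces the square root of A in the proof that commuting positive
    operators have a positive product. *)
Fixpoint sub_sqr_seq A (k : nat) : bop H H :=
  if k is k'.+1 then sub_sqr_seq A k' - sub_sqr_seq A k' \ob sub_sqr_seq A k'
  else A.

Lemma sub_sqr_seqP A k : sym A -> (forall y, 0 <= hi (A y) y <= hn y ^+ 2) ->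
  sym (sub_sqr_seq A k) /\
  forall y, 0 <= hi (sub_sqr_seq A k y) y <= hn y ^+ 2.
Proof.
move=> sA A01; elim: k => // k [sk k01]; split=> [|y].
  by apply: symB => //; apply: symM.
have [/andP[h1 h2] _] := sub_sqr_hi y sk k01.
by rewrite /= h1 (le_trans h2)// gerBl sqr_ge0.
Qed.

Lemma sub_sqr_seq_comm A X k : A \ob X = X \ob A ->
  sub_sqr_seq A k \ob X = X \ob sub_sqr_seq A k.
Proof.
move=> AX; elim: k => //= k ih; apply: bop_eqP => x.
have ih' y : sub_sqr_seq A k (X y) = X (sub_sqr_seq A k y).
  by rewrite -bcompE ih.
by rewrite !bcompE !bopBE !bcompE bopB !ih'.
Qed.

(** Telescoping, since |A_k x|^2 = <A_k x, x> - <A_(k+1) x, x>. So among the first n vectors A_k x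
    one has squared norm at most |x|^2 / n. *)
Lemma sub_sqr_seq_sum A n x : sym A -> (forall y, 0 <= hi (A y) y <= hn y ^+ 2) ->
  \sum_(k < n) hn (sub_sqr_seq A k x) ^+ 2 <= hn x ^+ 2.
Proof.
move=> sA A01.
suff -> : \sum_(k < n) hn (sub_sqr_seq A k x) ^+ 2 = hi (A x) x - hi (sub_sqr_seq A n x) x.
  have [_ /(_ x)/andP[h _]] := sub_sqr_seqP n sA A01.
  by have /andP[_ h2] := A01 x; lra.
elim: n => [|n ih]; first by rewrite big_ord0 subrr.
rewrite big_ord_recr/= ih; have [sn n01] := sub_sqr_seqP n sA A01.
by have [_ ->] := sub_sqr_hi x sn n01; lra.
Qed.

End PsdOperators.

(** * Positive operator matrices and a commuting positive operator *)

Section MatrixPositivity.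
Variable R : realType.
Variable H : hilb R.

(* F. Riesz: with A_0 = A and A_(k+1) = A_k - A_k^2 one has
   A = A_0^2 + ... + A_(N-1)^2 + A_N, so that X A is, up to the small term
   X A_N, a sum of the positive terms A_k X A_k. *)
Lemma psd_mx_comm_contr n (X : 'M[bop H H]_n) (A : bop H H) (v : 'I_n -> H) :
  sym A -> (forall y, 0 <= hi (A y) y <= hn y ^+ 2) ->
  psd_mx X -> (forall i j, A \ob X i j = X i j \ob A) ->
  0 <= \sum_i \sum_j inner (X i j (A (v j))) (v i).
Proof.
move=> sA A01 pX AX.
pose F B := \sum_i \sum_j inner (X i j (B (v j))) (v i) : Cplx R.
pose a k := sub_sqr_seq A k.
(* The drop is the form of X at the vectors a k (v i), because a k is symmetric and commutes with
   the entries of X. *)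
have Fstep k : 0 <= F (a k) - F (a k.+1).
  have -> : F (a k) - F (a k.+1) = \sum_i \sum_j inner (X i j (a k (v j))) (a k (v i)).
    rewrite /F -sumrB (eq_bigr (fun i => \sum_j inner (X i j (a k (v j))) (a k (v i))))// => i _.
    rewrite -sumrB; apply: eq_bigr => j _; rewrite -innerBl -bopB.
    have -> : a k.+1 (v j) = a k (v j) - a k (a k (v j)) by [].
    rewrite opprB addrC subrK.
    have [sk _] := sub_sqr_seqP k sA A01.
    rewrite -[RHS](sym_inner sk).
    by have /(congr1 (fun T : bop H H => T (a k (v j)))) := sub_sqr_seq_comm k (AX i j) => /= ->.
  exact: (pX (fun i => a k (v i))).
have F0 k : 0 <= F A - F (a k).
  elim: k => [|k ih]; first by rewrite subrr.
  by rewrite -(subrKA (F (a k))) addr_ge0.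
have /choice[c cP] (p : 'I_n * 'I_n) :
    exists c : R, 0 <= c /\ forall x, hn (X p.1 p.2 x) <= c * hn x.
  by have [c c0 cP] := bop_bounded (X p.1 p.2); exists c.
pose D := \sum_i \sum_j 2 * (c (i, j) * hn (v i)).
have D0 : 0 <= D.
  by apply: sumr_ge0 => i _; apply: sumr_ge0 => j _; rewrite !mulr_ge0 ?hn_ge0 ?(cP _).1.
have FD (B : bop H H) d : 0 <= d -> (forall j, hn (B (v j)) <= d) -> cn (F B) <= D * d.
  move=> d0 Bd; apply: le_trans (cn_sum _ _ _) _; rewrite mulr_suml ler_sum// => i _.
  apply: le_trans (cn_sum _ _ _) _; rewrite mulr_suml ler_sum// => j _.
  apply: le_trans (cn_inner_le _ _) _; rewrite -mulrA ler_wpM2l// mulrAC.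
  rewrite ler_wpM2r ?hn_ge0//; apply: le_trans ((cP (i, j)).2 _) _.
  by rewrite ler_wpM2l ?(cP _).1.
apply: cplx_ge0_approx => e e0.
pose d := e / (D + 1).
have d0 : 0 < d by rewrite divr_gt0//; lra.
pose W := \sum_j hn (v j) ^+ 2.
have W0 : 0 <= W by apply: sumr_ge0 => j _; rewrite sqr_ge0.
pose N := (Num.truncn ((W + 1) / d ^+ 2)).+1.
have Ngt : W + 1 < d ^+ 2 * N%:R.
  by rewrite -ltr_pdivrMl ?exprn_gt0// mulrC; exact: truncnS_gt.
(* Pigeonhole: if the sum exceeded d^2 for each k < N, adding up would give d^2 N <= W, against the
   choice of N. *)
have [k ak] : exists k, \sum_j hn (a k (v j)) ^+ 2 <= d ^+ 2.
  apply: contrapT => /forallNP h.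
  have : d ^+ 2 * N%:R <= W.
    apply: le_trans (_ : \sum_(k < N) \sum_j hn (a k (v j)) ^+ 2 <= _).
      rewrite (_ : d ^+ 2 * N%:R = \sum_(k < N) d ^+ 2); last first.
        by rewrite sumr_const card_ord mulr_natr.
      by apply: ler_sum => k _; have /negP := h k; rewrite -ltNge => /ltW.
    rewrite exchange_big /=; apply: ler_sum => j _.
    exact: sub_sqr_seq_sum.
  lra.
exists (F A - F (a k)) => //.
rewrite opprB addrC subrK; apply: le_trans (FD (a k) d (ltW d0) _) _.
  move=> j; rewrite -(@ler_pXn2r _ 2) ?nnegrE ?hn_ge0 ?(ltW d0)//.
  apply: le_trans ak; rewrite (bigD1 j)//= lerDl.
  by apply: sumr_ge0 => i _; rewrite sqr_ge0.
have -> : e = (D + 1) * d by rewrite /d; field; lra.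
by rewrite ler_wpM2r ?(ltW d0)//; lra.
Qed.

Lemma psd_mx_comm n (X : 'M[bop H H]_n) (A : bop H H) (v : 'I_n -> H) :
  psd A -> psd_mx X -> (forall i j, A \ob X i j = X i j \ob A) ->
  0 <= \sum_i \sum_j inner (X i j (A (v j))) (v i).
Proof.
move=> pA pX AX; have [c c0 cP] := psd_bounded A.
have := @psd_mx_comm_contr n X (rc c^-1 *: A) v.
have cc : rc c * rc c^-1 = 1 by rewrite -rcM divff ?gt_eqF// rc1.
move=> h; have {h} : 0 <= rc c * \sum_i \sum_j inner (X i j ((rc c^-1 *: A) (v j))) (v i).
  rewrite mulr_ge0 ?rc_ge0 ?(ltW c0)// h//.
  - by apply: symZ; exact: psd_sym.
  - move=> y; rewrite bopZE hiZl; apply/andP; split.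
      by rewrite mulr_ge0 ?psd_hi// invr_ge0 ltW.
    by rewrite ler_pdivrMl.
  - move=> i j; apply: bop_eqP => x; rewrite !(bcompE, bopZE) bopZ.
    by congr (_ *: _); rewrite -!bcompE AX.
rewrite mulr_sumr; under eq_bigr => i _ do rewrite mulr_sumr.
under eq_bigr => i _ do under eq_bigr => j _ do
  rewrite bopZE bopZ innerZl mulrA cc mul1r.
by [].
Qed.

Lemma psd_comm (A B : bop H H) :
  psd A -> psd B -> A \ob B = B \ob A -> psd (A \ob B).
Proof.
move=> pA pB AB x; rewrite AB.
have := @psd_mx_comm 1 (const_mx B) A (fun=> x) pA.
rewrite !big_ord1 mxE; apply=> [v|i j]; last by rewrite mxE.
by rewrite !big_ord1 mxE.
Qed.

End MatrixPositivity.

(** * Kernels and support projections *)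

Section Support.
Variable R : realType.
Variable H : hilb R.
Implicit Types (T : bop H H) (x y : H).

(** A vector orthogonal to the range lies in the kernel, hence is orthogonal to itself. On vectors
    x0 + T z, formulas involving an inverse of T become polynomial; the parallel sum and the limit
    of T_n are computed there. *)
Lemma ker_ran_dense T : sym T ->
  closure [set x | exists x0 z, T x0 = 0 /\ x = x0 + T z] = [set: H].
Proof.
move=> sT; apply: dense_orth.
  split; first by exists 0, 0; rewrite bop0 addr0.
  move=> a _ _ [x0 [z [Tx0 ->]]] [y0 [w [Ty0 ->]]].
  exists (a *: x0 + y0), (a *: z + w); split.
    by rewrite bopD bopZ Tx0 Ty0 scaler0 addr0.
  by rewrite bopD bopZ scalerDr addrACA.
move=> v vD; have Tv : T v = 0.
  apply: hi_eqP => z; rewrite hi0l sT /hi vD//.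
  by exists 0, z; rewrite bop0 add0r.
apply: hi_eqP => z; rewrite hi0l.
have h : hi v v = 0 by rewrite /hi vD//; exists v, 0; rewrite bop0 addr0.
have := hi_le v z; have := hi_le v (- z); rewrite hiNr.
have -> : hn v = 0 by apply/eqP; rewrite -sqrf_eq0 -hi_sqr h.
rewrite !mul0r; lra.
Qed.

Definition ker T := [set x | T x = 0].

Lemma subsp_ker T : subsp (ker T).
Proof.
split; first exact: bop0.
by move=> a x y /= Tx Ty; rewrite /ker /= bopD bopZ Tx Ty scaler0 addr0.
Qed.

Lemma closed_ker T x : closure (ker T) x -> ker T x.
Proof.
move=> /closureP h; apply: hn_eq0; apply/le_anti; rewrite hn_ge0 andbT.
apply/ler_addgt0Pl => e e0; rewrite addr0.
have [c c0 cP] := bop_bounded_gt0 T.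
have [|y Ty xy] := h (e / c); first by rewrite divr_gt0.
have -> : T x = T (x - y) by rewrite bopB Ty subr0.
by apply: le_trans (cP _) _; rewrite mulrC -ler_pdivlMr// ltW.
Qed.

(** With Q the projection onto the closed subspace ker T, the operator 1 - Q meets the
    specification, so the default of [xget] does not occur; the selected operator equals 1 - Q by
    uniqueness. *)
Lemma supp_projP T x : orthc (ker T) (supp_proj T x) /\ T (supp_proj T x) = T x.
Proof.
have [Q QP] := projection_ex (subsp_ker T) (@closed_ker T).
have spec : exists P : bop H H, forall x,
    orthc (ker T) (P x) /\ orthc (orthc (ker T)) (x - P x).
  exists (bid H - Q) => y; rewrite bopBE bidE; split; first exact: (QP y).2.
  move=> z zT; rewrite opprB addrC subrK inner_conj zT ?conjC0//.
  exact: (QP y).1.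
have /= /(_ x)[h1 h2] := xgetPex 0 spec; split=> //.
rewrite -/(proj_onto _) -/(supp_proj T) in h1 h2 *.
have Qx := (QP x).1; have xQ := (QP x).2.
have e : supp_proj T x = x - Q x.
  have d1 : orthc (ker T) (supp_proj T x - (x - Q x)).
    exact: subspB (subsp_orthc _) h1 xQ.
  have := h2 _ d1; rewrite inner_conj => /eqP; rewrite conjC_eq0 => /eqP h3.
  apply/eqP; rewrite -subr_eq0; apply/eqP/hn_eq0/eqP.
  rewrite -sqrf_eq0 -hi_sqr /hi {2}(_ : supp_proj T x - (x - Q x) = Q x - (x - supp_proj T x)); last first.
    by rewrite !opprB addrCA.
  by rewrite innerBr h3 subr0 (d1 _ Qx).
by rewrite e bopB Qx subr0.
Qed.

Lemma supp_proj_ker T x : T x = 0 -> supp_proj T x = 0.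
Proof.
move=> Tx; have [h1 h2] := supp_projP T x.
apply: hn_eq0; apply/eqP; rewrite -sqrf_eq0 -hi_sqr /hi h1//.
by rewrite /ker /= h2.
Qed.

Lemma supp_proj_id T x : orthc (ker T) x -> supp_proj T x = x.
Proof.
move=> xT; have [h1 h2] := supp_projP T x.
apply/eqP; rewrite -subr_eq0; apply/eqP/hn_eq0/eqP.
rewrite -sqrf_eq0 -hi_sqr /hi (subspB (subsp_orthc _) h1 xT)//.
by rewrite /ker /= bopB h2 subrr.
Qed.

Lemma supp_proj_idem T x : supp_proj T (supp_proj T x) = supp_proj T x.
Proof. by apply: supp_proj_id; have [] := supp_projP T x. Qed.

Lemma supp_proj_sym T : sym (supp_proj T).
Proof.
move=> x y.
have h u v : hi (supp_proj T u) (v - supp_proj T v) = 0.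
  rewrite /hi (supp_projP T u).1// /ker /= bopB.
  by rewrite (supp_projP T v).2 subrr.
have := h x y; have := h y x; rewrite !hiDr !hiNr.
rewrite (hiC x) (hiC (supp_proj T y) (supp_proj T x)); lra.
Qed.

Lemma supp_proj_ran T x : sym T -> supp_proj T (T x) = T x.
Proof.
move=> sT; apply: supp_proj_id => y Ty.
by rewrite sym_inner// Ty inner0r.
Qed.

Lemma supp_proj_eq0 T x : supp_proj T x = 0 -> T x = 0.
Proof. by move=> h; rewrite -(supp_projP T x).2 h bop0. Qed.

Lemma supp_rangeP T x : range (supp_proj T) x <-> supp_proj T x = x.
Proof. by split=> [[y _ <-]|h]; [exact: supp_proj_idem|exists x]. Qed.

End Support.

(** * Operators as a ring under composition *)

Section OperatorRing.
Variable R : realType.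
Variable H : hilb R.

Lemma bcompA (S T U : bop H H) : S \ob (T \ob U) = S \ob T \ob U.
Proof. exact: bop_eqP. Qed.
Lemma bcomp1l (T : bop H H) : bid H \ob T = T.
Proof. exact: bop_eqP. Qed.
Lemma bcomp1r (T : bop H H) : T \ob bid H = T.
Proof. exact: bop_eqP. Qed.
Lemma bcompDl (S T U : bop H H) : (S + T) \ob U = S \ob U + T \ob U.
Proof. exact: bop_eqP. Qed.
Lemma bcompDr (U S T : bop H H) : U \ob (S + T) = U \ob S + U \ob T.
Proof. by apply: bop_eqP => x; rewrite bcompE !bopDE bopD. Qed.

(** A ring that may be zero, since H = 0 is allowed. It brings powers, commutation lemmas and the
    binomial theorem for commuting elements. *)
HB.instance Definition _ := GRing.Zmodule_isPzRing.Build (bop H H)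
  bcompA bcomp1l bcomp1r bcompDl bcompDr.

Lemma bmulE (S T : bop H H) x : (S * T) x = S (T x). Proof. by []. Qed.

Lemma bpowE (T : bop H H) n : bpow T n = T ^+ n.
Proof. by elim: n => // n ih; rewrite exprS -ih. Qed.

Lemma bscaleAl (a : Cplx R) (S T : bop H H) : (a *: S) * T = a *: (S * T).
Proof. exact: bop_eqP. Qed.

Lemma bscaleAr (a : Cplx R) (S T : bop H H) : S * (a *: T) = a *: (S * T).
Proof. by apply: bop_eqP => x; rewrite !(bmulE, bopZE) bopZ. Qed.

Lemma bmulrnE (T : bop H H) n : T *+ n = rc n%:R *: T.
Proof. by rewrite rc_nat scaler_nat. Qed.

Lemma bscaleX (a : Cplx R) (T : bop H H) n : (a *: T) ^+ n = a ^+ n *: T ^+ n.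
Proof.
elim: n => [|n ih]; first by rewrite !expr0 scale1r.
by rewrite !exprS ih bscaleAl bscaleAr scalerA.
Qed.

Lemma bcomm_sum (S : bop H H) n (f : 'I_n -> bop H H) :
  (forall i, GRing.comm S (f i)) -> GRing.comm S (\sum_i f i).
Proof. by move=> h; rewrite /GRing.comm mulr_sumr mulr_suml; apply: eq_bigr => i _; exact: h. Qed.

Lemma bcommZ (S T : bop H H) a : GRing.comm S T -> GRing.comm S (a *: T).
Proof. by move=> h; rewrite /GRing.comm bscaleAl bscaleAr h. Qed.

Lemma psdX (T : bop H H) n : psd T -> psd (T ^+ n).
Proof.
move=> pT; elim: n => [|n ih]; first exact: psd_id.
by rewrite exprS; apply: psd_comm => //; apply: (@commrX _ T T n).
Qed.

Lemma symX (T : bop H H) n : sym T -> sym (T ^+ n).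
Proof.
move=> sT; elim: n => [|n ih]; first exact: sym_id.
by rewrite exprS; apply: symM => //; apply: (@commrX _ T T n).
Qed.

Lemma sym_sum n (f : 'I_n -> bop H H) : (forall i, sym (f i)) -> sym (\sum_i f i).
Proof.
move=> h; elim/big_ind: _ => // [|S T]; last exact: symD.
by move=> x y; rewrite hi0l hi0r.
Qed.

End OperatorRing.

(** * Weights of monomials in the Bernstein basis *)

Section BernsteinWeights.
Variable R : realType.

(** Coefficient of the k-th Bernstein polynomial of degree n in the expansion of x^i; it
    approximates (k / n)^i. *)
Definition ffr n i k : R := (k ^_ i)%:R / (n ^_ i)%:R.

(** Multiplied by l! (n - i - l)!, both sides become n!. *)
Lemma ffr_bin n i l : (i <= n)%N -> (l <= n - i)%N ->
  ('C(n - i, l) * n ^_ i = 'C(n, l + i) * (l + i) ^_ i)%N.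
Proof.
move=> ni lni; have lin : (l + i <= n)%N by rewrite addnC -leq_subRL.
apply/eqP; rewrite -(@eqn_pmul2r (l`! * (n - i - l)`!)) ?muln_gt0 ?fact_gt0//.
apply/eqP; rewrite mulnAC -mulnA mulnCA -!mulnA.
transitivity (n ^_ i * ('C(n - i, l) * (l`! * (n - i - l)`!)))%N; first lia.
rewrite bin_fact// ffact_fact//.
transitivity ('C(n, l + i) * (((l + i) ^_ i * (l + i - i)`!) * (n - (l + i))`!))%N.
  by rewrite ffact_fact ?leq_addl// bin_fact.
by rewrite addnK addnC -subnDA; lia.
Qed.

Lemma ffr01 n i k : (k <= n)%N -> (i <= n)%N -> 0 <= ffr n i k <= 1.
Proof.
move=> kn ni; have n0 : 0 < (n ^_ i)%:R :> R by rewrite ltr0n ffact_gt0.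
rewrite divr_ge0 ?ler0n//= ler_pdivrMr// mul1r ler_nat.
elim: i ni n0 => // i ih ni n0; rewrite !ffactnSr leq_mul ?leq_sub2r// ih ?(ltnW ni)//.
by rewrite ltr0n ffact_gt0 ltnW.
Qed.

(** Induction on i: the new factor (k - i) / (n - i) differs from k / n by at most i / n, all
    factors lie in [0, 1], and i^2 + i <= (i + 1)^2. *)
Lemma ffr_approx n i k : (0 < n)%N -> (k <= n)%N -> (i <= n)%N ->
  `|ffr n i k - (k%:R / n%:R) ^+ i| <= (i ^ 2)%:R / n%:R.
Proof.
move=> n0 kn; elim: i => [_|i ih ni].
  by rewrite /ffr !ffactn0 divr1 expr0 subrr normr0 divr_ge0.
have nR : 0 < n%:R :> R by rewrite ltr0n.
have niR : 0 < n%:R - i%:R :> R by rewrite subr_gt0 ltr_nat.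
have knR : k%:R <= n%:R :> R by rewrite ler_nat.
pose g : R := (k - i)%:R / (n - i)%:R.
pose q : R := k%:R / n%:R.
have -> : ffr n i.+1 k = ffr n i k * g.
  by rewrite /ffr /g !ffactnSr !natrM invfM; ring.
have q01 : 0 <= q <= 1 by rewrite divr_ge0//= ler_pdivrMr// mul1r.
have g01 : 0 <= g <= 1.
  rewrite divr_ge0//= ler_pdivrMr ?ltr0n ?subn_gt0// mul1r ler_nat.
  exact: leq_sub2r.
have gq : `|g - q| <= i%:R / n%:R.
  (* For k < i the truncated difference makes g zero, and k / n is itself at most i / n. *)
  have [ik|ki] := leqP i k.
    have -> : g - q = - (i%:R / n%:R * ((n%:R - k%:R) / (n%:R - i%:R))).
      by rewrite /g /q !natrB ?(ltnW ni)//; field; lra.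
    rewrite normrN ger0_norm; last by rewrite mulr_ge0 ?divr_ge0//; lra.
    rewrite ler_piMr ?divr_ge0// ler_pdivrMr// mul1r lerD2l lerN2 ler_nat//.
  rewrite /g (eqP (_ : k - i == 0)%N) ?mul0r ?sub0r ?normrN; last first.
    by rewrite subn_eq0 ltnW.
  by rewrite ger0_norm ?divr_ge0// ler_wpM2r ?invr_ge0// ler_nat ltnW.
rewrite exprSr -/q.
have -> : ffr n i k * g - q ^+ i * q = (ffr n i k - q ^+ i) * g + q ^+ i * (g - q).
  by ring.
apply: le_trans (ler_normD _ _) _; rewrite (normrM _ g) (normrM (q ^+ i)).
apply: le_trans (_ : (i ^ 2)%:R / n%:R + i%:R / n%:R <= _).
  case/andP: g01 => g0 g1; case/andP: q01 => q0 q1.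
  rewrite lerD//.
    rewrite (ger0_norm g0); apply: le_trans (ih (ltnW ni)).
    by rewrite ler_piMr.
  apply: le_trans gq; rewrite ler_piMl// ger0_norm ?exprn_ge0//.
  by rewrite exprn_ile1.
by rewrite -mulrDl ler_wpM2r ?invr_ge0// -natrD ler_nat; lia.
Qed.

End BernsteinWeights.

(** * Lower bounds for polynomials in two commuting positive operators *)

Section PolynomialPositivity.
Variable R : realType.
Variable H : hilb R.
Implicit Types (A B T : bop H H) (c : nat -> nat -> R).

Definition bern A n k : bop H H := rc 'C(n, k)%:R *: (A ^+ k * (1 - A) ^+ (n - k)).

Lemma comm_1B A : GRing.comm A (1 - A).
Proof. by apply: commrB => //; exact: commr1. Qed.

(** Binomial theorem for (1 - A + A)^(n - i) A^i; the terms with k < i carry a vanishing falling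
    factorial, so the sum effectively starts at i. *)
Lemma bern_moment A n i : (i <= n)%N ->
  A ^+ i = \sum_(k < n.+1) rc (ffr R n i k) *: bern A n k.
Proof.
move=> ni; rewrite -(big_mkord xpredT (fun k => rc (ffr R n i k) *: bern A n k)).
rewrite (big_cat_nat (n := i)) ?(leqW ni)//= [X in X + _]big1_seq ?add0r; last first.
  move=> k /andP[_]; rewrite mem_index_iota => /andP[_ ki].
  by rewrite /ffr ffact_small// mul0r scale0r.
rewrite -[X in \sum_(X <= _ < _) _]add0n big_addn subSn// big_mkord.
have -> : A ^+ i = (1 - A + A) ^+ (n - i) * A ^+ i.
  by rewrite subrK expr1n mul1r.
have c1 : GRing.comm (1 - A) A by apply/commr_sym/comm_1B.
rewrite (exprDn_comm _ c1) mulr_suml; apply: eq_bigr => l _.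
rewrite /bern scalerA -rcM bmulrnE bscaleAl.
have lni : (l <= n - i)%N by rewrite -ltnS.
have -> : ffr R n i (l + i) * 'C(n, l + i)%:R = 'C(n - i, l)%:R.
  rewrite /ffr mulrAC -natrM mulnC -ffr_bin// natrM mulfK//.
  by rewrite pnatr_eq0 -lt0n ffact_gt0.
congr (_ *: _); rewrite -mulrA -exprD addnC subnDA addnC subnAC.
by rewrite (commrX _ (commr_sym (commrX _ c1))) // .
Qed.

Lemma bern_psd A n k : psd A -> psd (1 - A) -> psd (bern A n k).
Proof.
move=> pA p1A; apply: psdZ; first exact: ler0n.
apply: psd_comm; [exact: psdX|exact: psdX|].
exact: (commrX _ (commr_sym (commrX _ (commr_sym (comm_1B A))))).
Qed.

Lemma bern_comm A S n k : GRing.comm S A -> GRing.comm S (bern A n k).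
Proof.
move=> SA; apply: bcommZ; apply: commrM; first exact: commrX.
by apply/commrX/commrB => //; exact: commr1.
Qed.

Definition pop m c A B : bop H H :=
  \sum_(i < m) \sum_(j < m) rc (c i j) *: (A ^+ i * B ^+ j).

Definition peval m c (r s : R) : R :=
  \sum_(i < m) \sum_(j < m) c i j * r ^+ i * s ^+ j.

Lemma hi_suml (I : Type) (r : seq I) (Q : pred I) (f : I -> H) x :
  hi (\sum_(i <- r | Q i) f i) x = \sum_(i <- r | Q i) hi (f i) x.
Proof. by rewrite /hi inner_suml Re_sum. Qed.

(** Products of Bernstein operators of A and B are positive and sum to 1, and p(A, B) is their
    combination with coefficients close to p(k / n, l / n). A lower bound of p on the unit square
    thus holds for p(A, B) up to K / n, with n arbitrary. *)
Lemma pop_ge_unit m c A B e x : psd A -> psd B -> psd (1 - A) -> psd (1 - B) ->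
  GRing.comm A B ->
  (forall r s, 0 <= r <= 1 -> 0 <= s <= 1 -> - e <= peval m c r s) ->
  - e * hn x ^+ 2 <= hi (pop m c A B x) x.
Proof.
move=> pA pB p1A p1B AB cpos.
(* K / n adds up the errors i^2 / n and j^2 / n of [ffr_approx], weighted by |c i j|. *)
pose K := \sum_(i < m) \sum_(j < m) `|c i j| * (i ^ 2 + j ^ 2)%:R.
have K0 : 0 <= K by apply: sumr_ge0 => i _; apply: sumr_ge0 => j _; rewrite mulr_ge0.
suff main n : (0 < n)%N -> (m <= n)%N ->
    - (e + K / n%:R) * hn x ^+ 2 <= hi (pop m c A B x) x.
  apply/ler_addgt0Pl => d d0.
  pose n := (maxn m (Num.truncn (K * hn x ^+ 2 / d)).+1).
  have n0 : (0 < n)%N by rewrite leq_max orbT.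
  have mn : (m <= n)%N by rewrite leq_max leqnn.
  have := main n n0 mn.
  have : K / n%:R * hn x ^+ 2 <= d.
    rewrite mulrAC ler_pdivrMr ?ltr0n// -ler_pdivrMl// mulrC.
    apply: le_trans (ltW (truncnS_gt _)) _.
    by rewrite ler_nat leq_max leqnn orbT.
  lra.
move=> n0 mn.
pose w (k l : nat) := hi ((bern A n k * bern B n l) x) x.
have w0 k l : 0 <= w k l.
  apply: psd_hi; apply: psd_comm; [exact: bern_psd|exact: bern_psd|].
  exact/bern_comm/commr_sym/bern_comm/commr_sym.
have mom i j : (i <= n)%N -> (j <= n)%N -> hi ((A ^+ i * B ^+ j) x) x =
    \sum_(k < n.+1) \sum_(l < n.+1) ffr R n i k * ffr R n j l * w k l.
  move=> ni nj; rewrite (bern_moment A ni) (bern_moment B nj).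
  rewrite mulr_suml bop_sumE hi_suml; apply: eq_bigr => k _.
  rewrite mulr_sumr bop_sumE hi_suml; apply: eq_bigr => l _.
  by rewrite bscaleAl bscaleAr scalerA -rcM bopZE hiZl.
have wsum : hn x ^+ 2 = \sum_(k < n.+1) \sum_(l < n.+1) w k l.
  rewrite -hi_sqr -[in LHS](_ : (A ^+ 0 * B ^+ 0) x = x) ?mom//.
  by apply: eq_bigr => k _; apply: eq_bigr => l _; rewrite /ffr !ffactn0 divr1 !mul1r.
have -> : hi (pop m c A B x) x = \sum_(k < n.+1) \sum_(l < n.+1)
    (\sum_(i < m) \sum_(j < m) c i j * (ffr R n i k * ffr R n j l)) * w k l.
  rewrite /pop bop_sumE hi_suml.
  transitivity (\sum_(i < m) \sum_(j < m) \sum_(k < n.+1) \sum_(l < n.+1)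
      c i j * (ffr R n i k * ffr R n j l) * w k l).
    apply: eq_bigr => i _; rewrite bop_sumE hi_suml; apply: eq_bigr => j _.
    rewrite bopZE hiZl mom; last 2 first.
    - exact: leq_trans (ltnW (ltn_ord i)) mn.
    - exact: leq_trans (ltnW (ltn_ord j)) mn.
    rewrite mulr_sumr; apply: eq_bigr => k _; rewrite mulr_sumr.
    by apply: eq_bigr => l _; rewrite mulrA.
  under eq_bigr => i _ do rewrite exchange_big/=.
  rewrite exchange_big/=; apply: eq_bigr => k _.
  under eq_bigr => i _ do rewrite exchange_big/=.
  rewrite exchange_big/=; apply: eq_bigr => l _.
  by rewrite mulr_suml; apply: eq_bigr => i _; rewrite mulr_suml.
rewrite wsum mulr_sumr ler_sum// => k _; rewrite mulr_sumr ler_sum// => l _.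
rewrite ler_wpM2r//.
have kn : (k <= n)%N by rewrite -ltnS.
have ln : (l <= n)%N by rewrite -ltnS.
have nR : 0 < n%:R :> R by rewrite ltr0n.
have q01 (p : nat) : (p <= n)%N -> 0 <= (p%:R / n%:R : R) <= 1.
  by move=> pn; rewrite divr_ge0//= ler_pdivrMr// mul1r ler_nat.
have := cpos _ _ (q01 _ kn) (q01 _ ln).
suff : peval m c (k%:R / n%:R) (l%:R / n%:R) -
    \sum_(i < m) \sum_(j < m) c i j * (ffr R n i k * ffr R n j l) <= K / n%:R by lra.
rewrite /peval -sumrB /K mulr_suml ler_sum// => i _.
rewrite -sumrB mulr_suml ler_sum// => j _.
have im : (i <= n)%N by apply: leq_trans mn; exact: ltnW.
have jm : (j <= n)%N by apply: leq_trans mn; exact: ltnW.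
rewrite -mulrA -mulrBr; apply: le_trans (ler_norm _) _; rewrite normrM -mulrA.
rewrite ler_wpM2l//.
have := ffr_approx R n0 kn im; have := ffr_approx R n0 ln jm.
have /andP[f0 f1] := ffr01 R ln jm; have /andP[g0 g1] := q01 _ kn.
set f := ffr _ n j l in f0 f1 *; set f' := ffr _ n i k.
set p := k%:R / n%:R in g0 g1 *; set q := l%:R / n%:R => h1 h2.
have -> : p ^+ i * q ^+ j - f' * f = p ^+ i * (q ^+ j - f) + (p ^+ i - f') * f by ring.
rewrite natrD (mulrDl _ _ n%:R^-1) [leRHS]addrC; apply: le_trans (ler_normD _ _) _; rewrite lerD//.
  rewrite (normrM (p ^+ i)); apply: le_trans h1; rewrite distrC.
  by rewrite ler_piMl// ger0_norm ?exprn_ge0// exprn_ile1.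
rewrite (normrM _ f); apply: le_trans h2; rewrite distrC.
by rewrite ler_piMr// ger0_norm.
Qed.

(** The functional calculus admits any a with A <= a. A negative a forces H = 0, and a = 0 forces A
    = 0; in both cases A1 = 0 serves, otherwise A1 = A / a. *)
Lemma psd_scale A a : psd A -> op_le A (rc a *: bid H) ->
  exists A1, [/\ psd A1, psd (1 - A1), A = rc a *: A1, 0 <= a \/ (forall x : H, x = 0) &
    forall S, GRing.comm S A -> GRing.comm S A1].
Proof.
move=> pA Aa.
have Aah x : hi (A x) x <= a * hn x ^+ 2.
  by have := op_le_hi x Aa; rewrite bopZE hiZl bidE hi_sqr.
have [a0|a0|a0] := ltrgtP a 0.
- have H0 (x : H) : x = 0.
    apply: hn_eq0; apply/eqP; rewrite -sqrf_eq0.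
    have := psd_hi x pA; have := Aah x; rewrite eq_le sqr_ge0 andbT => h1 h2.
    rewrite leNgt; apply/negP => x0; have : a * hn x ^+ 2 < 0 by rewrite nmulr_rlt0.
    lra.
  exists 0; split.
  + exact: psd0.
  + by rewrite subr0; exact: psd_id.
  + by apply: bop_eqP => x; rewrite (H0 x) !bop0.
  + by right.
  + by move=> S _; exact: commr0.
- exists (rc a^-1 *: A); split.
  + by apply: psdZ => //; rewrite invr_ge0 ltW.
  + apply: (@psd_op_le _ _ (rc a^-1 *: A) (bid H)); [|exact: sym_id|].
      by apply: symZ; exact: psd_sym.
    by move=> x; rewrite bopZE hiZl bidE hi_sqr ler_pdivrMl.
  + by rewrite scalerA -rcM divff ?gt_eqF// rc1 scale1r.
  + by left.
  + by move=> S SA; apply: bcommZ.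
- exists 0; split.
  + exact: psd0.
  + by rewrite subr0; exact: psd_id.
  + rewrite scaler0; apply: bop_eqP => x; apply: psd_ker => //.
    by apply/le_anti; rewrite psd_hi// andbT; have := Aah x; rewrite a0 mul0r.
  + by left.
  + by move=> S _; exact: commr0.
Qed.

Lemma pop_ge m c A B a b e x : psd A -> psd B ->
  op_le A (rc a *: bid H) -> op_le B (rc b *: bid H) -> GRing.comm A B ->
  (forall r s, 0 <= r <= a -> 0 <= s <= b -> - e <= peval m c r s) ->
  - e * hn x ^+ 2 <= hi (pop m c A B x) x.
Proof.
move=> pA pB /(psd_scale pA)[A1 [pA1 p1A1 AE a0 A1c]].
move=> /(psd_scale pB)[B1 [pB1 p1B1 BE b0 B1c]] AB cpos.
case: a0 => [a0|z]; last by rewrite (z x) bop0 hi0l hn0 expr0n mulr0.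
case: b0 => [b0|z]; last by rewrite (z x) bop0 hi0l hn0 expr0n mulr0.
have -> : pop m c A B = pop m (fun i j => c i j * a ^+ i * b ^+ j) A1 B1.
  apply: eq_bigr => i _; apply: eq_bigr => j _.
  by rewrite AE BE !bscaleX bscaleAl bscaleAr !scalerA -!rcX -!rcM.
apply: pop_ge_unit => //; first exact/B1c/commr_sym/A1c/commr_sym.
move=> r s /andP[r0 r1] /andP[s0 s1].
have := cpos (a * r) (b * s); rewrite !mulr_ge0// !ler_piMr//= => /(_ isT isT).
congr (_ <= _); apply: eq_bigr => i _; apply: eq_bigr => j _.
by rewrite !exprMn; ring.
Qed.

End PolynomialPositivity.

(** * Bivariate polynomials evaluated at operators *)

Section BivariatePolynomials.
Variable R : realType.
Variable H : hilb R.
Implicit Types (A B T : bop H H) (p q : {poly {poly R}}).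

(** A common bound for both degrees turns [poly2_op] into a sum over a square, so that different
    polynomials are compared term by term. *)
Definition size2_le p m := (size p <= m)%N /\ forall i, (size (p`_i)%R <= m)%N.

Lemma size2_ex p : exists m0, forall m, (m0 <= m)%N -> size2_le p m.
Proof.
exists (maxn (size p) (\max_(i < size p) size (p`_i)%R)) => m.
rewrite geq_max => /andP[h1 h2]; split=> // i.
have [ip|pi] := ltnP i (size p); last by rewrite nth_default// size_poly0.
apply: leq_trans h2.
exact: (@leq_bigmax _ (fun i : 'I_(size p) => size (p`_i)%R) (Ordinal ip)).
Qed.

Lemma poly2_opE p A B m : size2_le p m ->
  poly2_op p A B = pop m (fun i j => p`_i`_j) A B.
Proof.
move=> [sp spi]; rewrite /poly2_op /pop.
have inner_eq i : \sum_(j < size p`_i) rc p`_i`_j *: (bpow A i \ob bpow B j) =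
    \sum_(j < m) rc p`_i`_j *: (A ^+ i * B ^+ j).
  rewrite (big_ord_widen _ (fun j => rc p`_i`_j *: (bpow A i \ob bpow B j)) (spi i)).
  rewrite big_mkcond /=; apply: eq_bigr => j _; rewrite !bpowE; case: ltnP => // h.
  by rewrite [p`_i`_j]nth_default// rc0 scale0r.
under eq_bigr => i _ do rewrite inner_eq.
rewrite (big_ord_widen _ (fun i => \sum_(j < m) rc p`_i`_j *: (A ^+ i * B ^+ j)) sp).
rewrite big_mkcond /=; apply: eq_bigr => i _; case: ltnP => // h.
by rewrite big1// => j _; rewrite [p`_i]nth_default// coef0 rc0 scale0r.
Qed.

Lemma horner2E p m r s : size2_le p m ->
  p.[r, s] = peval m (fun i j => p`_i`_j) r s.
Proof.
move=> [sp spi]; rewrite (horner_coef_wide _ sp) horner_sum; apply: eq_bigr => i _.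
rewrite hornerM horner_exp hornerC (horner_coef_wide _ (spi i)) mulr_suml.
by apply: eq_bigr => j _; rewrite -!mulrA [s ^+ j * _]mulrC.
Qed.

Lemma poly2_op_ge p A B a b e x : psd A -> psd B ->
  op_le A (rc a *: bid H) -> op_le B (rc b *: bid H) -> GRing.comm A B ->
  (forall r s, 0 <= r <= a -> 0 <= s <= b -> - e <= p.[r, s]) ->
  - e * hn x ^+ 2 <= hi (poly2_op p A B x) x.
Proof.
move=> pA pB Aa Bb AB pe; have [m /(_ m (leqnn m)) sm] := size2_ex p.
rewrite (poly2_opE _ _ sm); apply: (pop_ge x pA pB Aa Bb AB) => r s r0 s0.
by rewrite -horner2E// pe.
Qed.

Lemma poly2_opD p q A B : poly2_op (p + q) A B = poly2_op p A B + poly2_op q A B.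
Proof.
have [m1 h1] := size2_ex p; have [m2 h2] := size2_ex q.
have [m3 h3] := size2_ex (p + q).
pose m := maxn m1 (maxn m2 m3).
have [l1 l2 l3] : [/\ m1 <= m, m2 <= m & m3 <= m]%N by rewrite /m; split; lia.
rewrite (poly2_opE _ _ (h1 m l1)) (poly2_opE _ _ (h2 m l2)) (poly2_opE _ _ (h3 m l3)).
rewrite /pop -big_split; apply: eq_bigr => i _ /=; rewrite -big_split.
by apply: eq_bigr => j _ /=; rewrite !coefD rcD scalerDl.
Qed.

Lemma poly2_opN p A B : poly2_op (- p) A B = - poly2_op p A B.
Proof.
apply/eqP; rewrite -addr_eq0 -poly2_opD addNr /poly2_op.
by rewrite size_poly0 big_ord0.
Qed.

Lemma poly2_opB p q A B : poly2_op (p - q) A B = poly2_op p A B - poly2_op q A B.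
Proof. by rewrite poly2_opD poly2_opN. Qed.

Lemma poly2_op1 A B : poly2_op 1 A B = 1.
Proof.
rewrite (@poly2_opE 1 A B 1%N).
  rewrite /pop !big_ord1 -[1]/(1%:P%:P) !coefC /=.
  by rewrite rc1 scale1r expr0 mulr1.
split; first by rewrite size_poly1.
by move=> i; rewrite -[1]/(1%:P) coefC; case: eqP; rewrite ?size_poly1 ?size_poly0.
Qed.

(** Together with [poly2_opYM] this is all the multiplicativity behind the relation (r + s) g = r s,
    which is affine in the approximant of g. *)
Lemma poly2_opXM p A B : poly2_op ('X * p) A B = A * poly2_op p A B.
Proof.
have [m1 h1] := size2_ex p; have [m2 h2] := size2_ex ('X * p).
pose m := maxn m1 m2.
have [l1 l2] : (m1 <= m /\ m2 <= m.+1)%N by rewrite /m; lia.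
have [sp spi] := h1 m l1.
have h1' : size2_le p m.+1 by split; [exact: leqW|move=> i; exact: leqW].
rewrite (poly2_opE _ _ (h2 _ l2)) (poly2_opE _ _ h1') /pop.
rewrite big_ord_recl [X in X + _]big1 ?add0r; last first.
  by move=> j _; rewrite coefXM coef0 rc0 scale0r.
rewrite [in RHS]big_ord_recr/= [X in _ * (_ + X)]big1 ?addr0; last first.
  by move=> j _; rewrite [p`_m]nth_default// coef0 rc0 scale0r.
rewrite mulr_sumr; apply: eq_bigr => i _; rewrite mulr_sumr; apply: eq_bigr => j _.
by rewrite coefXM/= bscaleAr exprS !mulrA.
Qed.

Lemma poly2_opYM p A B : GRing.comm A B ->
  poly2_op ('X%:P * p) A B = B * poly2_op p A B.
Proof.
move=> AB; have [m1 h1] := size2_ex p; have [m2 h2] := size2_ex ('X%:P * p).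
pose m := maxn m1 m2.
have [l1 l2] : (m1 <= m /\ m2 <= m.+1)%N by rewrite /m; lia.
have [sp spi] := h1 m l1.
have h1' : size2_le p m.+1 by split; [exact: leqW|move=> i; exact: leqW].
rewrite (poly2_opE _ _ (h2 _ l2)) (poly2_opE _ _ h1') /pop.
rewrite mulr_sumr; apply: eq_bigr => i _.
rewrite big_ord_recl coefCM coefXM rc0 scale0r add0r.
rewrite [in RHS]big_ord_recr/= [X in _ * (_ + X)](_ : _ = 0) ?addr0; last first.
  by rewrite [p`_i`_m]nth_default// rc0 scale0r.
rewrite mulr_sumr; apply: eq_bigr => j _.
rewrite coefXM/= bscaleAr exprS !mulrA.
by rewrite add0n (commrX i (commr_sym AB)).
Qed.

Lemma poly2_op_comm p A B S : GRing.comm S A -> GRing.comm S B ->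
  GRing.comm S (poly2_op p A B).
Proof.
move=> SA SB; have [m /(_ m (leqnn m)) sm] := size2_ex p.
rewrite (poly2_opE _ _ sm); apply: bcomm_sum => i; apply: bcomm_sum => j.
by apply: bcommZ; apply: commrM; exact: commrX.
Qed.

Lemma poly2_op_sym p A B : sym A -> sym B -> GRing.comm A B -> sym (poly2_op p A B).
Proof.
move=> sA sB AB; have [m /(_ m (leqnn m)) sm] := size2_ex p.
rewrite (poly2_opE _ _ sm); apply: sym_sum => i; apply: sym_sum => j.
apply: symZ; apply: symM; [exact: symX|exact: symX|].
exact: (commrX _ (commr_sym (commrX _ (commr_sym AB)))).
Qed.

End BivariatePolynomials.

(** * Properties of g(A, B) inherited from polynomial approximants *)

Section ParallelSumOperator.
Variable R : realType.
Variable H : hilb R.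
Implicit Types (A B T : bop H H).

(* These properties characterize g(A, B), where g = par_fun. *)
Definition is_par_op A B T := [/\ psd T, op_le T A, op_le T B,
  (A + B) \ob T = A \ob B &
  forall S, S \ob A = A \ob S -> S \ob B = B \ob S -> S \ob T = T \ob S].

Lemma le_eps (a b K : R) : (forall e : R, 0 < e -> a <= b + K * e) -> a <= b.
Proof.
move=> h; apply/ler_addgt0Pl => e e0.
have K0 : 0 < `|K| + 1 by rewrite ltr_wpDl.
have := h (e / (`|K| + 1)); rewrite divr_gt0// => /(_ isT).
have : K * (e / (`|K| + 1)) <= e.
  apply: le_trans (_ : (`|K| + 1) * (e / (`|K| + 1)) <= _).
    by rewrite ler_wpM2r ?divr_ge0 ?ltW//; have := ler_norm K; lra.
  by rewrite mulrC divfK// gt_eqF.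
lra.
Qed.

Lemma hn_eps (x : H) K : (forall e : R, 0 < e -> hn x <= K * e) -> x = 0.
Proof.
move=> h; apply: hn_eq0; apply/le_anti; rewrite hn_ge0 andbT.
by apply: (@le_eps _ _ K) => e e0; rewrite add0r h.
Qed.

Lemma sym_eq0 T : sym T -> (forall x, hi (T x) x = 0) -> T = 0.
Proof.
move=> sT h; apply: bop_eqP => x; rewrite bop0E; apply: psd_ker => //.
by apply/psdP; split=> // y; rewrite h.
Qed.

Lemma par_fun_ge0 (r s : R) : 0 <= r -> 0 <= s -> 0 <= par_fun r s.
Proof. by move=> r0 s0; rewrite divr_ge0 ?mulr_ge0 ?addr_ge0. Qed.

Lemma par_fun_le (r s : R) : 0 <= r -> 0 <= s -> par_fun r s <= r.
Proof.
move=> r0 s0; have : 0 <= r + s by rewrite addr_ge0.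
rewrite le_eqVlt => /orP[/eqP rs|rs]; first by rewrite /par_fun -rs invr0 mulr0.
by rewrite /par_fun ler_pdivrMr// ler_wpM2l// lerDr.
Qed.

Lemma par_funC (r s : R) : par_fun r s = par_fun s r.
Proof. by rewrite /par_fun [r * s]mulrC [r + s]addrC. Qed.

Lemma par_funM (r s : R) : 0 <= r -> 0 <= s -> (r + s) * par_fun r s = r * s.
Proof.
move=> r0 s0; have : 0 <= r + s by rewrite addr_ge0.
rewrite le_eqVlt => /orP[/eqP rs|rs]; last by rewrite /par_fun; field; lra.
by rewrite -rs mul0r (_ : r = 0) ?mul0r//; lra.
Qed.

(** An inequality for g on the rectangle holds for p n up to a multiple of e, passes to operators by
    [poly2_op_ge], and then to the norm limit T. The product relation comes out as two opposite
    inequalities for a symmetric operator; symmetry and commutation are direct norm limits. *)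
Lemma is_funcalc2_par A B T : psd A -> psd B -> A \ob B = B \ob A ->
  is_funcalc2 (@par_fun R) A B T -> is_par_op A B T.
Proof.
move=> pA pB AB [a [b [Aa Bb [p pu pT]]]].
have sA := psd_sym pA; have sB := psd_sym pB.
have appr e : 0 < e -> exists2 n,
    (forall r s, 0 <= r <= a -> 0 <= s <= b -> `|(p n).[r, s] - par_fun r s| <= e) &
    forall x, hn (poly2_op (p n) A B x - T x) <= e * hn x.
  move=> e0; have [N1 _ h1] := pu e e0; have [N2 _ h2] := pT e e0.
  exists (maxn N1 N2); first by move=> r s; apply: (h1 (maxn N1 N2)); exact: leq_maxl.
  move=> x; have := h2 (maxn N1 N2) (leq_maxr _ _) x.
  by rewrite !hnE -rcM rc_le.
have comm S : S \ob A = A \ob S -> S \ob B = B \ob S -> S \ob T = T \ob S.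
  move=> SA SB; apply: bop_eqP => x; apply/eqP; rewrite -subr_eq0; apply/eqP.
  have [c c0 cP] := bop_bounded S.
  apply: (@hn_eps _ (c * hn x + hn (S x))) => e e0; have [n _ nT] := appr e e0.
  have SP : S (poly2_op (p n) A B x) = poly2_op (p n) A B (S x).
    by rewrite -bmulE (poly2_op_comm (p n) SA SB).
  rewrite !bcompE.
  have -> : S (T x) - T (S x) = (poly2_op (p n) A B (S x) - T (S x))
      - S (poly2_op (p n) A B x - T x).
    by rewrite bopB SP opprB [RHS]addrC subrKA.
  apply: le_trans (hnD _ _) _; rewrite hnN addrC mulrDl lerD//.
    apply: le_trans (cP _) _; rewrite -mulrA ler_wpM2l// mulrC.
    exact: nT.
  by rewrite mulrC nT.
have sT : sym T.
  move=> x y; apply/eqP; rewrite -subr_eq0 -normr_le0.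
  apply: (@le_eps _ _ (2 * (hn x * hn y))) => e e0; have [n _ nT] := appr e e0.
  have := poly2_op_sym (p n) sA sB AB x y => sP.
  have -> : hi (T x) y - hi x (T y) =
      hi x (poly2_op (p n) A B y - T y) - hi (poly2_op (p n) A B x - T x) y.
    by rewrite !hiDr !hiDl !hiNl !hiNr sP; lra.
  rewrite add0r; apply: le_trans (ler_normB _ _) _.
  rewrite -mulrA mulr_natl mulr2n lerD//.
    apply: le_trans (abs_hi_le _ _) _; rewrite -mulrA ler_wpM2l ?hn_ge0// mulrC.
    exact: nT.
  apply: le_trans (abs_hi_le _ _) _; rewrite mulrAC ler_wpM2r ?hn_ge0// mulrC.
  exact: nT.
(* A bound on the rectangle for q(p_n) passes to the limit. *)
have lim (S : bop H H) (F : {poly {poly R}} -> {poly {poly R}}) k c : 0 <= c ->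
    (forall x n e, 0 < e ->
      (forall y, hn (poly2_op (p n) A B y - T y) <= e * hn y) ->
      hi (S x) x >= hi (poly2_op (F (p n)) A B x) x - c * e * hn x ^+ 2) ->
    (forall n e r s, 0 < e -> 0 <= r <= a -> 0 <= s <= b ->
      `|(p n).[r, s] - par_fun r s| <= e -> - (k * e) <= (F (p n)).[r, s]) ->
    forall x, 0 <= hi (S x) x.
  move=> c0 h1 h2 x; apply: (@le_eps _ _ ((c + k) * hn x ^+ 2)) => e e0.
  have [n nu nT] := appr e e0; have := h1 x n e e0 nT.
  have := @poly2_op_ge _ _ (F (p n)) A B a b (k * e) x pA pB Aa Bb AB.
  move=> /(_ (fun r s r0 s0 => h2 n e r s e0 r0 s0 (nu r s r0 s0))); lra.
have opX : poly2_op 'X A B = A by rewrite -['X]mulr1 poly2_opXM poly2_op1 mulr1.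
have opY : poly2_op 'X%:P A B = B by rewrite -['X%:P]mulr1 poly2_opYM// poly2_op1 mulr1.
have close (D : bop H H) e x : (forall y, hn (D y) <= e * hn y) ->
    `|hi (D x) x| <= e * hn x ^+ 2.
  move=> De; apply: le_trans (abs_hi_le _ _) _; rewrite expr2 mulrA.
  by rewrite ler_wpM2r ?hn_ge0.
have T0 x : 0 <= hi (T x) x.
  apply: (@lim T id 1 1) => // [y n e e0 nT|n e r s e0 /andP[r0 _] /andP[s0 _]].
    have := close (poly2_op (p n) A B - T) e y nT.
    by rewrite ler_norml bopBE hiDl hiNl => /andP[_]; lra.
  by rewrite ler_norml => /andP[]; have := par_fun_ge0 r0 s0; lra.
have TA x : 0 <= hi ((A - T) x) x.
  apply: (@lim (A - T) (fun q => 'X - q) 1 1) => // [y n e e0 nT|n e r s e0 /andP[r0 _] /andP[s0 _]].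
    have := close (poly2_op (p n) A B - T) e y nT.
    rewrite ler_norml poly2_opB opX !bopBE !hiDl !hiNl => /andP[]; lra.
  rewrite ler_norml => /andP[]; rewrite !hornerE.
  by have := par_fun_le r0 s0; lra.
have TB x : 0 <= hi ((B - T) x) x.
  apply: (@lim (B - T) (fun q => 'X%:P - q) 1 1) => // [y n e e0 nT|n e r s e0 /andP[r0 _] /andP[s0 _]].
    have := close (poly2_op (p n) A B - T) e y nT.
    rewrite ler_norml poly2_opB opY !bopBE !hiDl !hiNl => /andP[]; lra.
  rewrite ler_norml => /andP[]; rewrite !hornerE.
  by have := par_fun_le s0 r0; rewrite par_funC; lra.
have [c c0 cP] := bop_bounded (A + B).
have TAc : T \ob A = A \ob T by rewrite -comm.
have TBc : T \ob B = B \ob T by rewrite -comm.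
have closeC n e x : (forall y, hn (poly2_op (p n) A B y - T y) <= e * hn y) ->
   `|hi (((A + B) * (poly2_op (p n) A B - T)) x) x| <= c * e * hn x ^+ 2.
  move=> nT; apply: close => y; apply: le_trans (cP _) _.
  by rewrite -mulrA ler_wpM2l// nT.
have opF n x : hi (poly2_op (('X + 'X%:P) * p n - 'X * 'X%:P) A B x) x =
    hi (((A + B) * (poly2_op (p n) A B - T)) x) x + hi (((A + B) \ob T - A \ob B) x) x.
  rewrite poly2_opB mulrDl poly2_opD poly2_opXM poly2_opYM// poly2_opXM opY.
  rewrite !(bopBE, bopDE, bmulE, bcompE) !bopB !hiE; ring.
(* Here (r + s) p - r s = (r + s) (p - g), and r + s <= a + b. *)
have Fbd n e r s : 0 < e -> 0 <= r <= a -> 0 <= s <= b ->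
    `|(p n).[r, s] - par_fun r s| <= e ->
    `|(('X + 'X%:P) * p n - 'X * 'X%:P).[r, s]| <= (a + b) * e.
  move=> e0 /andP[r0 ra] /andP[s0 sb] h.
  have -> : (('X + 'X%:P) * p n - 'X * 'X%:P).[r, s] = (r + s) * ((p n).[r, s] - par_fun r s).
    by rewrite mulrBr par_funM// !hornerE.
  rewrite normrM.
  by rewrite ler_pM// ger0_norm ?addr_ge0// lerD.
have eqT : (A + B) \ob T = A \ob B.
  apply/eqP; rewrite -subr_eq0; apply/eqP/sym_eq0.
    apply: symB; last exact: symM.
    apply: symM => //; first exact: symD.
    by apply: bop_eqP => x; rewrite !(bcompE, bopDE) bopD -!bcompE TAc TBc.
  move=> x; apply/le_anti/andP; split.
    rewrite -oppr_ge0 -hiNl.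
    apply: (@lim (- ((A + B) \ob T - A \ob B)) (fun q => - (('X + 'X%:P) * q - 'X * 'X%:P)) (a + b) c) => //.
      move=> y n e e0 nT; have := closeC n e y nT.
      by rewrite poly2_opN !bopNE !hiNl opF ler_norml => /andP[]; lra.
    move=> n e r s e0 ra sb h; have := Fbd n e r s e0 ra sb h.
    by rewrite ler_norml !hornerN => /andP[]; lra.
  apply: (@lim ((A + B) \ob T - A \ob B) (fun q => ('X + 'X%:P) * q - 'X * 'X%:P) (a + b) c) => //.
    move=> y n e e0 nT; have := closeC n e y nT.
    by rewrite opF ler_norml => /andP[]; lra.
  move=> n e r s e0 ra sb h; have := Fbd n e r s e0 ra sb h.
  by rewrite ler_norml => /andP[]; lra.
split=> //.
- exact/psdP.
- by apply/psdP; split=> //; exact: symB.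
- by apply/psdP; split=> //; exact: symB.
Qed.

End ParallelSumOperator.

(** * Existence of g(A, B) *)

Section ParallelSumExistence.
Variable R : realType.
Variable H : hilb R.
Implicit Types (A B T : bop H H).

Lemma bop_norm_cauchy (P : nat -> bop H H) :
  (forall e : R, 0 < e -> exists N, forall m n, (N <= m)%N -> (N <= n)%N ->
     forall x, hn (P m x - P n x) <= e * hn x) ->
  exists T, op_norm_cvg P T.
Proof.
move=> cP.
have /choice[f fP] x : exists l, forall e : R, 0 < e ->
    exists N, forall n, (N <= n)%N -> hn (l - P n x) < e.
  apply: hcauchy_cvg => e e0.
  have x0 : 0 < hn x + 1 by have := hn_ge0 x; lra.
  have [|N NP] := cP (e / (hn x + 1)); first by rewrite divr_gt0.
  exists N => m n Nm Nn; apply: le_lt_trans (NP m n Nm Nn x) _.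
  by rewrite mulrAC ltr_pdivrMr// ltr_pM2l//; lra.
have fb e : 0 < e -> exists N, forall n, (N <= n)%N -> forall x, hn (P n x - f x) <= e * hn x.
  move=> e0; have [N NP] := cP _ e0; exists N => n Nn x.
  apply: (@le_eps _ _ _ 1) => d d0; have [M MP] := fP x _ d0.
  rewrite -(subrKA (P (maxn N M) x)); apply: le_trans (hnD _ _) _.
  rewrite lerD ?NP ?leq_maxl// mul1r hnB ltW// MP// leq_maxr//.
have lf : linear f.
  move=> a x y; apply/eqP; rewrite -subr_eq0; apply/eqP.
  apply: (@hn_eps _ _ _ (hn (a *: x + y) + (cn a * hn x + hn y))) => e e0.
  have [N NP] := fb e e0.
  have -> : f (a *: x + y) - (a *: f x + f y) =
      (a *: (P N x - f x) + (P N y - f y)) - (P N (a *: x + y) - f (a *: x + y)).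
    rewrite bopD bopZ scalerBr addrACA -opprD opprB [RHS]addrC.
    by rewrite subrKA.
  apply: le_trans (hnD _ _) _; rewrite hnN addrC mulrDl lerD//.
    by rewrite mulrC NP.
  apply: le_trans (hnD _ _) _; rewrite mulrDl lerD//; last by rewrite mulrC NP.
  by rewrite hnZ -mulrA ler_wpM2l ?cn_ge0// mulrC NP.
have [N NP] := fb 1 ltr01; have [c c0 cb] := bop_bounded (P N).
have fc x : hn (f x) <= (c + 1) * hn x.
  rewrite -(subrK (P N x) (f x)); apply: le_trans (hnD _ _) _.
  by rewrite mulrDl addrC lerD// hnB mul1r; have := NP N (leqnn N) x; rewrite mul1r.
exists (Bop (bounded_opI lf fc)) => e e0; have [M MP] := fb e e0.
by exists M => // n /= Mn x; rewrite !hnE -rcM rc_le MP.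
Qed.

(** T + e is positive and at most 2 e, so its norm is at most 2 e; removing the shift costs another
    e. *)
Lemma sym_norm T e x : 0 <= e -> sym T -> (forall y, `|hi (T y) y| <= e * hn y ^+ 2) ->
  hn (T x) <= 3 * e * hn x.
Proof.
move=> e0 sT Te.
have p1 : psd (T + rc e *: bid H).
  apply/psdP; split; first by apply: symD => //; apply: symZ; exact: sym_id.
  move=> y; rewrite bopDE bopZE bidE !hiE hi_sqr; have := Te y.
  by rewrite ler_norml => /andP[]; lra.
have : hn ((T + rc e *: bid H) x) <= 2 * e * hn x.
  apply: psd_norm_le => //; first by rewrite mulr_ge0.
  move=> y; rewrite bopDE bopZE bidE !hiE hi_sqr; have := Te y.
  by rewrite ler_norml => /andP[]; lra.
move=> h; have -> : T x = (T + rc e *: bid H) x - rc e *: x.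
  by rewrite bopDE bopZE bidE addrK.
apply: le_trans (hnD _ _) _; rewrite hnN hnZ cn_rc ger0_norm//; lra.
Qed.

(* par_fun r s = r s / K * sum_k (1 - (r + s) / K)^k, a Neumann series. *)
Definition par_poly (K : R) n : {poly {poly R}} :=
  'X * 'X%:P * (K^-1)%:P%:P * \sum_(k < n) (1 - ('X + 'X%:P) * (K^-1)%:P%:P) ^+ k.

Lemma par_polyE K n r s : (par_poly K n).[r, s] =
  r * s * K^-1 * \sum_(k < n) (1 - (r + s) * K^-1) ^+ k.
Proof.
rewrite /par_poly !(hornerM, hornerX, hornerC, horner_sum); congr (_ * _); apply: eq_bigr => k _.
by rewrite !horner_exp !hornerE.
Qed.

(** With w = (r + s) / K the error is g (1 - w)^n, where g <= r <= K w. Uniformity up to the origin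
    comes from w (1 - w)^n <= 1 / (n + 1): the powers (1 - w)^k with k <= n are each at least (1 -
    w)^n and sum to at most 1 / w. *)
Lemma par_poly_approx K n r s : 0 < K -> 0 <= r -> 0 <= s -> r + s <= K ->
  `|(par_poly K n).[r, s] - par_fun r s| <= K / n.+1%:R.
Proof.
move=> K0 r0 s0 rsK; rewrite par_polyE.
have n0 : 0 < n.+1%:R :> R by rewrite ltr0n.
have := addr_ge0 r0 s0; rewrite le_eqVlt => /orP[/eqP rs|rs].
  have -> : r = 0 by lra.
  by rewrite /par_fun !mul0r subrr normr0 divr_ge0// ltW.
pose w := (r + s) / K.
have w0 : 0 < w by rewrite divr_gt0.
have w1 : w <= 1 by rewrite ler_pdivrMr// mul1r.
have geo m : w * \sum_(k < m) (1 - w) ^+ k = 1 - (1 - w) ^+ m.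
  have := subrX1 (1 - w) m; rewrite (_ : 1 - w - 1 = - w); last by ring.
  by rewrite mulNr => h; lra.
have -> : r * s * K^-1 * \sum_(k < n) (1 - (r + s) * K^-1) ^+ k =
   par_fun r s * (1 - (1 - w) ^+ n).
  by rewrite -geo /par_fun -/w; rewrite {2}/w; field; rewrite !gt_eqF.
rewrite (_ : _ * (1 - _) - _ = - (par_fun r s * (1 - w) ^+ n)); last by ring.
have wn0 : 0 <= (1 - w) ^+ n by rewrite exprn_ge0//; lra.
rewrite normrN ger0_norm; last by rewrite mulr_ge0// par_fun_ge0.
apply: le_trans (_ : K * (w * (1 - w) ^+ n) <= _).
  rewrite mulrA ler_wpM2r//; apply: le_trans (par_fun_le r0 s0) _.
  by rewrite /w mulrC divfK ?gt_eqF//; lra.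
rewrite ler_wpM2l ?(ltW K0)// -[leRHS]mul1r ler_pdivlMr//.
have := geo n.+1; have : 0 <= (1 - w) ^+ n.+1 by rewrite exprn_ge0//; lra.
suff : n.+1%:R * (1 - w) ^+ n <= \sum_(k < n.+1) (1 - w) ^+ k by nra.
rewrite [leLHS](_ : _ = \sum_(k < n.+1) (1 - w) ^+ n); last first.
  by rewrite sumr_const card_ord mulr_natl.
apply: ler_sum => k _; apply: ler_wiXn2l; [lra|lra|].
by rewrite -ltnS.
Qed.

Lemma is_funcalc2_par_ex A B : psd A -> psd B -> A \ob B = B \ob A ->
  exists T, is_funcalc2 (@par_fun R) A B T.
Proof.
move=> pA pB AB.
have [a a0 aP] := psd_bounded A; have [b b0 bP] := psd_bounded B.
have sA := psd_sym pA; have sB := psd_sym pB.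
have Aa : op_le A (rc a *: bid H).
  by apply: psd_op_le => [//||x]; [exact/symZ/sym_id|rewrite bopZE bidE hiZl hi_sqr].
have Bb : op_le B (rc b *: bid H).
  by apply: psd_op_le => [//||x]; [exact/symZ/sym_id|rewrite bopZE bidE hiZl hi_sqr].
pose K := a + b; have K0 : 0 < K by rewrite addr_gt0.
have unif e : 0 < e -> exists N, forall n, (N <= n)%N ->
    forall r s, 0 <= r <= a -> 0 <= s <= b -> `|(par_poly K n).[r, s] - par_fun r s| <= e.
  move=> e0; exists (Num.truncn (K / e)) => n Nn r s /andP[r0 ra] /andP[s0 sb].
  apply: le_trans (par_poly_approx n K0 r0 s0 _) _; first by rewrite lerD.
  rewrite ler_pdivrMr ?ltr0n// -ler_pdivrMl// mulrC.
  by apply: le_trans (ltW (truncnS_gt _)) _; rewrite ler_nat ltnS.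
have [T TP] : exists T, op_norm_cvg (fun n => poly2_op (par_poly K n) A B) T.
  apply: bop_norm_cauchy => e e0.
  (* Two approximation errors e / 6 give e / 3 for the difference, and [sym_norm] loses a factor
     3. *)
  have [|N NP] := unif (e / 6); first by rewrite divr_gt0.
  exists N => m n Nm Nn x.
  have bound p q y : (N <= p)%N -> (N <= q)%N ->
      - (e / 3) * hn y ^+ 2 <= hi (poly2_op (par_poly K p - par_poly K q) A B y) y.
    move=> Np Nq; apply: (poly2_op_ge y pA pB Aa Bb AB) => r s r0 s0.
    have := NP p Np r s r0 s0; have := NP q Nq r s r0 s0.
    by rewrite !ler_norml !hornerD !hornerN => /andP[h1 h2] /andP[h3 h4]; lra.
  have -> : poly2_op (par_poly K m) A B x - poly2_op (par_poly K n) A B x =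
      poly2_op (par_poly K m - par_poly K n) A B x by rewrite poly2_opB.
  have -> : e = 3 * (e / 3) by field.
  apply: sym_norm; [by rewrite divr_ge0// ltW|exact: poly2_op_sym|move=> y].
  rewrite ler_norml -mulNr bound//=.
  by have := bound n m y Nn Nm; rewrite !poly2_opB !bopBE !hiE; lra.
exists T, a, b; split=> //; exists (par_poly K) => // e e0.
by have [N NP] := unif e e0; exists N.
Qed.

Lemma funcalc2_par A B : psd A -> psd B -> A \ob B = B \ob A ->
  is_par_op A B (funcalc2 (@par_fun R) A B).
Proof.
move=> pA pB AB; apply: is_funcalc2_par => //.
exact: (xgetPex 0 (is_funcalc2_par_ex pA pB AB)).
Qed.

End ParallelSumExistence.

(** * Variational description of the parallel sum *)

Section Variational.
Variable R : realType.
Variable H : hilb R.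
Implicit Types (A B T : bop H H).

(** Cost of splitting x as y + (x - y); its infimum over y is the quadratic form of the parallel
    sum. *)
Definition par_cost A B (x y : H) : R := hi (A y) y + hi (B (x - y)) (x - y).

(* With C = A + B and D = B - T one has C D = B^2, so that
   par_cost A B x y - <T x, x> = <C y, y> - 2 <B x, y> + <D x, x> is the square
   <C (y - B z), y - B z> when x = x0 + C z with C x0 = 0. *)
Lemma par_cost_square A B T x0 z y : psd A -> psd B -> A \ob B = B \ob A ->
  is_par_op A B T -> (A + B) x0 = 0 ->
  par_cost A B (x0 + (A + B) z) y = hi (T (x0 + (A + B) z)) (x0 + (A + B) z) +
     hi ((A + B) (y - B z)) (y - B z).
Proof.
move=> pA pB AB [pT TA TB CT Tc] Cx0.
have sA := psd_sym pA; have sB := psd_sym pB; have sT := psd_sym pT.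
have AB' u : A (B u) = B (A u) by rewrite -!bcompE AB.
have CT' u : A (T u) + B (T u) = A (B u).
  by have /(congr1 (fun S : bop H H => S u)) := CT; rewrite !bcompE bopDE.
have [Ax0 Bx0] : A x0 = 0 /\ B x0 = 0.
  have : hi (A x0) x0 + hi (B x0) x0 = 0 by rewrite -hiDl -bopDE Cx0 hi0l.
  by have := psd_hi x0 pA; have := psd_hi x0 pB => h1 h2 h3; split; apply: psd_ker => //; lra.
have Tx0 : T x0 = 0.
  apply: psd_ker => //; have := psd_hi x0 pT; have := op_le_hi x0 TA.
  by rewrite Ax0 hi0l; lra.
have [w wE] : exists w, w = (A + B) z by eexists.
rewrite /par_cost -wE.
have hT v : hi v w = hi (A v) z + hi (B v) z.
  by rewrite wE bopDE !hiE -sA -sB.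
have e1 : hi (T (x0 + w)) (x0 + w) = hi (A (B w)) z.
  rewrite bopD Tx0 add0r hiDr (sT w x0) Tx0 hi0r add0r hT -hiDl.
  by rewrite CT'.
have e2 : hi (B (x0 + w - y)) (x0 + w - y) = hi (A (B w)) z + hi (B (B w)) z
    - 2 * hi (B w) y + hi (B y) y.
  rewrite bopB bopD Bx0 add0r !hiE (sB w x0) (sB y x0) Bx0 !hi0r.
  by rewrite (hT (B w)) (sB y w) (hiC y (B w)); lra.
rewrite e1 e2 bopDE !bopB !hiE.
have e3 : hi (A (B z)) y + hi (B (B z)) y = hi (B w) y.
  by rewrite -hiDl AB' -bopD wE.
have e4 : hi (A (B z)) (B z) + hi (B (B z)) (B z) = hi (B (B w)) z.
  by rewrite AB' -hiDl -bopD -bopDE -wE (sB (B w) z).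
have e5 : hi (A y) (B z) + hi (B y) (B z) = hi (B w) y.
  by rewrite (sA y) (sB y) -hiDr (hiC y) AB' -bopD wE.
by move: e3 e4 e5; lra.
Qed.

Lemma psd_quad_le A (x y : H) : psd A ->
  hi (A (x + y)) (x + y) <= 2 * hi (A x) x + 2 * hi (A y) y.
Proof.
move=> pA; have := psd_hi (x - y) pA.
by rewrite bopB bopD !hiE; lra.
Qed.

(** Immediate from [par_cost_square] on the dense set ker (A + B) + ran (A + B); in general x is
    moved there with y fixed, both sides being continuous in x. *)
Lemma is_par_op_le A B T x y : psd A -> psd B -> A \ob B = B \ob A ->
  is_par_op A B T -> hi (T x) x <= par_cost A B x y.
Proof.
move=> pA pB AB TP; have [pT TA TB _ _] := TP.
have sA := psd_sym pA; have sB := psd_sym pB; have sT := psd_sym pT.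
have sC : sym (A + B) by exact: symD.
have [a a0 aP] := bop_bounded_gt0 T; have [b b0 bP] := bop_bounded_gt0 B.
pose u := x - y.
(* Bounds the variation of <T x, x> plus that of <B u, u>, per unit of e, when x moves by less than
   e <= 1. *)
pose K := 2 * a * hn x + a + (2 * b * hn u + b).
apply: (@le_eps _ _ _ K) => e0 e00.
pose e := Num.min e0 1.
have e1 : 0 < e by rewrite lt_min e00 ltr01.
have ee : e <= e0 by rewrite ge_min lexx.
have e11 : e <= 1 by rewrite ge_min lexx orbT.
have K0 : 0 <= K by rewrite /K !addr_ge0 ?mulr_ge0 ?hn_ge0// ltW.
have /closureP/(_ e e1)[_ [x0 [z [Cx0 ->]]] xe] :
    closure [set x | exists x0 z, (A + B) x0 = 0 /\ x = x0 + (A + B) z] x.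
  by rewrite ker_ran_dense.
set x' := x0 + _ in xe.
have := par_cost_square z y pA pB AB TP Cx0; rewrite -/x' => cost.
have := psd_hi (y - B z) (psdD pA pB); move: cost; set q := hi _ (y - B z) => cost q0.
have hq (S : bop H H) (c : R) v d : hn d < e -> sym S -> 0 < c -> (forall v, hn (S v) <= c * hn v) ->
    `|hi (S (v + d)) (v + d) - hi (S v) v| <= (2 * c * hn v + c) * e.
  move=> de sS c0 cS; rewrite bopD !hiE (sS d v) (hiC d).
  have -> : hi (S v) v + hi (S v) d + (hi (S v) d + hi (S d) d) - hi (S v) v =
     2 * hi (S v) d + hi (S d) d by ring.
  have h1 := abs_hi_le (S v) d; have h2 := abs_hi_le (S d) d.
  have h3 := cS v; have h4 := cS d; have nv := hn_ge0 v; have nd := hn_ge0 d.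
  apply: le_trans (ler_normD _ _) _; rewrite (mulrDl _ c e) normrM normr_nat; apply: lerD.
    rewrite -!mulrA ler_wpM2l//; apply: le_trans h1 _; rewrite mulrA.
    by apply: ler_pM => //; [exact: hn_ge0|exact: ltW].
  apply: le_trans h2 _; apply: le_trans (_ : c * hn d * hn d <= _).
    by rewrite ler_wpM2r.
  rewrite -mulrA ler_wpM2l ?(ltW c0)//; apply: le_trans (_ : hn d * 1 <= _).
    by rewrite ler_wpM2l//; lra.
  by rewrite mulr1 ltW.
pose d := x' - x; have de : hn d < e by rewrite hnB.
have := hq T a x d de sT a0 aP; have := hq B b u d de sB b0 bP.
have -> : u + d = x' - y by rewrite /u /d addrC subrKA.
have -> : x + d = x' by rewrite /d addrC subrK.
rewrite !ler_norml => /andP[h1 h2] /andP[h3 h4].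
have : K * e <= K * e0 by rewrite ler_wpM2l.
by move: cost; rewrite /par_cost -/u {1}/K; lra.
Qed.

Lemma is_par_op_approx A B T x e : psd A -> psd B -> A \ob B = B \ob A ->
  is_par_op A B T -> 0 < e -> exists y, par_cost A B x y <= hi (T x) x + e.
Proof.
move=> pA pB AB TP e0; have [pT TA TB _ _] := TP.
have sA := psd_sym pA; have sB := psd_sym pB; have sT := psd_sym pT.
have sC : sym (A + B) by exact: symD.
(* x |-> par_cost A B x y - <T x, x> is, jointly in (x, y), a positive quadratic
   form, and it vanishes at (x0 + C z, B z). *)
have [b b0 bP] := psd_bounded B.
pose d := Num.min 1 (e / (2 * b)).
have d0 : 0 < d by rewrite lt_min ltr01 divr_gt0// mulr_gt0.
have /closureP/(_ d d0)[_ [x0 [z [Cx0 ->]]] xe] :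
    closure [set x | exists x0 z, (A + B) x0 = 0 /\ x = x0 + (A + B) z] x.
  by rewrite ker_ran_dense.
set x' := x0 + _ in xe.
pose Q u v := par_cost A B u v - hi (T u) u.
have Q0 u v : 0 <= Q u v by rewrite subr_ge0; exact: is_par_op_le.
have Qz : Q x' (B z) = 0.
  by rewrite /Q (par_cost_square _ _ pA pB AB TP Cx0) subrr bop0 hi0l addr0 subrr.
(* With Q >= 0 and Q x' (B z) = 0 the parallelogram identity leaves Q x (B z) <= 2 Q (x - x') 0, and
   d is chosen to make this at most e. *)
have Qpar u v u' v' : Q (u + u') (v + v') + Q (u - u') (v - v') = 2 * Q u v + 2 * Q u' v'.
  rewrite /Q /par_cost.
  have -> : u + u' - (v + v') = (u - v) + (u' - v') by rewrite opprD addrACA.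
  have -> : u - u' - (v - v') = (u - v) - (u' - v') by rewrite !opprB [v' - v]addrC addrACA [- u' + v']addrC.
  by move: (u - v) (u' - v') => s t; rewrite !bopB !bopD !hiE; lra.
exists (B z); suff : Q x (B z) <= e by rewrite /Q; lra.
have := Qpar x' (B z) (x - x') 0.
rewrite (_ : x' + (x - x') = x) ?addr0 ?subr0 ?Qz; last by rewrite addrC subrK.
have := Q0 (x' - (x - x')) (B z).
suff : Q (x - x') 0 <= e / 2 by lra.
rewrite /Q /par_cost subr0 bop0 hi0l add0r; have := psd_hi (x - x') pT.
have := bP (x - x'); suff : b * hn (x - x') ^+ 2 <= e / 2 by lra.
have dd : d ^+ 2 <= e / (2 * b).
  apply: le_trans (_ : d * 1 <= _); last by rewrite mulr1 ge_min lexx orbT.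
  by rewrite expr2 ler_wpM2l ?(ltW d0)// ge_min lexx.
apply: le_trans (_ : b * d ^+ 2 <= _).
  by rewrite ler_wpM2l ?(ltW b0)// ler_pXn2r ?nnegrE ?hn_ge0 ?ltW.
apply: le_trans (_ : b * (e / (2 * b)) <= _); first by rewrite ler_wpM2l ?(ltW b0).
by rewrite le_eqVlt; apply/orP; left; apply/eqP; field; rewrite gt_eqF.
Qed.

End Variational.

(** * Independence of the compatible representation *)

Section FormParallelSumIndependence.
Variable R : realType.
Variable V : lmodType (Cplx R).
Implicit Types (s t : V -> V -> Cplx R).

(** Lets a near-optimal y be moved into the dense range of a compatible representation at small
    cost. *)
Lemma par_cost_cont (H : hilb R) (A B : bop H H) (x y : H) : psd A -> psd B ->
  exists2 K : R, 0 <= K &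
    forall y', hn (y' - y) <= 1 -> par_cost A B x y' <= par_cost A B x y + K * hn (y' - y).
Proof.
move=> pA pB; have [a a0 aP] := psd_bounded A; have [b b0 bP] := psd_bounded B.
exists (2 * hn (A y) + 2 * hn (B (x - y)) + a + b).
  by rewrite !addr_ge0 ?mulr_ge0 ?hn_ge0// ltW.
move=> y' y1; have [d dE] : exists d, d = y' - y by eexists.
have -> : y' = y + d by rewrite dE addrC subrK.
rewrite [y + d]addrC addrK; rewrite -dE in y1.
rewrite /par_cost; have -> : x - (d + y) = (x - y) - d by rewrite opprD addrA addrAC.
have := aP d; have := bP d; have := abs_hi_le (A y) d; have := abs_hi_le (B (x - y)) d.
move: (x - y) => u; rewrite bopB bopD !hiE !ler_norml => /andP[h1 h2] /andP[h3 h4] h5 h6.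
rewrite (psd_sym pA d y) (psd_sym pB d u) (hiC d (A y)) (hiC d (B u)).
have : hn d ^+ 2 <= hn d by rewrite expr2 ler_piMl ?hn_ge0.
move: (ltW a0) (ltW b0) => a0' b0' hd.
have : a * hn d ^+ 2 <= a * hn d by rewrite ler_wpM2l.
have : b * hn d ^+ 2 <= b * hn d by rewrite ler_wpM2l.
lra.
Qed.

(** A near-optimal splitting of h' u is moved to h' w. Its cost is then s w w + t (u - w) (u - w),
    which does not see the representation and so also bounds <T (h u), h u>. *)
Lemma compatible_rep_le s t (H H' : hilb R) (h : V -> H) (h' : V -> H')
    (A B T : bop H H) (A' B' T' : bop H' H') u :
  compatible_rep s t h A B -> compatible_rep s t h' A' B' ->
  is_par_op A B T -> is_par_op A' B' T' ->
  hi (T (h u)) (h u) <= hi (T' (h' u)) (h' u).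
Proof.
move=> [[lh clh] [pA pB AB] sE tE] [[lh' clh'] [pA' pB' AB'] sE' tE'] TP TP'.
have hB w : h (u - w) = h u - h w.
  by rewrite addrC -scaleN1r lh scaleN1r addrC.
have hB' w : h' (u - w) = h' u - h' w.
  by rewrite addrC -scaleN1r lh' scaleN1r addrC.
apply: (@le_eps _ _ _ 2) => e e0.
have [y yP] := is_par_op_approx (h' u) pA' pB' AB' TP' e0.
have [K K0 KP] := par_cost_cont (h' u) y pA' pB'.
pose d := Num.min 1 (e / (K + 1)).
have d0 : 0 < d by rewrite lt_min ltr01 divr_gt0//; lra.
have /closureP/(_ d d0)[_ [w _ <-] yw] : closure (range h') y by rewrite clh'.
have yw1 : hn (h' w - y) <= d by rewrite hnB ltW.
have := KP (h' w); rewrite (le_trans yw1) ?ge_min ?lexx// => /(_ isT) cost.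
have Ke : K * hn (h' w - y) <= e.
  apply: le_trans (_ : (K + 1) * (e / (K + 1)) <= _); last first.
    by rewrite mulrC divfK// gt_eqF//; lra.
  apply: ler_pM => //; [exact: hn_ge0|lra|].
  by apply: le_trans yw1 _; rewrite ge_min lexx orbT.
have := is_par_op_le (h u) (h w) pA pB AB TP.
have -> : par_cost A B (h u) (h w) = par_cost A' B' (h' u) (h' w).
  by rewrite /par_cost -hB -hB' /hi -sE -sE' -tE -tE'.
lra.
Qed.

(** The representation behind the form selected in [form_par] is unknown. [compatible_rep_le] in
    both directions equates the quadratic forms, polarisation gives the real parts, and replacing v
    by i v the imaginary parts. *)
Lemma form_parE s t (H : hilb R) (h : V -> H) (A B : bop H H) u v :
  compatible_rep s t h A B ->
  form_par s t u v = inner (funcalc2 (@par_fun R) A B (h u)) (h v).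
Proof.
move=> rep; rewrite /form_par; set Q := [set q | _].
have : exists q, Q q.
  by exists (fun u v => inner (funcalc2 (@par_fun R) A B (h u)) (h v)), H, h, A, B.
move=> /(xgetPex (fun _ _ => 0)); set q := xget _ _.
move=> [H' [h' [A' [B' [rep' qE]]]]]; rewrite qE.
have [[lh _] [pA pB AB] _ _] := rep; have [[lh' _] [pA' pB' AB'] _ _] := rep'.
have TP := funcalc2_par pA pB AB; have TP' := funcalc2_par pA' pB' AB'.
set T := funcalc2 _ A B in TP *; set T' := funcalc2 _ A' B' in TP' *.
have diag x : hi (T' (h' x)) (h' x) = hi (T (h x)) (h x).
  by apply/le_anti/andP; split; apply: compatible_rep_le; eassumption.
have [sT sT'] : sym T /\ sym T'.
  by case: TP TP' => [/psd_sym sT _ _ _ _] [/psd_sym sT' _ _ _ _].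
have re x y : hi (T' (h' x)) (h' y) = hi (T (h x)) (h y).
  have := diag (x + y); have := diag x; have := diag y.
  have hD a b : h (a + b) = h a + h b by have := lh 1 a b; rewrite !scale1r.
  have hD' a b : h' (a + b) = h' a + h' b by have := lh' 1 a b; rewrite !scale1r.
  rewrite hD hD' !bopD !hiE (sT (h y) (h x)) (sT' (h' y) (h' x)) (hiC (h y) (T (h x))) (hiC (h' y) (T' (h' x))).
  lra.
apply: eq_cplx; first exact: re.
have h0 : h 0 = 0 by have := lh 1 0 0; rewrite !scale1r addr0 -{1}[h 0]addr0 => /addrI.
have h0' : h' 0 = 0 by have := lh' 1 0 0; rewrite !scale1r addr0 -{1}[h' 0]addr0 => /addrI.
have := re u ('i%C *: v); rewrite -[_ *: v]addr0 lh lh' h0 h0' !addr0 /hi.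
by rewrite !innerZr !conjE !ReM /= !mul0r !sub0r !mulN1r !opprK.
Qed.

End FormParallelSumIndependence.

(** * Von Neumann algebras through the double commutant *)

Section VonNeumannFacts.
Variable R : realType.
Variable H : hilb R.
Variable M : set (bop H H).
Hypothesis vM : von_neumann_algebra M.

Lemma vnP x : M x <-> forall y, commutant M y -> x \ob y = y \ob x.
Proof. by have [_ e] := vM; rewrite -{1}e. Qed.

Lemma vn_id : M (bid H).
Proof. by apply/vnP => y _; apply: bop_eqP. Qed.

Lemma vn_adj x : M x -> M (adj x).
Proof. by have [h _] := vM; exact: h. Qed.

Lemma vn_comp x y : M x -> M y -> M (x \ob y).
Proof.
move=> /vnP hx /vnP hy; apply/vnP => z zM; apply: bop_eqP => u.
have hx' v : x (z v) = z (x v) by rewrite -!bcompE hx.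
have hy' v : y (z v) = z (y v) by rewrite -!bcompE hy.
by rewrite !bcompE hy' hx'.
Qed.

Lemma vn_lin a x y : M x -> M y -> M (a *: x + y).
Proof.
move=> /vnP hx /vnP hy; apply/vnP => z zM; apply: bop_eqP => u.
have hx' v : x (z v) = z (x v) by rewrite -!bcompE hx.
have hy' v : y (z v) = z (y v) by rewrite -!bcompE hy.
by rewrite !(bcompE, bopDE, bopZE) hx' hy' bopD bopZ.
Qed.

Lemma vnD x y : M x -> M y -> M (x + y).
Proof. by move=> Mx My; have := vn_lin 1 Mx My; rewrite scale1r. Qed.

Lemma commutant_adj y : commutant M y -> commutant M (adj y).
Proof.
move=> yM x Mx; apply: bop_eqP => u; apply: hi_eqP => v.
rewrite /hi !bcompE adjP'.
have -> : inner (x (adj y u)) v = inner u (y (adj x v)).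
  by rewrite adjP adjP'.
by rewrite -bcompE yM ?bcompE ?adjP//; exact: vn_adj.
Qed.

End VonNeumannFacts.

Lemma adj_id (R : realType) (H : hilb R) : adj (bid H) = bid H.
Proof. exact: adj_uniq. Qed.

(** * Bounded extension from a total set *)

Section DenseExtension.
Variable R : realType.
Variable G : hilb R.

(** Used to extend pi(x) V xi |-> pi(x) V y' xi to the whole Stinespring space. *)
Lemma extension (I : Type) (Q : set I) (h k : I -> G) (c : R) :
  closure (lin_span [set v | exists2 i, Q i & v = h i]) = [set: G] ->
  (forall n (a : 'I_n -> Cplx R) (s : 'I_n -> I), (forall i, Q (s i)) ->
     hn (\sum_i a i *: k (s i)) <= c * hn (\sum_i a i *: h (s i))) ->
  exists S : bop G G, forall i, Q i -> S (h i) = k i.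
Proof.
move=> dense bound.
(* The graph of the map on the span: a vector may be several combinations of the h i, and the bound
   is what makes this relation single-valued. *)
pose D := [set p : G * G | exists n (a : 'I_n -> Cplx R) (s : 'I_n -> I),
  [/\ forall i, Q (s i), p.1 = \sum_i a i *: h (s i) & p.2 = \sum_i a i *: k (s i)]].
have Dbound p : D p -> hn p.2 <= c * hn p.1.
  by move=> [n [a [s [sQ -> ->]]]]; exact: bound.
have Dlin a p q : D p -> D q -> D (a *: p + q).
  move=> [n [b [s [sQ p1 p2]]]] [m [b' [s' [sQ' q1 q2]]]].
  exists (n + m)%N.
  exists (fun i => match fintype.split i with inl j => a * b j | inr j => b' j end).
  exists (fun i => match fintype.split i with inl j => s j | inr j => s' j end).
  split=> [i||]; first by case: (fintype.split i).
    rewrite /= p1 q1 big_split_ord /= scaler_sumr; congr +%R; apply: eq_bigr => i _.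
      by rewrite (unsplitK (inl i)) scalerA.
    by rewrite (unsplitK (inr i)).
  rewrite /= p2 q2 big_split_ord /= scaler_sumr; congr +%R; apply: eq_bigr => i _.
    by rewrite (unsplitK (inl i)) scalerA.
  by rewrite (unsplitK (inr i)).
have DB p q : D p -> D q -> D (p - q).
  by move=> Dp Dq; rewrite -scaleN1r addrC; exact: Dlin.
have Dex g e : 0 < e -> exists2 p, D p & hn (g - p.1) < e.
  move=> e0; have /closureP/(_ e e0)[y [n [a [s [sh ->]]]] gy] : closure
      (lin_span [set v | exists2 i, Q i & v = h i]) g by rewrite dense.
  have /choice[t tP] i : exists t, Q t /\ s i = h t by have [t] := sh i; exists t.
  exists (\sum_i a i *: h (t i), \sum_i a i *: k (t i)).
    by exists n, a, t; split=> // i; exact: (tP i).1.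
  by move: gy; under eq_bigr do rewrite (tP _).2.
pose c' := `|c| + 1; have c'0 : 0 < c' by rewrite ltr_wpDl.
have Dbound' p : D p -> hn p.2 <= c' * hn p.1.
  move=> /Dbound h1; apply: le_trans h1 _; rewrite ler_wpM2r ?hn_ge0//.
  by rewrite /c'; have := ler_norm c; lra.
(* The value at g is described by one estimate against all points of the graph; linearity, the bound
   and the values on generators are read off from it. *)
have /choice[f fP] g : exists l, forall p, D p -> hn (l - p.2) <= c' * hn (g - p.1).
  have /choice[u uP] (n : nat) : exists p, D p /\ hn (g - p.1) < n.+1%:R^-1.
    by have [|p Dp gp] := Dex g n.+1%:R^-1; [rewrite invr_gt0 ltr0n|exists p].
  have small e : 0 < e -> exists N, forall n, (N <= n)%N -> hn (g - (u n).1) < e.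
    move=> e0; exists (Num.truncn e^-1) => n Nn; apply: lt_trans (uP n).2 _.
    rewrite -[ltRHS]invrK ltf_pV2 ?posrE ?ltr0n ?invr_gt0//.
    by apply: lt_le_trans (truncnS_gt _) _; rewrite ler_nat ltnS.
  have [e e0|l lP] := hcauchy_cvg (u := fun n => (u n).2).
    have [|N NP] := small (e / (2 * c')); first by rewrite divr_gt0// mulr_gt0.
    exists N => m n Nm Nn.
    have := Dbound' _ (DB _ _ (uP m).1 (uP n).1) => /= /le_lt_trans; apply.
    rewrite mulrC -ltr_pdivlMr//.
    have -> : (u m).1 - (u n).1 = - (g - (u m).1) + (g - (u n).1).
      by rewrite opprB addrA subrK.
    apply: le_lt_trans (hnD _ _) _; rewrite hnN.
    have := NP m Nm; have := NP n Nn; have : e / (2 * c') *+ 2 = e / c'.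
      by field; rewrite gt_eqF.
    lra.
  exists l => p Dp; apply: (@le_eps _ _ _ (1 + c')) => e e0.
  have [N1 P1] := lP e e0; have [N2 P2] := small e e0.
  have := P1 _ (leq_maxl N1 N2); have := P2 _ (leq_maxr N1 N2).
  set v := u _ => g1 l1.
  have := Dbound' _ (DB _ _ (uP (maxn N1 N2)).1 Dp) => /=; rewrite -/v => b1.
  have : hn (l - p.2) <= hn (l - v.2) + hn (v.2 - p.2) by rewrite -(subrKA v.2) hnD.
  have : hn (v.1 - p.1) <= hn (g - v.1) + hn (g - p.1).
    by rewrite (hnB g v.1) -(subrKA g v.1) hnD.
  move=> t1 t2; have : c' * hn (v.1 - p.1) <= c' * (hn (g - v.1) + hn (g - p.1)).
    by rewrite ler_wpM2l// ltW.
  have : c' * hn (g - v.1) <= c' * e by rewrite ler_wpM2l ?ltW.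
  lra.
have lf : linear f.
  move=> a x y; apply/eqP; rewrite -subr_eq0; apply/eqP.
  apply: (@hn_eps _ _ _ (2 * (c' * (cn a + 1)))) => e e0.
  have [p Dp xp] := Dex x e e0; have [q Dq yq] := Dex y e e0.
  have h1 := fP (a *: x + y) _ (Dlin a _ _ Dp Dq).
  have h2 := fP x _ Dp; have h3 := fP y _ Dq.
  have e1 : a *: x + y - (a *: p + q).1 = a *: (x - p.1) + (y - q.1).
    by rewrite /= opprD addrACA -scalerBr.
  rewrite e1 in h1.
  have -> : f (a *: x + y) - (a *: f x + f y) =
     f (a *: x + y) - (a *: p + q).2 - (a *: (f x - p.2) + (f y - q.2)).
    rewrite /= scalerBr addrACA -opprD opprB.
    by rewrite subrKA.
  apply: le_trans (hnD _ _) _; rewrite hnN.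
  have := hnD (a *: (x - p.1)) (y - q.1); have := hnD (a *: (f x - p.2)) (f y - q.2).
  rewrite !hnZ => h4 h5; have a0 := cn_ge0 a.
  have : cn a * hn (f x - p.2) <= cn a * (c' * e).
    by rewrite ler_wpM2l//; apply: le_trans h2 _; rewrite ler_wpM2l ?ltW.
  have : hn (f y - q.2) <= c' * e.
    by apply: le_trans h3 _; rewrite ler_wpM2l ?ltW.
  have : c' * hn (a *: (x - p.1) + (y - q.1)) <= c' * (cn a * e + e).
    rewrite ler_wpM2l ?(ltW c'0)//; apply: le_trans h5 _.
    by rewrite lerD ?(ltW yq)// ler_wpM2l// ltW.
  lra.
have fc x : hn (f x) <= c' * hn x.
  have [p Dp _] := Dex 0 1 ltr01.
  have D0 : D (0, 0).
    by have := DB _ _ Dp Dp; rewrite [X in D X](_ : _ = (0, 0))//; apply: (subrr p).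
  by have := fP x _ D0; rewrite /= !subr0.
exists (Bop (bounded_opI lf fc)) => i Qi /=.
have Di : D (h i, k i).
  by exists 1%N, (fun=> 1), (fun=> i); split=> //=; rewrite big_ord1 scale1r.
apply/eqP; rewrite -subr_eq0; apply/eqP/hn_eq0/le_anti; rewrite hn_ge0 andbT.
by have := fP (h i) _ Di; rewrite /= subrr hn0 mulr0.
Qed.

End DenseExtension.

(** * Complete positivity over arbitrary finite index types *)

Section CompletePositivityFinType.
Variable R : realType.
Variables H L : hilb R.
Variables (M : set (bop H H)) (N : set (bop L L)).

(** Transport along [enum_val]; pairs and disjoint unions can then serve as matrix indices. *)
Lemma cp_fin (Theta : bop H H -> bop L L) (I : finType) (Z : I -> I -> bop H H)
    (f : I -> L) :
  CP M N Theta -> (forall a b, M (Z a b)) ->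
  (forall v : I -> H, 0 <= \sum_a \sum_b inner (Z a b (v b)) (v a)) ->
  0 <= \sum_a \sum_b inner (Theta (Z a b) (f b)) (f a).
Proof.
move=> [_ _ cp] MZ Z0.
pose X := \matrix_(i < #|I|, j < #|I|) Z (enum_val i) (enum_val j).
have re (F : I -> I -> Cplx R) : \sum_a \sum_b F a b =
    \sum_(i < #|I|) \sum_(j < #|I|) F (enum_val i) (enum_val j).
  rewrite (reindex (fun i : 'I_#|I| => enum_val i)) /=; last exact: onW_bij (enum_val_bij _).
  apply: eq_bigr => i _.
  by rewrite (reindex (fun i : 'I_#|I| => enum_val i)) //=; exact: onW_bij (enum_val_bij _).
have MX i j : M (X i j) by rewrite mxE.
have pX : psd_mx X.
  move=> v; have := Z0 (fun a => v (enum_rank a)); rewrite re.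
  by under eq_bigr => i _ do under eq_bigr => j _ do rewrite !enum_valK;
     under [X in _ -> 0 <= X]eq_bigr => i _ do under eq_bigr => j _ do rewrite mxE.
have := cp _ X MX pX (fun i => f (enum_val i)); rewrite re.
by under eq_bigr => i _ do under eq_bigr => j _ do rewrite !mxE.
Qed.

Lemma CP_ext (Theta Theta' : bop H H -> bop L L) :
  (forall x, M x -> Theta x = Theta' x) -> von_neumann_algebra M ->
  CP M N Theta -> CP M N Theta'.
Proof.
move=> e vM [c1 c2 c3]; split=> [x Mx|a x y Mx My|n X MX pX].
- by rewrite -e//; exact: c1.
- by rewrite -!e//; [exact: c2|exact: vn_lin].
- have -> : map_mx Theta' X = map_mx Theta X by apply/matrixP => i j; rewrite !mxE e.
  exact: c3.
Qed.

End CompletePositivityFinType.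

(** * Ultraweak convergence *)

Section UltraweakLimits.
Variable R : realType.
Implicit Types (L : hilb R).

Lemma real_cauchy_cvg (u : nat -> R) :
  (forall e : R, 0 < e -> exists N, forall m n, (N <= m)%N -> (N <= n)%N ->
     `|u m - u n| < e) ->
  exists l, forall e : R, 0 < e -> exists N, forall n, (N <= n)%N -> `|l - u n| < e.
Proof.
move=> cu; suff /cvg_ex[l /= /cvgrPdist_lt ul] : cvgn u.
  by exists l => e /ul[N _ NP]; exists N => n Nn; exact: NP.
apply/cauchy_cvgP/cauchy_ballP => e e0.
have [N NP] := cu _ e0.
exists (u @` [set n | (N <= n)%N], u @` [set n | (N <= n)%N]) => /=.
  by split; exists N => // n Nn; exists n.
by move=> [_ _] /= [[m Nm <-] [n Nn <-]]; rewrite -ball_normE /= NP.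
Qed.

Lemma ccvgP (u : nat -> Cplx R) l : (u n @[n --> \oo] --> l) <->
  forall e : R, 0 < e -> exists N, forall n, (N <= n)%N -> cn (l - u n) < e.
Proof.
split=> [/cvgrPdist_lt h e e0|h].
  have := h (rc e); rewrite (rc_lt 0) => /(_ e0)[N _ NP].
  by exists N => n /NP /=; rewrite normE rc_lt.
apply/cvgrPdist_lt => e /cplx_gt0E[-> e0]; have [N NP] := h _ e0.
by exists N => // n /= /NP; rewrite normE rc_lt.
Qed.

Lemma ccauchy_cvg (u : nat -> Cplx R) :
  (forall e : R, 0 < e -> exists N, forall m n, (N <= m)%N -> (N <= n)%N ->
     cn (u m - u n) < e) -> cvgn u.
Proof.
move=> cu.
have part (f : Cplx R -> R) : (forall z w, f (z - w) = f z - f w) -> (forall z, `|f z| <= cn z) ->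
    exists l, forall e : R, 0 < e -> exists N, forall n, (N <= n)%N -> `|l - f (u n)| < e.
  move=> fB fle; apply: (@real_cauchy_cvg (fun n => f (u n))) => e e0.
  have [N NP] := cu e e0; exists N => m n Nm Nn.
  by rewrite -fB (le_lt_trans (fle _))// NP.
have [a aP] : exists l, forall e : R, 0 < e -> exists N, forall n, (N <= n)%N -> `|l - Re (u n)| < e.
  apply: (part (@complex.Re R)) => [z w|z]; first by rewrite ReD ReN.
  by rewrite ler_norml lerNl -ReN -{1}cnN !Re_le_cn.
have [b bP] : exists l, forall e : R, 0 < e -> exists N, forall n, (N <= n)%N -> `|l - Im (u n)| < e.
  apply: (part (@complex.Im R)) => [z w|z]; first by rewrite ImD ImN.
  by rewrite ler_norml lerNl -ImN -{1}cnN !Im_le_cn.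
apply/cvg_ex; exists (Complex a b); apply/ccvgP => e e0.
have [|N1 P1] := aP (e / 2); first by rewrite divr_gt0.
have [|N2 P2] := bP (e / 2); first by rewrite divr_gt0.
exists (maxn N1 N2) => n; rewrite geq_max => /andP[h1 h2].
apply: le_lt_trans (cn_le _) _; rewrite ReD ReN ImD ImN /=.
by have := P1 n h1; have := P2 n h2; lra.
Qed.

Lemma ccvg_lim (u : nat -> Cplx R) l : u n @[n --> \oo] --> l -> limn u = l.
Proof. by move=> ul; apply: cvg_lim => //; exact: norm_hausdorff. Qed.

Lemma sq_summable_tail L (xi : nat -> L) : sq_summable xi ->
  forall e : R, 0 < e -> exists N, forall m n, (N <= m)%N -> (m <= n)%N ->
    \sum_(m <= k < n) hn (xi k) ^+ 2 < e.
Proof.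
move=> /cvg_ex[l /= /ccvgP xl] e e0.
have [|N NP] := xl (e / 2); first by rewrite divr_gt0.
exists N => m n Nm mn.
have h1 := NP m Nm; have h2 := NP n (leq_trans Nm mn).
pose s p := \sum_(0 <= k < p) (`|xi k| ^+ 2 : Cplx R).
rewrite -/(s m) in h1; rewrite -/(s n) in h2.
have sE : s n - s m = rc (\sum_(m <= k < n) hn (xi k) ^+ 2).
  rewrite /s (big_cat_nat (n := m) (p := n))//= addrAC subrr add0r.
  rewrite (big_morph (@rc R) (@rcD R) (rc0 R)); apply: eq_bigr => k _.
  by rewrite hnE rcX.
have -> : \sum_(m <= k < n) hn (xi k) ^+ 2 = cn (s n - s m).
  by rewrite sE cn_rc ger0_norm// sumr_ge0// => k _; rewrite sqr_ge0.
rewrite -(subrKA l); apply: le_lt_trans (cnD _ _) _.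
by rewrite -[s n - l]opprB cnN; lra.
Qed.

Lemma cn_inner_sq L (T : bop L L) c (x y : L) : (forall x, hn (T x) <= c * hn x) -> 0 <= c ->
  cn (inner (T x) y) <= c * (hn x ^+ 2 + hn y ^+ 2).
Proof.
move=> Tc c0; apply: le_trans (cn_inner_le _ _) _.
have h1 := Tc x; have y0 := hn_ge0 y; have x0 := hn_ge0 x.
have : hn (T x) * hn y <= c * hn x * hn y by rewrite ler_wpM2r.
have : 0 <= (hn x - hn y) ^+ 2 by rewrite sqr_ge0.
rewrite sqrrB => h2; have : 0 <= c * (hn x ^+ 2 - hn x * hn y *+ 2 + hn y ^+ 2).
  by rewrite mulr_ge0.
lra.
Qed.

(** The tail is dominated by (c + 1) times the sum of |xi k|^2 + |eta k|^2. Being uniform in T, this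
    allows a limit in n inside the series. *)
Lemma uw_tail L (xi eta : nat -> L) c : sq_summable xi -> sq_summable eta -> 0 <= c ->
  forall e : R, 0 < e -> exists N, forall T : bop L L, (forall x, hn (T x) <= c * hn x) ->
    forall m n, (N <= m)%N -> (m <= n)%N ->
    cn (\sum_(m <= k < n) inner (T (xi k)) (eta k)) < e.
Proof.
move=> sx sy c0 e e0.
have c1 : 0 < 2 * (c + 1) by rewrite mulr_gt0//; lra.
have [|N1 P1] := sq_summable_tail sx (e := e / (2 * (c + 1))); first by rewrite divr_gt0.
have [|N2 P2] := sq_summable_tail sy (e := e / (2 * (c + 1))); first by rewrite divr_gt0.
exists (maxn N1 N2) => T Tc m n; rewrite geq_max => /andP[h1 h2] mn.
apply: le_lt_trans (cn_sum _ _ _) _.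
apply: le_lt_trans (_ : \sum_(m <= k < n) (c + 1) * (hn (xi k) ^+ 2 + hn (eta k) ^+ 2) < _).
  apply: ler_sum => k _; apply: le_trans (cn_inner_sq _ _ Tc c0) _.
  by rewrite ler_wpM2r ?addr_ge0 ?sqr_ge0//; lra.
rewrite -mulr_sumr big_split /=.
have := P1 m n h1 mn; have := P2 m n h2 mn; set a := \sum_(_ <= _ < _) _; set b := \sum_(_ <= _ < _) _.
rewrite !ltr_pdivlMr//; lra.
Qed.

Lemma series_diff (u : nat -> Cplx R) m n : (m <= n)%N ->
  series u n - series u m = \sum_(m <= k < n) u k.
Proof. by move=> mn; rewrite /series /= (big_cat_nat (n := m) (p := n))//= addrAC subrr add0r. Qed.

Lemma uw_functional_cvg L (xi eta : nat -> L) (T : bop L L) :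
  sq_summable xi -> sq_summable eta ->
  series (fun k => inner (T (xi k)) (eta k)) n @[n --> \oo] --> uw_functional xi eta T.
Proof.
move=> sx sy; rewrite /uw_functional.
set s := series _; suff /cvg_ex[l /= sl] : cvgn s by rewrite (ccvg_lim sl).
apply: ccauchy_cvg => e e0; have [c c0 Tc] := bop_bounded T.
have [N NP] := uw_tail sx sy c0 e0; exists N => m n Nm Nn.
have [mn|/ltnW nm] := leqP m n; last by rewrite series_diff// NP.
by rewrite -cnN opprB series_diff// NP.
Qed.

(** Strong convergence takes care of finitely many vectors xi k, the uniform tail estimate of the
    rest. *)
Lemma uw_cvg_strong L (T_ : nat -> bop L L) (T : bop L L) c : 0 <= c ->
  (forall n x, hn (T_ n x) <= c * hn x) ->
  (forall x (e : R), 0 < e -> exists N, forall n, (N <= n)%N -> hn (T x - T_ n x) < e) ->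
  uw_cvg T_ T.
Proof.
move=> c0 Tc Tcvg xi eta sx sy; apply/ccvgP => e e0.
have [d d0 Td] := bop_bounded T.
(* Four quarters: the truncation of each of the two series, and the head and the tail of their
   difference. *)
have e4 : 0 < e / 4 by rewrite divr_gt0.
have [K KP] := uw_tail sx sy (addr_ge0 c0 d0) e4.
have bound n x : hn ((T - T_ n) x) <= (c + d) * hn x.
  rewrite bopBE; apply: le_trans (hnD _ _) _; rewrite hnN mulrDl addrC lerD//.
pose W := \sum_(0 <= k < K) 2 * hn (eta k).
have W0 : 0 <= W by apply: sumr_ge0 => k _; rewrite mulr_ge0 ?hn_ge0.
pose r := e / 4 / (W + 1).
have r0 : 0 < r by rewrite divr_gt0//; lra.
have /choice[f fP] k : exists N, forall n, (N <= n)%N -> hn (T (xi k) - T_ n (xi k)) < r.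
  exact: Tcvg.
exists (\max_(k < K) f k) => n Nn.
have [N1 P1] := (ccvgP _ _).1 (@uw_functional_cvg L xi eta T sx sy) _ e4.
have [N2 P2] := (ccvgP _ _).1 (@uw_functional_cvg L xi eta (T_ n) sx sy) _ e4.
pose m := maxn K (maxn N1 N2).
have [Km N1m N2m] : [/\ K <= m, N1 <= m & N2 <= m]%N.
  by rewrite /m !leq_max !leqnn !orbT.
have h1 := P1 m N1m; have h2 := P2 m N2m.
set s1 := series _ m in h1; set s2 := series _ m in h2.
have h3 : cn (s1 - s2) < e / 2.
  have -> : s1 - s2 = \sum_(0 <= k < K) inner ((T - T_ n) (xi k)) (eta k) +
      \sum_(K <= k < m) inner ((T - T_ n) (xi k)) (eta k).
    rewrite -big_cat_nat// /s1 /s2 /series /= -sumrB; apply: eq_bigr => k _.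
    by rewrite -innerBl.
  apply: le_lt_trans (cnD _ _) _.
  have h4 := KP _ (bound n) K m (leqnn K) Km.
  suff : cn (\sum_(0 <= k < K) inner ((T - T_ n) (xi k)) (eta k)) <= e / 4 by lra.
  apply: le_trans (cn_sum _ _ _) _.
  apply: le_trans (_ : W * r <= _); last first.
    rewrite /r mulrA ler_pdivrMr; last lra.
    by rewrite mulrC ler_wpM2l ?(ltW e4)//; lra.
  rewrite mulr_suml big_nat_cond [leRHS]big_nat_cond; apply: ler_sum => k.
  rewrite andbT => /andP[_ kK]; apply: le_trans (cn_inner_le _ _) _.
  rewrite -mulrA ler_wpM2l// mulrC ler_wpM2l ?hn_ge0// ltW// fP//.
  by apply: leq_trans Nn; exact: (@leq_bigmax _ (fun k : 'I_K => f k) (Ordinal kK)).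
have -> : uw_functional xi eta T - uw_functional xi eta (T_ n) =
   (uw_functional xi eta T - s1) + (s1 - s2) - (uw_functional xi eta (T_ n) - s2).
  by rewrite subrKA opprB addrA subrK.
apply: le_lt_trans (cnD _ _) _; rewrite cnN.
have := cnD (uw_functional xi eta T - s1) (s1 - s2); lra.
Qed.

(** On sequences concentrated at index 0 the ultraweak functional is a single matrix coefficient. *)
Lemma uw_cvg_weak L (T_ : nat -> bop L L) (T : bop L L) x y : uw_cvg T_ T ->
  forall e : R, 0 < e -> exists N, forall n, (N <= n)%N ->
    cn (inner (T x) y - inner (T_ n x) y) < e.
Proof.
pose d (z : L) (k : nat) := if k == 0%N then z else 0.
have ser (u : nat -> Cplx R) : (forall k, u k.+1 = 0) ->
    series u n @[n --> \oo] --> u 0%N.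
  move=> u0; apply/ccvgP => e e0; exists 1%N => -[//|n _].
  rewrite /series /= big_nat_recl// big1 ?addr0 ?subrr ?cn0//.
have sd z : sq_summable (d z).
  apply/cvg_ex; eexists; apply: ser => k; rewrite /d /= normr0.
  by rewrite expr0n.
have uE (S : bop L L) : uw_functional (d x) (d y) S = inner (S x) y.
  apply: ccvg_lim; apply: (ser (fun k => inner (S (d x k)) (d y k))) => k.
  by rewrite /d /= bop0 inner0l.
by move=> /(_ (d x) (d y) (sd x) (sd y)) /ccvgP; rewrite uE => h e /h[N NP];
  exists N => n /NP; rewrite uE.
Qed.

Lemma uw_cvg_uniq L (T_ : nat -> bop L L) (S T : bop L L) :
  uw_cvg T_ S -> uw_cvg T_ T -> S = T.
Proof.
move=> hS hT; apply: bop_eqP => x; apply: hi_eqP => y; rewrite /hi; congr Re.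
apply/eqP; rewrite -subr_eq0 -normr_eq0 normE; apply/eqP; congr rc.
apply/le_anti; rewrite cn_ge0 andbT; apply: (@le_eps _ _ _ 2) => e e0.
have [N1 P1] := uw_cvg_weak x y hS e0; have [N2 P2] := uw_cvg_weak x y hT e0.
have := P1 _ (leq_maxl N1 N2); have := P2 _ (leq_maxr N1 N2).
set w := inner (T_ _ x) y => h1 h2; rewrite -(subrKA w).
apply: le_trans (cnD _ _) _; rewrite -[w - _]opprB cnN; lra.
Qed.

End UltraweakLimits.

(** * The Stinespring space of Gamma and the maps it induces *)

Section StinespringRepresentation.
Variable R : realType.
Variables H L G : hilb R.
Variables (M : set (bop H H)) (N : set (bop L L)).
Variables (Phi Psi : bop H H -> bop L L).
Variables (pi : bop H H -> bop G G) (V : bop L G) (A B : bop G G).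
Hypothesis vM : von_neumann_algebra M.
Hypothesis vN : von_neumann_algebra N.
Hypothesis cPhi : CP M N Phi.
Hypothesis cPsi : CP M N Psi.
Hypothesis stine : minimal_stinespring M (Phi + Psi) pi V.
Hypothesis rnA : radon_nikodym M pi V Phi A.
Hypothesis rnB : radon_nikodym M pi V Psi B.

Definition orbit : set G := [set v | exists x xi, M x /\ v = pi x (V xi)].

Lemma orbit_dense : closure (lin_span orbit) = [set: G].
Proof. by have [_ _ ->] := stine. Qed.

Lemma pi_lin a x y : M x -> M y -> pi (a *: x + y) = a *: pi x + pi y.
Proof. by have [[l _ _ _] _ _] := stine; exact: l. Qed.
Lemma pi_mul x y : M x -> M y -> pi (x \ob y) = pi x \ob pi y.
Proof. by have [[_ l _ _] _ _] := stine; exact: l. Qed.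
Lemma pi_adj x : M x -> pi (adj x) = adj (pi x).
Proof. by have [[_ _ l _] _ _] := stine; exact: l. Qed.
Lemma eq_on_orbit (K : hilb R) (S T : bop G K) :
  (forall x xi, M x -> S (pi x (V xi)) = T (pi x (V xi))) -> S = T.
Proof.
move=> ST; apply: (eq_on_dense orbit_dense) => _ [n [a [s [sO ->]]]].
rewrite !bop_sum; apply: eq_bigr => i _; rewrite !bopZ.
by have [x [xi [Mx ->]]] := sO i; rewrite ST.
Qed.

(** The rank-one operator w |-> <w, v> v vanishes on the orbit, hence everywhere, and at v this
    gives |v|^4 = 0. *)
Lemma orth_orbit v : (forall y eta, M y -> inner v (pi y (V eta)) = 0) -> v = 0.
Proof.
move=> h; have [S SP] : exists S : bop G G, forall w, S w = inner w v *: v.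
  have lf : linear (fun w => inner w v *: v).
    by move=> a x y /=; rewrite innerDl innerZl scalerDl scalerA.
  have fc w : hn (inner w v *: v) <= (2 * hn v * hn v) * hn w.
    rewrite hnZ; have := cn_inner_le w v; have := hn_ge0 v => h0 h1.
    have : cn (inner w v) * hn v <= 2 * (hn w * hn v) * hn v by rewrite ler_wpM2r.
    lra.
  by exists (Bop (bounded_opI lf fc)).
have : S = 0.
  apply: eq_on_orbit => x xi Mx; rewrite SP bop0E inner_conj h//.
  by rewrite conjC0 scale0r.
move=> /(congr1 (fun S : bop G G => inner (S v) v)); rewrite bop0E inner0l SP.
rewrite innerZl inner_sqr -expr2 => /eqP; rewrite sqrf_eq0 => /eqP hv.
apply: hn_eq0; apply/eqP; rewrite -sqrf_eq0; apply/eqP.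
exact: (congr1 (@complex.Re R) hv).
Qed.

Definition pi_comm (T : bop G G) := forall x, M x -> T \ob pi x = pi x \ob T.

Lemma commutantP T : commutant (pi @` M) T <-> pi_comm T.
Proof.
split=> [h x Mx|h _ [x Mx <-]]; last exact: h.
by apply: h; exists x.
Qed.

Lemma A_comm : pi_comm A. Proof. by apply/commutantP; case: rnA. Qed.
Lemma B_comm : pi_comm B. Proof. by apply/commutantP; case: rnB. Qed.
Lemma A_psd : psd A. Proof. by case: rnA. Qed.
Lemma B_psd : psd B. Proof. by case: rnB. Qed.
Lemma PhiE x : M x -> Phi x = adj V \ob A \ob pi x \ob V.
Proof. by case: rnA => _ _ _; apply. Qed.
Lemma PsiE x : M x -> Psi x = adj V \ob B \ob pi x \ob V.
Proof. by case: rnB => _ _ _; apply. Qed.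

(** The map with prospective Radon-Nikodym derivative T with respect to Gamma. *)
Definition cpmap (T : bop G G) (x : bop H H) : bop L L :=
  adj V \ob T \ob pi x \ob V.

Lemma cpmapE T x y xi eta : pi_comm T -> M x -> M y ->
  inner (cpmap T (adj y \ob x) xi) eta = inner (T (pi x (V xi))) (pi y (V eta)).
Proof.
move=> Tc Mx My; rewrite /cpmap !bcompE adjP' pi_mul//; last exact: vn_adj.
rewrite bcompE -bcompE Tc ?bcompE; last exact: vn_adj.
by rewrite pi_adj// adjP'.
Qed.

Lemma GammaE x : M x -> (Phi + Psi) x = cpmap (bid G) x.
Proof. by case: stine => _ h _ Mx; rewrite h//; apply: bop_eqP. Qed.

Lemma bid_comm : pi_comm (bid G).
Proof. by move=> x _; apply: bop_eqP. Qed.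

(** The derivatives are given separately; minimality forces the sum, because A + B and 1 have the
    same matrix coefficients between orbit vectors. *)
Lemma AB_id : A + B = bid G.
Proof.
apply: eq_on_orbit => x xi Mx; apply/eqP; rewrite -subr_eq0; apply/eqP.
apply: orth_orbit => y eta My; rewrite innerBl bopDE innerDl.
rewrite -!cpmapE//; last first.
- exact: A_comm.
- exact: B_comm.
- exact: bid_comm.
rewrite -GammaE; last by apply: (vn_comp vM) => //; exact: vn_adj.
rewrite /cpmap -PhiE -?PsiE; try by apply: (vn_comp vM) => //; exact: vn_adj.
by rewrite -innerDl -bopDE subrr.
Qed.

Lemma AB_comm : A \ob B = B \ob A.
Proof.
have -> : B = bid G - A by rewrite -AB_id addrC addKr.
by apply: bop_eqP => x; rewrite !bcompE !bopBE !bidE bopB.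
Qed.

Lemma Gamma_CP n (X : 'M[bop H H]_n) : (forall i j, M (X i j)) ->
  psd_mx X -> psd_mx (map_mx (Phi + Psi) X).
Proof.
move=> MX pX v; have [_ _ c1] := cPhi; have [_ _ c2] := cPsi.
have := addr_ge0 (c1 n X MX pX v) (c2 n X MX pX v).
rewrite -big_split; congr (0 <= _); apply: eq_bigr => i _ /=.
by rewrite -big_split; apply: eq_bigr => j _; rewrite !mxE /= -innerDl.
Qed.

Lemma Gamma_is_CP : CP M N (Phi + Psi).
Proof.
have [c1 l1 _] := cPhi; have [c2 l2 _] := cPsi; split.
- by move=> x Mx; apply: (vnD vN); [exact: c1|exact: c2].
- move=> a x y Mx My; rewrite !fctE l1// l2// scalerDr addrACA.
  by [].
- exact: Gamma_CP.
Qed.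

(** Several vectors are written over one family y so that the matrix y_k^* X_ij y_l of [pi_psd_mx]
    can be formed. The index is a pair (owner, position), coefficients vanish outside the owner's
    block, and scalars are absorbed into them. *)
Lemma span_words n (w : 'I_n -> G) : (forall j, lin_span orbit (w j)) ->
  exists (I : finType) (y : I -> bop H H) (xi : 'I_n -> I -> L),
    (forall i, M (y i)) /\ forall j, w j = \sum_i pi (y i) (V (xi j i)).
Proof.
move=> wO.
have /choice[f fP] j : exists p : nat * (nat -> bop H H) * (nat -> L),
    (forall k, M (p.1.2 k)) /\
    forall m, (p.1.1 <= m)%N -> w j = \sum_(k < m) pi (p.1.2 k) (V (p.2 k)).
  have [m [a [s [sO wE]]]] := wO j.
  have /choice[z zP] (i : 'I_m) : exists z : bop H H * L, M z.1 /\ s i = pi z.1 (V z.2).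
    by have [x [xi [Mx e]]] := sO i; exists (x, xi).
  (* Padding past the length with 1 in M and the vector 0, so that all words can be read up to the
     same length. *)
  pose y k := if insub k is Some i then (z i).1 else bid H.
  pose x k := if insub k is Some i then a i *: (z i).2 else 0.
  exists (m, y, x); split=> [k|m' mm'] /=.
    rewrite /y; case: insubP => [i _ _|_]; first exact: (zP i).1.
    exact: vn_id.
  rewrite -(big_mkord xpredT (fun k => pi (y k) (V (x k)))) (big_cat_nat (n := m))//=.
  rewrite [X in _ + X]big_nat_cond [X in _ + X]big1 ?addr0; last first.
    move=> k; rewrite andbT => /andP[mk _].
    by rewrite /x insubF ?bop0// ltnNge mk.
  rewrite big_mkord wE; apply: eq_bigr => i _.
  by rewrite /y /x !valK (zP i).2 !bopZ.
pose m := \max_j (f j).1.1.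
exists (('I_n * 'I_m)%type : finType), (fun p : 'I_n * 'I_m => (f p.1).1.2 p.2),
  (fun j (p : 'I_n * 'I_m) => if p.1 == j then (f j).2 p.2 else 0); split=> [p|j].
  exact: (fP p.1).1.
have [_ /(_ m) ->] := fP j; last exact: (@leq_bigmax _ (fun j => (f j).1.1)).
rewrite -(pair_big xpredT xpredT (fun i k : 'I__ => pi ((f i).1.2 k)
  (V (if i == j then (f j).2 k else 0)))) /=.
rewrite (bigD1 j)//= [X in _ + X]big1 ?addr0; last first.
  by move=> i /negbTE ij; rewrite big1// => k _; rewrite ij !bop0.
by apply: eq_bigr => k _; rewrite eqxx.
Qed.

(* pi is positive on matrices over M because Gamma is, by minimality. *)
Lemma pi_psd_mx n (X : 'M[bop H H]_n) : (forall i j, M (X i j)) ->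
  psd_mx X -> psd_mx (map_mx pi X).
Proof.
move=> MX pX.
have on_span (w : 'I_n -> G) : (forall j, lin_span orbit (w j)) ->
    0 <= \sum_i \sum_j inner (pi (X i j) (w j)) (w i).
  move=> /span_words[I [y [xi [My wE]]]].
  (* Compressing X by the column of the y k keeps it positive and inside M, and the form of Gamma(Z)
     at the xi is the form of pi(X) at w. *)
  pose Z (p q : 'I_n * I) := adj (y p.2) \ob (X p.1 q.1 \ob y q.2).
  have MZ p q : M (Z p q).
    apply: (vn_comp vM); first exact/(vn_adj vM)/My.
    by apply: (vn_comp vM) => //; exact: My.
  have := cp_fin (fun p : 'I_n * I => xi p.1 p.2) Gamma_is_CP MZ.
  have -> : \sum_i \sum_j inner (pi (X i j) (w j)) (w i) =
      \sum_a \sum_b inner ((Phi + Psi) (Z a b) (xi b.1 b.2)) (xi a.1 a.2).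
    have termE i j k l : inner (pi (X i j) (pi (y l) (V (xi j l)))) (pi (y k) (V (xi i k)))
        = inner ((Phi + Psi) (Z (i, k) (j, l)) (xi j l)) (xi i k).
      rewrite GammaE; last exact: MZ.
      rewrite cpmapE//; [|exact: bid_comm|exact: (vn_comp vM)].
      by rewrite bidE pi_mul.
    rewrite -(pair_bigA _ (fun i k => \sum_b
      inner ((Phi + Psi) (Z (i, k) b) (xi b.1 b.2)) (xi i k))) /=.
    apply: eq_bigr => i _.
    transitivity (\sum_j \sum_k \sum_l
        inner ((Phi + Psi) (Z (i, k) (j, l)) (xi j l)) (xi i k)).
      apply: eq_bigr => j _; rewrite !wE bop_sum inner_sumr; apply: eq_bigr => k _.
      by rewrite inner_suml; apply: eq_bigr => l _; rewrite termE.
    rewrite exchange_big /=; apply: eq_bigr => k _.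
    by rewrite (pair_bigA _ (fun j l => inner ((Phi + Psi) (Z (i, k) (j, l)) (xi j l)) (xi i k))).
  apply => v.
  pose v' i k := v (i, k).
  have vE a : v a = v' a.1 a.2 by case: a.
  have := pX (fun i => \sum_k y k (v' i k)); congr (0 <= _).
  transitivity (\sum_a \sum_b inner (Z a b (v' b.1 b.2)) (v' a.1 a.2)); last first.
    by apply: eq_bigr => a _; apply: eq_bigr => b _; rewrite -!vE.
  rewrite -(pair_bigA _ (fun i k => \sum_b inner (Z (i, k) b (v' b.1 b.2)) (v' i k))) /=.
  apply: eq_bigr => i _; under [RHS]eq_bigr => k _ do
    rewrite -(pair_bigA _ (fun j l => inner (Z (i, k) (j, l) (v' j l)) (v' i k))) /=.
  rewrite exchange_big /=; apply: eq_bigr => j _; rewrite inner_sumr.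
  apply: eq_bigr => k _; rewrite bop_sum inner_suml; apply: eq_bigr => l _.
  by rewrite /Z /= adjP'.
move=> w; under eq_bigr => i _ do under eq_bigr => j _ do rewrite mxE.
have /choice[c cP] (p : 'I_n * 'I_n) :
    exists c : R, 0 <= c /\ forall x, hn (pi (X p.1 p.2) x) <= c * hn x.
  by have [c c0 cP] := bop_bounded (pi (X p.1 p.2)); exists c.
pose K := \sum_i \sum_j (2 * c (i, j) * (hn (w j) + 1 + hn (w i))).
have K0 : 0 <= K.
  apply: sumr_ge0 => i _; apply: sumr_ge0 => j _.
  by rewrite !mulr_ge0 ?(cP _).1// !addr_ge0 ?hn_ge0.
apply: cplx_ge0_approx => e e0.
pose d := Num.min 1 (e / (K + 1)).
have d0 : 0 < d by rewrite lt_min ltr01 divr_gt0//; lra.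
have /choice[w' w'P] j : exists w', lin_span orbit w' /\ hn (w j - w') < d.
  have /closureP/(_ d d0)[w' w'O wd] : closure (lin_span orbit) (w j) by rewrite orbit_dense.
  by exists w'.
exists (\sum_i \sum_j inner (pi (X i j) (w' j)) (w' i)).
  by apply: on_span => j; exact: (w'P j).1.
have d1 : d <= 1 by rewrite ge_min lexx.
apply: le_trans (_ : K * d <= _); last first.
  apply: le_trans (_ : (K + 1) * (e / (K + 1)) <= _); last first.
    by rewrite mulrC divfK// gt_eqF//; lra.
  by apply: ler_pM => //; [exact: ltW|lra|rewrite ge_min lexx orbT].
rewrite -sumrB; apply: le_trans (cn_sum _ _ _) _; rewrite mulr_suml ler_sum// => i _.
rewrite -sumrB; apply: le_trans (cn_sum _ _ _) _; rewrite mulr_suml ler_sum// => j _.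
have -> : inner (pi (X i j) (w j)) (w i) - inner (pi (X i j) (w' j)) (w' i) =
    inner (pi (X i j) (w j - w' j)) (w i) + inner (pi (X i j) (w' j)) (w i - w' i).
  by rewrite bopB innerBl innerBr addrA subrK.
apply: le_trans (cnD _ _) _.
have [c0 cij] := cP (i, j); rewrite /= in cij; move: (c (i, j)) c0 cij => k k0 kP.
have := cn_inner_le (pi (X i j) (w j - w' j)) (w i).
have := cn_inner_le (pi (X i j) (w' j)) (w i - w' i).
have := kP (w j - w' j); have := kP (w' j).
have hw' : hn (w' j) <= hn (w j) + 1.
  rewrite -{1}(subrK (w j) (w' j)) addrC; apply: le_trans (hnD _ _) _.
  by rewrite lerD2l hnB (le_trans (ltW (w'P j).2)).
have hi' := ltW (w'P i).2; have hj' := ltW (w'P j).2 => h1 h2 h3 h4.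
have t1 : hn (pi (X i j) (w' j)) * hn (w i - w' i) <= k * (hn (w j) + 1) * d.
  apply: ler_pM => //; [exact: hn_ge0|exact: hn_ge0|].
  by apply: le_trans h1 _; rewrite ler_wpM2l.
have t2 : hn (pi (X i j) (w j - w' j)) * hn (w i) <= k * d * hn (w i).
  rewrite ler_wpM2r ?hn_ge0//; apply: le_trans h2 _; by rewrite ler_wpM2l.
lra.
Qed.

(** With S = pi(x) this puts T in the commutant of pi(M); with S an intertwiner of N' it makes
    [cpmap T] take values in N. *)
Definition bicomm (T : bop G G) := forall S : bop G G,
  S \ob A = A \ob S -> S \ob B = B \ob S -> S \ob T = T \ob S.

Lemma bicomm_A : bicomm A. Proof. by []. Qed.
Lemma bicomm_B : bicomm B. Proof. by []. Qed.

Lemma bicomm_lin a T U : bicomm T -> bicomm U -> bicomm (a *: T + U).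
Proof.
move=> gT gU S SA SB; apply: bop_eqP => x.
rewrite !(bcompE, bopDE, bopZE) bopD bopZ.
by rewrite -!bcompE (gT S SA SB) (gU S SA SB).
Qed.

Lemma bicomm_sub T U : bicomm T -> bicomm U -> bicomm (T - U).
Proof. by move=> gT gU; rewrite addrC -scaleN1r; apply: bicomm_lin. Qed.

Lemma bicomm_pi_comm T : bicomm T -> pi_comm T.
Proof. by move=> gT x Mx; rewrite gT// ?A_comm ?B_comm. Qed.

Lemma commN x y' : N x -> commutant N y' -> forall u, x (y' u) = y' (x u).
Proof. by move=> /(vnP vN) h y'N u; rewrite -!bcompE h. Qed.

Lemma Gamma_N x : M x -> N (cpmap (bid G) x).
Proof. by move=> Mx; rewrite -GammaE//; case: Gamma_is_CP => h _ _; exact: h. Qed.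

Lemma gram n (x : 'I_n -> bop H H) (u : 'I_n -> L) : (forall i, M (x i)) ->
  inner (\sum_i pi (x i) (V (u i))) (\sum_i pi (x i) (V (u i))) =
  \sum_i \sum_j inner (cpmap (bid G) (adj (x i) \ob x j) (u j)) (u i).
Proof.
move=> Mx; rewrite inner_sumr; apply: eq_bigr => i _; rewrite inner_suml.
by apply: eq_bigr => j _; rewrite cpmapE//; exact: bid_comm.
Qed.

(* The representation of the commutant of N on the Stinespring space. *)
Lemma intertwiner y' : commutant N y' ->
  exists S : bop G G, forall x xi, M x -> S (pi x (V xi)) = pi x (V (y' xi)).
Proof.
move=> y'N; have [c c0 cP] := bop_bounded y'.
have [||S SP] := @extension _ G (bop H H * L)%type [set p | M p.1]
    (fun p => pi p.1 (V p.2)) (fun p => pi p.1 (V (y' p.2))) c; last first.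
- by exists S => x xi Mx; exact: (SP (x, xi) Mx).
- move=> n a s sM.
  pose x i := (s i).1; pose u i := a i *: (s i).2.
  have Mx i : M (x i) := sM i.
  have -> : \sum_i a i *: pi (s i).1 (V (y' (s i).2)) = \sum_i pi (x i) (V (y' (u i))).
    by apply: eq_bigr => i _; rewrite /u !bopZ.
  have -> : \sum_i a i *: pi (s i).1 (V (s i).2) = \sum_i pi (x i) (V (u i)).
    by apply: eq_bigr => i _; rewrite /u !bopZ.
  rewrite -(@ler_pXn2r _ 2) ?nnegrE ?mulr_ge0 ?hn_ge0// exprMn -rc_le [rc (c ^+ 2 * _)]rcM.
  rewrite -!inner_sqr (gram u Mx) (gram (fun i => y' (u i)) Mx).
  pose X := \matrix_(i < n, j < n) cpmap (bid G) (adj (x i) \ob x j).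
  have MX i j : M (adj (x i) \ob x j) by apply: (vn_comp vM) => //; exact: vn_adj.
  have pX : psd_mx X.
    move=> v; have : 0 <= inner (\sum_i pi (x i) (V (v i))) (\sum_i pi (x i) (V (v i))).
      by rewrite inner_sqr rc_ge0 sqr_ge0.
    by rewrite gram//; under [X in _ -> 0 <= X]eq_bigr => i _ do
      under eq_bigr => j _ do rewrite mxE.
  (* A0 is positive and commutes with N, where the Gram matrix X has its entries. So X times A0 is a
     positive matrix, which is the required bound on squared norms. *)
  pose A0 := rc (c ^+ 2) *: bid L - adj y' \ob y'.
  have pA0 : psd A0.
    move=> v; rewrite bopBE bopZE bcompE bidE innerBl innerZl adjP' !inner_sqr -rcM.
    rewrite -rcN -rcD rc_ge0 subr_ge0 -exprMn ler_pXn2r ?nnegrE ?mulr_ge0 ?hn_ge0//.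
  have y'aN := commutant_adj vN y'N.
  have A0X i j : A0 \ob X i j = X i j \ob A0.
    rewrite mxE; have := Gamma_N (MX i j); move: (cpmap _ _) => q Nq.
    apply: bop_eqP => v; rewrite !(bcompE, bopBE, bopZE, bidE) bopB bopZ.
    by rewrite (commN Nq y'aN) (commN Nq y'N).
  have psdA0X := @psd_mx_comm _ L n X A0 u pA0 pX A0X.
  rewrite -subr_ge0 mulr_sumr -sumrB; move: psdA0X; congr (0 <= _); apply: eq_bigr => i _.
  rewrite mulr_sumr -sumrB; apply: eq_bigr => j _.
  rewrite mxE; have := Gamma_N (MX i j); move: (cpmap _ _) => q Nq.
  rewrite !(bopBE, bopZE, bcompE, bidE) bopB bopZ innerBl innerZl.
  by rewrite (commN Nq y'aN) adjP'.
- rewrite (_ : [set v | _] = orbit) ?orbit_dense//; apply/seteqP; split=> v /=.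
    by move=> [[x xi] /= Mx ->]; exists x, xi.
  by move=> [x [xi [Mx ->]]]; exists (x, xi).
Qed.

(** By the double commutant it is enough to commute with each y' in N'. The extension S of y'
    commutes with pi(M) and, as Phi and Psi take values in N, with A and B, hence with T; moreover
    V^* S = y' V^*. *)
Lemma cpmap_N T x : bicomm T -> M x -> N (cpmap T x).
Proof.
move=> gT Mx; apply/(vnP vN) => y' y'N; have [S SP] := intertwiner y'N.
have Spi z g : M z -> S (pi z g) = pi z (S g).
  move=> Mz; rewrite -!bcompE; congr (bop_fun _ g); apply: eq_on_orbit => w xi Mw.
  rewrite !bcompE -[pi z (pi w _)]bcompE -pi_mul// !SP ?pi_mul//.
  exact: (vn_comp vM).
have VS g : adj V (S g) = y' (adj V g).
  rewrite -!bcompE; congr (bop_fun _ g); apply: eq_on_orbit => w xi Mw.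
  rewrite !bcompE SP//; exact: (commN (Gamma_N Mw) y'N).
have Scomm U (Theta : bop H H -> bop L L) : pi_comm U -> (forall z, M z -> N (Theta z)) ->
    (forall z, M z -> Theta z = cpmap U z) -> S \ob U = U \ob S.
  move=> Uc NT TU; apply: eq_on_orbit => w xi Mw; apply/eqP; rewrite -subr_eq0.
  apply/eqP/orth_orbit => y eta My; rewrite innerBl !bcompE SP//.
  have Mya := vn_adj vM My; have Myw : M (adj y \ob w) by exact: (vn_comp vM).
  rewrite -(cpmapE (y' xi))// -TU// (commN (NT _ Myw) y'N) TU//.
  rewrite -[pi y]adjK -pi_adj// -adjP -Spi// -adjP' VS.
  rewrite /cpmap !bcompE pi_mul// bcompE -[U (pi (adj y) _)]bcompE (Uc _ Mya) bcompE.
  by rewrite subrr.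
have SA : S \ob A = A \ob S.
  apply: (Scomm A Phi) => //; [exact: A_comm|by case: cPhi|exact: PhiE].
have SB : S \ob B = B \ob S.
  apply: (Scomm B Psi) => //; [exact: B_comm|by case: cPsi|exact: PsiE].
apply: bop_eqP => xi; rewrite /cpmap !bcompE -SP// -[T (S _)]bcompE -(gT S SA SB).
by rewrite bcompE VS.
Qed.

Lemma cpmap_lin T : linear_on M (cpmap T).
Proof.
move=> a x y Mx My; rewrite /cpmap pi_lin//; apply: bop_eqP => xi.
by rewrite !(bcompE, bopDE, bopZE) !(bopD, bopZ).
Qed.

Lemma cpmap_CP T : psd T -> bicomm T -> CP M N (cpmap T).
Proof.
move=> pT gT; split; first by move=> x; exact: cpmap_N.
  exact: cpmap_lin.
move=> n X MX pX v.
have := psd_mx_comm (fun i => V (v i)) pT (pi_psd_mx MX pX) _.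
have Tpi i j : T \ob (map_mx pi X) i j = (map_mx pi X) i j \ob T.
  by rewrite mxE (bicomm_pi_comm gT).
move/(_ Tpi); congr (0 <= _); apply: eq_bigr => i _; apply: eq_bigr => j _.
by rewrite !mxE /cpmap !bcompE adjP' -[T (pi _ _)]bcompE (bicomm_pi_comm gT).
Qed.

Lemma cpmap_sub T U x : cpmap (T - U) x = cpmap T x - cpmap U x.
Proof.
by apply: bop_eqP => xi; rewrite /cpmap !(bcompE, bopBE) bopB.
Qed.

Lemma cpmap_le T U : bicomm T -> bicomm U -> op_le T U ->
  cp_le M N (cpmap T) (cpmap U).
Proof.
move=> gT gU TU; apply: (@CP_ext _ _ _ M N (cpmap (U - T))) => //.
  by move=> x _; rewrite cpmap_sub.
by apply: cpmap_CP => //; exact: bicomm_sub.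
Qed.

Lemma coeff_form_proof g : bilinear_form_on M (fun x xi => inner (pi x (V xi)) g).
Proof.
split=> [xi a x y Mx My|x Mx a xi eta] /=.
  by rewrite pi_lin// bopDE bopZE innerDl innerZl.
by rewrite !bopD !bopZ innerDl innerZl.
Qed.

Definition coeff_form g : bilinear_form L M := exist _ _ (coeff_form_proof g).

(** A tensor is a functional on bilinear forms, so its pairings with the coefficients <pi(x) V xi,
    g> depend on no expression of t as a sum; such an expression only shows that some vector
    realises them. *)
Lemma htens_ex (t : tensor L M) :
  exists v, forall g, inner v g = tensor_val t (coeff_form g).
Proof.
case: t => t tP; have /= := tP; rewrite inE => -[n [a [s [sE ->]]]].
have /choice[z zP] (i : 'I_n) : exists z : bop H H * L, M z.1 /\ s i = evaluation (M := M) z.1 z.2.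
  by have [x [xi [Mx e]]] := sE i; exists (x, xi).
exists (\sum_i a i *: pi (z i).1 (V (z i).2)) => g.
rewrite inner_suml fct_sumE; apply: eq_bigr => i _.
by rewrite innerZl (zP i).2.
Qed.

(* The linear map x (x) xi |-> pi x (V xi). *)
Definition htens (t : tensor L M) : G := projT1 (cid (htens_ex t)).

Lemma htensP t g : inner (htens t) g = tensor_val t (coeff_form g).
Proof. by rewrite /htens; case: cid. Qed.

Lemma inner_inj (u v : G) : (forall g, inner u g = inner v g) -> u = v.
Proof. by move=> uv; apply: hi_eqP => g; rewrite /hi uv. Qed.

Lemma htens_linear : linear htens.
Proof.
by move=> a u v; apply: inner_inj => g; rewrite innerDl innerZl !htensP.
Qed.

Lemma htensD u v : htens (u + v) = htens u + htens v.
Proof. by have := htens_linear 1 u v; rewrite !scale1r. Qed.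

Lemma htens0 : htens 0 = 0.
Proof. by have := htensD 0 0; rewrite addr0 -{1}[htens 0]addr0 => /addrI. Qed.

Lemma htensZ a u : htens (a *: u) = a *: htens u.
Proof. by have := htens_linear a u 0; rewrite !addr0 htens0 addr0. Qed.

Lemma htens_sum n (f : 'I_n -> tensor L M) : htens (\sum_i f i) = \sum_i htens (f i).
Proof. by apply: (big_morph htens htensD htens0). Qed.

Lemma htens_pure x xi : M x -> htens (pure M x xi) = pi x (V xi).
Proof. by move=> Mx; apply: inner_inj => g; rewrite htensP pureE. Qed.

Lemma htens_dense : closure (range htens) = [set: G].
Proof.
apply/seteqP; split=> // g _; apply/closureP => e e0.
have /closureP/(_ e e0)[_ [n [a [s [sO ->]]]] ge] : closure (lin_span orbit) g.
  by rewrite orbit_dense.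
have /choice[z zP] (i : 'I_n) : exists z : bop H H * L, M z.1 /\ s i = pi z.1 (V z.2).
  by have [x [xi [Mx e']]] := sO i; exists (x, xi).
exists (\sum_i a i *: s i) => //; exists (\sum_i a i *: pure M (z i).1 (z i).2) => //.
rewrite htens_sum; apply: eq_bigr => i _.
by rewrite htensZ htens_pure ?(zP i).2//; exact: (zP i).1.
Qed.

Lemma tensor_span (t : tensor L M) : exists n (a : 'I_n -> Cplx R) (x : 'I_n -> bop H H)
    (xi : 'I_n -> L), (forall i, M (x i)) /\ t = \sum_i a i *: pure M (x i) (xi i).
Proof.
have tP : tensor_val t \in @tensor_pred _ _ L M by case: t.
have := tP; rewrite inE => -[n [a [s [sE tE]]]].
have /choice[z zP] (i : 'I_n) : exists z : bop H H * L, M z.1 /\ s i = evaluation (M := M) z.1 z.2.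
  by have [x [xi [Mx e']]] := sE i; exists (x, xi).
exists n, a, (fun i => (z i).1), (fun i => (z i).2); split=> [i|]; first exact: (zP i).1.
apply: val_inj => /=; rewrite tE.
rewrite (big_morph (fun t : tensor L M => tensor_val t) (id1 := 0) (op1 := +%R))//.
apply: eq_bigr => i _; rewrite (zP i).2 -pureE//; exact: (zP i).1.
Qed.

Lemma sesquilinear_uniq (s s' : tensor L M -> tensor L M -> Cplx R) :
  positive_sesquilinear s -> positive_sesquilinear s' ->
  (forall x y xi eta, M x -> M y ->
     s (pure M x xi) (pure M y eta) = s' (pure M x xi) (pure M y eta)) ->
  s = s'.
Proof.
have sl (q : tensor L M -> tensor L M -> Cplx R) : positive_sesquilinear q -> forall v n (a : 'I_n -> Cplx R) f,
    q (\sum_i a i *: f i) v = \sum_i a i * q (f i) v.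
  move=> [ql _ _] v n a f.
  have qD u w : q (u + w) v = q u v + q w v by have := ql v 1 u w; rewrite scale1r mul1r.
  have q0 : q 0 v = 0 by have := qD 0 0; rewrite addr0 -{1}[q 0 v]addr0 => /addrI.
  rewrite (big_morph (q^~ v) qD q0); apply: eq_bigr => i _.
  by have := ql v (a i) (f i) 0; rewrite addr0 q0 addr0.
have sr (q : tensor L M -> tensor L M -> Cplx R) : positive_sesquilinear q -> forall v n (a : 'I_n -> Cplx R) f,
    q v (\sum_i a i *: f i) = \sum_i (a i)^* * q v (f i).
  move=> [_ qr _] v n a f.
  have qD u w : q v (u + w) = q v u + q v w.
    by have := qr v 1 u w; rewrite scale1r conjC1 mul1r.
  have q0 : q v 0 = 0 by have := qD 0 0; rewrite addr0 -{1}[q v 0]addr0 => /addrI.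
  rewrite (big_morph (q v) qD q0); apply: eq_bigr => i _.
  by have := qr v (a i) (f i) 0; rewrite addr0 q0 addr0.
move=> ps ps' e; apply/funext => u; apply/funext => v.
have [n [a [x [xi [Mx ->]]]]] := tensor_span u.
have [m [b [y [eta [My ->]]]]] := tensor_span v.
rewrite !sl//; apply: eq_bigr => i _; rewrite !sr//; congr (_ * _).
by apply: eq_bigr => j _; rewrite e.
Qed.

Lemma cp_formE (Theta : bop H H -> bop L L) T : psd T -> pi_comm T ->
  (forall x, M x -> Theta x = cpmap T x) ->
  cp_form (M := M) Theta = fun u v => inner (T (htens u)) (htens v).
Proof.
move=> pT Tc TE.
set s0 := fun u v => _.
have ps0 : positive_sesquilinear s0.
  split=> [v a u w|w a u v|v]; rewrite /s0 /=.
  - by rewrite htens_linear bopD bopZ innerDl innerZl.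
  - by rewrite htens_linear innerDr innerZr.
  - exact: pT.
have s0E x y xi eta : M x -> M y ->
    s0 (pure M x xi) (pure M y eta) = inner (Theta (adj y \ob x) xi) eta.
  move=> Mx My; rewrite /s0 !htens_pure// TE ?cpmapE//.
  by apply: (vn_comp vM) => //; exact: vn_adj.
have /(xgetPex (fun _ _ => 0))[ps sE] : exists s, positive_sesquilinear s /\
       forall x y xi eta, M x -> M y ->
         s (pure M x xi) (pure M y eta) = inner (Theta (adj y \ob x) xi) eta.
  by exists s0.
by apply: sesquilinear_uniq => // x y xi eta Mx My; rewrite s0E// -sE.
Qed.

Definition nA (n : nat) : bop G G := rc n%:R *: A.
Definition par_op n : bop G G := funcalc2 (@par_fun R) (nA n) B.

Lemma nA_psd n : psd (nA n).
Proof. by apply: psdZ => //; exact: A_psd. Qed.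

Lemma nA_comm n : nA n \ob B = B \ob nA n.
Proof.
apply: bop_eqP => x; rewrite /nA !(bcompE, bopZE) bopZ.
by rewrite -!bcompE AB_comm.
Qed.

Lemma par_opP n : is_par_op (nA n) B (par_op n).
Proof. exact: funcalc2_par (nA_psd n) B_psd (nA_comm n). Qed.

Lemma par_op_psd n : psd (par_op n). Proof. by case: (par_opP n). Qed.

Lemma bicomm_par_op n : bicomm (par_op n).
Proof.
move=> S SA SB; case: (par_opP n) => _ _ _ _; apply=> //.
by apply: bop_eqP => x; rewrite /nA !(bcompE, bopZE) bopZ -!bcompE SA.
Qed.

Lemma bicomm_nA n : bicomm (nA n).
Proof. by have := bicomm_lin (rc n%:R) bicomm_A (bicomm_sub bicomm_A bicomm_A); rewrite subrr addr0. Qed.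

Lemma cpmapZ a T x : cpmap (a *: T) x = a *: cpmap T x.
Proof. by apply: bop_eqP => xi; rewrite /cpmap !(bcompE, bopZE) bopZ. Qed.

(** The choice in [cp_par] is settled by the witness [cpmap (par_op n)]; its defining relation at y
    = 1 determines the values on M. *)
Lemma cp_parE n x : M x ->
  cp_par M N ((n%:R : Cplx R) *: Phi) Psi x = cpmap (par_op n) x.
Proof.
move=> Mx.
have nPhiE z : M z -> ((n%:R : Cplx R) *: Phi) z = cpmap (nA n) z.
  by move=> Mz; rewrite fctE PhiE// /nA cpmapZ rc_nat.
have rep : compatible_rep (cp_form (M := M) ((n%:R : Cplx R) *: Phi)) (cp_form (M := M) Psi)
    htens (nA n) B.
  split.
  - by split; [exact: htens_linear|exact: htens_dense].
  - by split; [exact: nA_psd|exact: B_psd|exact: nA_comm].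
  - move=> u v; rewrite (cp_formE (nA_psd n) _ nPhiE)//.
    exact/bicomm_pi_comm/bicomm_nA.
  - by move=> u v; rewrite (cp_formE B_psd B_comm PsiE).
have fE x' y xi eta : M x' -> M y ->
    form_par (cp_form (M := M) ((n%:R : Cplx R) *: Phi)) (cp_form (M := M) Psi)
      (pure M x' xi) (pure M y eta) = inner (cpmap (par_op n) (adj y \ob x') xi) eta.
  move=> Mx' My; rewrite (form_parE _ _ rep) !htens_pure// cpmapE//.
  exact/bicomm_pi_comm/bicomm_par_op.
have /(xgetPex 0)[_ h] : exists Theta : bop H H -> bop L L, CP M N Theta /\
       forall x y xi eta, M x -> M y ->
         inner (Theta (adj y \ob x) xi) eta
         = form_par (cp_form (M := M) ((n%:R : Cplx R) *: Phi)) (cp_form (M := M) Psi) (pure M x xi) (pure M y eta).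
  exists (cpmap (par_op n)); split.
    by apply: cpmap_CP; [exact: par_op_psd|exact: bicomm_par_op].
  by move=> x' y xi eta Mx' My; rewrite fE.
apply: bop_eqP => xi; apply: hi_eqP => eta; rewrite /hi.
have := h x (bid H) xi eta Mx (vn_id vM); rewrite fE//; last exact: vn_id.
by rewrite adj_id (_ : bid H \ob x = x); [move=> <-|exact: bop_eqP].
Qed.

Lemma hi_AB x : hi (A x) x + hi (B x) x = hn x ^+ 2.
Proof. by rewrite -hiDl -bopDE AB_id hi_sqr. Qed.

Lemma A_le1 x : hi (A x) x <= hn x ^+ 2.
Proof. by have := hi_AB x; have := psd_hi x B_psd; lra. Qed.

Lemma B_le1 x : hi (B x) x <= hn x ^+ 2.
Proof. by have := hi_AB x; have := psd_hi x A_psd; lra. Qed.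

Lemma par_op_le1 n x : hn (par_op n x) <= hn x.
Proof.
have := @psd_norm_le _ _ (par_op n) 1 x ler01 (par_op_psd n); rewrite !mul1r; apply=> y.
rewrite mul1r; apply: le_trans (B_le1 y); apply: op_le_hi.
by case: (par_opP n).
Qed.

Lemma BE x : B x = x - A x.
Proof. by apply/eqP; rewrite eq_sym subr_eq -bopDE [B + A]addrC AB_id. Qed.

Definition acproj := supp_proj A.
Definition ac_op := acproj \ob B \ob acproj.

Lemma acproj_A x : acproj (A x) = A x.
Proof. exact/supp_proj_ran/psd_sym/A_psd. Qed.

Lemma A_acproj x : A (acproj x) = A x.
Proof. exact: (supp_projP A x).2. Qed.

(** B = 1 - A, and A commutes with its own support projection. *)
Lemma acproj_B x : acproj (B x) = B (acproj x).
Proof. by rewrite !BE bopB acproj_A A_acproj. Qed.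

Lemma ac_opE x : ac_op x = B (acproj x).
Proof. by rewrite /ac_op !bcompE acproj_B /acproj supp_proj_idem. Qed.

(* Hence T_n tends to B on the range of A. *)
Lemma par_op_ran n z : rc n%:R *: A (B z - par_op n z) = B (par_op n z).
Proof.
have [_ _ _ + _] := par_opP n.
move=> /(congr1 (fun T : bop G G => T z)); rewrite /nA !(bcompE, bopDE, bopZE) => h.
by rewrite bopB scalerBr -h addrC addKr.
Qed.

Lemma par_op_A n z : par_op n (A z) = A (par_op n z).
Proof. by rewrite -!bcompE (bicomm_par_op n (S := A))// AB_comm. Qed.

(** On A z the error A (B z - T_n z) = B T_n z / n has norm at most |z| / n; on ker A both operators
    vanish, T_n because T_n <= n A. Density of ker A + ran A and uniform bounds do the rest. *)
Lemma par_op_cvg x (e : R) : 0 < e ->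
  exists N, forall n, (N <= n)%N -> hn (ac_op x - par_op n x) < e.
Proof.
move=> e0; have [c c0 cP] := bop_bounded ac_op.
have sA := psd_sym A_psd.
pose d := e / 2 / (c + 1).
have d0 : 0 < d by rewrite !divr_gt0//; lra.
have /closureP/(_ d d0)[_ [x0 [z [Ax0 ->]]] xe] :
    closure [set x | exists x0 z, A x0 = 0 /\ x = x0 + A z] x.
  by rewrite ker_ran_dense.
set x' := x0 + _ in xe.
have x'E n : ac_op x' - par_op n x' = A (B z - par_op n z).
  have Tx0 : par_op n x0 = 0.
    apply: psd_ker; first exact: par_op_psd.
    have [_ le1 _ _ _] := par_opP n.
    apply/le_anti; rewrite psd_hi ?andbT; last exact: par_op_psd.
    by have := op_le_hi x0 le1; rewrite /nA bopZE Ax0 scaler0 hi0l.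
  rewrite /x' !bopD !ac_opE /acproj (supp_proj_ker Ax0) bop0 add0r Tx0 add0r.
  rewrite -/acproj acproj_A par_op_A bopN; congr (_ - _).
  by rewrite -!bcompE AB_comm.
pose K := hn z.
exists (Num.truncn (K * 2 / e)).+1 => n Nn.
have n0 : 0 < n%:R :> R by rewrite ltr0n; case: n Nn.
have Bn y : hn (B y) <= hn y.
  have := @psd_norm_le _ _ B 1 y ler01 B_psd; rewrite !mul1r; apply=> u.
  by rewrite mul1r B_le1.
have h1 : hn (ac_op x' - par_op n x') < e / 2.
  rewrite x'E -(ltr_pM2l n0).
  have -> : n%:R * hn (A (B z - par_op n z)) = hn (B (par_op n z)).
    by rewrite -par_op_ran hnZ cn_rc ger0_norm// ltW.
  apply: le_lt_trans (Bn _) _; apply: le_lt_trans (par_op_le1 _ _) _.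
  rewrite -ltr_pdivrMr ?divr_gt0// invf_div mulrA.
  by apply: lt_le_trans (truncnS_gt _) _; rewrite ler_nat.
have -> : ac_op x - par_op n x = (ac_op x' - par_op n x') + (ac_op (x - x') - par_op n (x - x')).
  rewrite !bopB; move: (ac_op x) (ac_op x') (par_op n x) (par_op n x') => p q r s.
  have -> : p - q - (r - s) = (p - r) - (q - s).
    by rewrite !opprB addrACA [RHS]addrACA [- q - r]addrC.
  by rewrite [RHS]addrC subrK.
apply: le_lt_trans (hnD _ _) _.
have := hnD (ac_op (x - x')) (- par_op n (x - x')); rewrite hnN.
have := cP (x - x'); have := par_op_le1 n (x - x').
have : (c + 1) * hn (x - x') < e / 2.
  by rewrite mulrC -ltr_pdivlMr//; lra.
lra.
Qed.

(** The reindexing f is the identity for the Lebesgue part and n |-> n + 1 for the sequence that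
    witnesses absolute continuity. *)
Lemma cpmap_par_uw (f : nat -> nat) x : (forall n, (n <= f n)%N) ->
  uw_cvg (fun n => cpmap (par_op (f n)) x) (cpmap ac_op x).
Proof.
move=> fn; have [c c0 cP] := bop_bounded (adj V).
have [d d0 dP] := bop_bounded (pi x \ob V).
have cP' u : hn (adj V u) <= (c + 1) * hn u.
  by apply: le_trans (cP u) _; rewrite ler_wpM2r ?hn_ge0//; lra.
apply: (@uw_cvg_strong _ _ _ _ ((c + 1) * d)); first by rewrite mulr_ge0//; lra.
  move=> n xi; rewrite /cpmap !bcompE; apply: le_trans (cP' _) _.
  rewrite -mulrA ler_wpM2l//; first lra.
  by apply: le_trans (par_op_le1 _ _) _; exact: dP.
move=> xi e e0; have [|K KP] := @par_op_cvg (pi x (V xi)) (e / (c + 1)).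
  by rewrite divr_gt0//; lra.
exists K => n Kn; rewrite /cpmap !bcompE -bopB; apply: le_lt_trans (cP' _) _.
rewrite mulrC -ltr_pdivlMr; last lra.
by apply: KP; apply: leq_trans (fn n).
Qed.

Lemma cp_acE x : M x -> cp_ac M N Phi Psi x = cpmap ac_op x.
Proof.
move=> Mx; have spec : pt_uw_cvg M (fun n => cp_par M N ((n%:R : Cplx R) *: Phi) Psi) (cpmap ac_op).
  move=> z Mz; have := @cpmap_par_uw (fun n => n) z (fun n => leqnn n); congr uw_cvg.
  by apply/funext => n; rewrite cp_parE.
have spec' := xgetPex 0 (ex_intro _ _ spec).
exact: uw_cvg_uniq (spec' x Mx) (spec x Mx).
Qed.

(** P commutes with B, so (1 - P) B (1 - P) = B - P B P. *)
Lemma cp_sE x : M x -> cp_s M N Phi Psi x =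
  cpmap ((bid G - acproj) \ob B \ob (bid G - acproj)) x.
Proof.
move=> Mx; rewrite /cp_s.
have -> : (bid G - acproj) \ob B \ob (bid G - acproj) = B - ac_op.
  apply: bop_eqP => u; rewrite [RHS]bopBE ac_opE !(bcompE, bopBE, bidE) acproj_B.
  by rewrite (bopB acproj) /acproj supp_proj_idem subrr bop0 subr0 bopB.
by rewrite cpmap_sub -cp_acE// -[cpmap B x]/(adj V \ob B \ob pi x \ob V) -PsiE.
Qed.

(** * CP maps as quadratic forms on words *)

Section Quadratic.
Variables (I : finType) (y : I -> bop H H).

(** Stands in for <T w, w> at w = [word xi] when Theta has no derivative T at hand; positivity and
    order can still be read off. *)
Definition qform (Theta : bop H H -> bop L L) (xi : I -> L) : Cplx R :=
  \sum_a \sum_b inner (Theta (adj (y a) \ob y b) (xi b)) (xi a).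

Definition word (xi : I -> L) : G := \sum_a pi (y a) (V (xi a)).

Hypothesis My : forall a, M (y a).

Lemma qform_mem a b : M (adj (y a) \ob y b).
Proof. by apply: (vn_comp vM) => //; exact: vn_adj. Qed.

Lemma qform_ge0 Theta xi : CP M N Theta -> 0 <= qform Theta xi.
Proof.
move=> cT; apply: (cp_fin xi cT qform_mem) => v.
have : 0 <= inner (\sum_a y a (v a)) (\sum_a y a (v a)).
  by rewrite inner_sqr rc_ge0 sqr_ge0.
congr (0 <= _); rewrite inner_sumr; apply: eq_bigr => a _; rewrite inner_suml.
by apply: eq_bigr => b _; rewrite bcompE adjP'.
Qed.

Lemma qformE T Theta xi : pi_comm T -> (forall x, M x -> Theta x = cpmap T x) ->
  qform Theta xi = inner (T (word xi)) (word xi).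
Proof.
move=> Tc TE; rewrite /word bop_sum inner_sumr; apply: eq_bigr => a _.
rewrite inner_suml; apply: eq_bigr => b _; rewrite TE ?cpmapE//.
exact: qform_mem.
Qed.

Lemma qformB Theta Theta' xi : qform (Theta - Theta') xi = qform Theta xi - qform Theta' xi.
Proof.
rewrite /qform -sumrB; apply: eq_bigr => a _; rewrite -sumrB; apply: eq_bigr => b _.
by rewrite -innerBl.
Qed.

Lemma qformZ r Theta xi : qform (r *: Theta) xi = r * qform Theta xi.
Proof.
rewrite /qform mulr_sumr; apply: eq_bigr => a _; rewrite mulr_sumr.
by apply: eq_bigr => b _; rewrite -innerZl.
Qed.

Lemma qform_parallelogram Theta xi eta :
  qform Theta (fun a => xi a + eta a) + qform Theta (fun a => xi a - eta a) =
  2 * qform Theta xi + 2 * qform Theta eta.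
Proof.
rewrite /qform !mulr_sumr -!big_split; apply: eq_bigr => a _ /=.
rewrite !mulr_sumr -!big_split; apply: eq_bigr => b _ /=.
rewrite !bopB !bopD !(innerDl, innerDr, innerBl, innerBr, innerNl, innerNr).
ring.
Qed.

Lemma wordB xi eta : word (fun a => xi a - eta a) = word xi - word eta.
Proof. by rewrite /word -sumrB; apply: eq_bigr => a _; rewrite !bopB. Qed.

End Quadratic.

(** * Two words over a common family *)

Section Concatenation.
Variables (I J : finType) (y : I -> bop H H) (z : J -> bop H H).

(** Tuples over different families can be subtracted once both are padded to the disjoint union. *)
Definition cat_word (s : I + J) := match s with inl i => y i | inr j => z j end.
Definition pad_l (xi : I -> L) (s : I + J) : L := if s is inl i then xi i else 0.
Definition pad_r (xi : J -> L) (s : I + J) : L := if s is inr j then xi j else 0.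

Lemma word_pad_l xi : word cat_word (pad_l xi) = word y xi.
Proof.
by rewrite /word big_sumType /= [X in _ + X]big1 ?addr0// => j _; rewrite !bop0.
Qed.

Lemma word_pad_r xi : word cat_word (pad_r xi) = word z xi.
Proof.
by rewrite /word big_sumType /= [X in X + _]big1 ?add0r// => j _; rewrite !bop0.
Qed.

Lemma qform_pad_l Theta xi : qform cat_word Theta (pad_l xi) = qform y Theta xi.
Proof.
rewrite /qform big_sumType /= [X in _ + X]big1 ?addr0; last first.
  by move=> j _; rewrite big1// => b _; rewrite inner0r.
apply: eq_bigr => a _; rewrite big_sumType /= [X in _ + X]big1 ?addr0//.
by move=> j _; rewrite bop0 inner0l.
Qed.

End Concatenation.

Lemma word_dense x (e : R) : 0 < e -> exists (I : finType) (y : I -> bop H H) (xi : I -> L),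
  (forall a, M (y a)) /\ hn (x - word y xi) < e.
Proof.
move=> e0; have /closureP/(_ e e0)[w wO xw] : closure (lin_span orbit) x.
  by rewrite orbit_dense.
have [I [y [xi [My wE]]]] := @span_words 1 (fun=> w) (fun=> wO).
by exists I, y, (xi ord0); split=> //; rewrite /word -wE.
Qed.

(** Polarisation over the pair (1, x): the diagonal terms vanish, and comparing u with i u separates
    <Theta(x) u, v> from its partner. *)
Lemma qform_eq0 Theta : CP M N Theta ->
  (forall (I : finType) (y : I -> bop H H) xi, (forall a, M (y a)) -> qform y Theta xi = 0) ->
  forall x, M x -> Theta x = 0.
Proof.
move=> cT h x Mx.
have h1 (z : bop H H) u : M z -> inner (Theta (adj z \ob z) u) u = 0.
  move=> Mz; have := h 'I_1 (fun=> z) (fun=> u) (fun=> Mz).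
  by rewrite /qform !big_ord1.
have h2 u v : inner (Theta (adj (bid H) \ob x) u) v + inner (Theta (adj x \ob bid H) v) u = 0.
  pose z (b : bool) := if b then x else bid H.
  have Mz b : M (z b) by case: b => //; exact: vn_id.
  have := h bool z (fun b => if b then u else v) Mz.
  rewrite /qform !big_bool /= !h1//; last exact: vn_id.
  by rewrite add0r addr0 addrC.
have xE : adj (bid H) \ob x = x by rewrite adj_id; exact: bop_eqP.
apply: bop_eqP => u; apply: hi_eqP => v; rewrite bop0E hi0l /hi.
have := h2 u v; have := h2 ('i%C *: u) v; rewrite xE bopZ innerZl innerZr.
move: (inner _ v) (inner _ u) => a b; rewrite conjE /= => /(congr1 (@complex.Im R)) + /(congr1 (@complex.Re R)).
rewrite !(ImD, ReD, ImM, ReM) /=; lra.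
Qed.

Lemma qform_hi (I : finType) (y : I -> bop H H) T Theta xi : (forall a, M (y a)) ->
  pi_comm T -> (forall x, M x -> Theta x = cpmap T x) ->
  Re (qform y Theta xi) = hi (T (word y xi)) (word y xi).
Proof. by move=> My Tc TE; rewrite (qformE My xi Tc TE). Qed.

Lemma qform_le (I : finType) (y : I -> bop H H) Theta Theta' xi : (forall a, M (y a)) ->
  cp_le M N Theta Theta' -> Re (qform y Theta xi) <= Re (qform y Theta' xi).
Proof.
move=> My /(qform_ge0 My xi); rewrite qformB cplx_ge0 ReD ReN => /andP[].
by rewrite subr_ge0.
Qed.

(** Parallelogram identity for eta and xi - eta, dropping the term at their difference. *)
Lemma qform_quad (I : finType) (y : I -> bop H H) Theta xi eta :
  (forall zeta, 0 <= Re (qform y Theta zeta)) ->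
  Re (qform y Theta xi) <= 2 * Re (qform y Theta eta) +
     2 * Re (qform y Theta (fun a => xi a - eta a)).
Proof.
move=> pos; have := qform_parallelogram y Theta eta (fun a => xi a - eta a).
have -> : (fun a => eta a + (xi a - eta a)) = xi.
  by apply/funext => a; rewrite addrC subrK.
move=> /(congr1 (@complex.Re R)); rewrite !ReD !ReM /=.
by have := pos (fun a => eta a - (xi a - eta a)); lra.
Qed.

Lemma cvg_bigsum (I : Type) (r : seq I) (F : I -> nat -> Cplx R) (l : I -> Cplx R) :
  (forall i, F i n @[n --> \oo] --> l i) ->
  (\sum_(i <- r) F i n) @[n --> \oo] --> \sum_(i <- r) l i.
Proof.
move=> h; elim: r => [|i r ih].
  by rewrite big_nil; under eq_fun do rewrite big_nil; exact: cvg_cst.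
by rewrite big_cons; under eq_fun do rewrite big_cons; apply: cvgD; [exact: h|exact: ih].
Qed.

Lemma qform_cvg (I : finType) (y : I -> bop H H) Psi_ Theta xi : (forall a, M (y a)) ->
  pt_uw_cvg M Psi_ Theta -> forall e : R, 0 < e ->
  exists K, forall n, (K <= n)%N -> `|Re (qform y Theta xi) - Re (qform y (Psi_ n) xi)| < e.
Proof.
move=> My lim e e0.
have : qform y (Psi_ n) xi @[n --> \oo] --> qform y Theta xi.
  apply: cvg_bigsum => a; apply: cvg_bigsum => b.
  by apply/ccvgP; apply: uw_cvg_weak; apply: lim; exact: qform_mem.
move=> /ccvgP/(_ e e0)[K KP]; exists K => n /KP; apply: le_lt_trans.
by rewrite -ReN -ReD ler_norml lerNl -ReN -{1}cnN !Re_le_cn.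
Qed.

Lemma word_near x (d : R) : 0 < d -> d <= 1 -> exists (I : finType) (y : I -> bop H H) (xi : I -> L),
  (forall a, M (y a)) /\ hn (x - word y xi) ^+ 2 <= d.
Proof.
move=> d0 d1; have [I [y [xi [My xd]]]] := word_dense x d0.
exists I, y, xi; split=> //; apply: le_trans (_ : d * 1 <= _); last by rewrite mulr1.
by rewrite expr2 ler_pM ?hn_ge0 ?ltW// (lt_le_trans xd).
Qed.

Lemma hn_sqr_quad (u v : G) : hn (u - v) ^+ 2 <= 2 * hn u ^+ 2 + 2 * hn v ^+ 2.
Proof. by have := parallelogram u v; have := sqr_ge0 (hn (u + v)); lra. Qed.

(** Psi_n is at most alpha_n Phi, whose form vanishes at x, while Psi - Psi_n is small at a word
    near x and bounded by the squared norm at all words. Together they make <B x, x> small. *)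
Lemma abs_cont_ker : cp_abs_cont M N Psi Phi -> forall x, A x = 0 -> B x = 0.
Proof.
move=> [Psi_ [alpha [cPn alpha0 [inc lim] le]]] x Ax.
have mono (I : finType) (y : I -> bop H H) xi n m : (forall a, M (y a)) -> (n <= m)%N ->
    Re (qform y (Psi_ n) xi) <= Re (qform y (Psi_ m) xi).
  move=> My; elim: m => [|m ih]; first by rewrite leqn0 => /eqP->.
  rewrite leq_eqVlt => /orP[/eqP->//|]; rewrite ltnS => /ih/le_trans; apply.
  exact: qform_le.
have lePsi (I : finType) (y : I -> bop H H) xi n : (forall a, M (y a)) ->
    Re (qform y (Psi_ n) xi) <= Re (qform y Psi xi).
  move=> My; apply: (@le_eps _ _ _ 1) => e e0.
  have [K KP] := qform_cvg xi My lim e0.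
  have := KP _ (leq_maxl K n); have := mono I y xi n _ My (leq_maxr K n).
  by rewrite ltr_norml => h /andP[]; lra.
apply: psd_ker; first exact: B_psd.
apply/le_anti; rewrite psd_hi ?andbT; last exact: B_psd.
(* 24 is twice the bound 11 e of [p2], plus 2 for the passage from the second word to x. *)
apply: (@le_eps _ _ _ 24) => e' e'0.
pose e := Num.min 1 e'.
have e0 : 0 < e by rewrite lt_min ltr01.
have e1 : e <= 1 by rewrite ge_min lexx.
have ee' : e <= e' by rewrite ge_min lexx orbT.
have [I [y [xi0 [My x0]]]] := word_near x e0 e1.
have [n nP] := qform_cvg xi0 My lim e0; have {nP}r0 := nP n (leqnn n).
(* The order of choices matters: the first word fixes n, and only then is a second word taken so
   close to x that the factor alpha n is absorbed. *)
pose d := Num.min e (e / alpha n).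
have d0 : 0 < d by rewrite lt_min e0 divr_gt0.
have de : d <= e by rewrite ge_min lexx.
have [J [z [xi1 [Mz x1]]]] := word_near x d0 (le_trans de e1).
pose yz := cat_word y z; pose eta0 := pad_l (J := J) xi0; pose eta1 := pad_r (I := I) xi1.
have Myz s : M (yz s) by case: s.
have w0 : word yz eta0 = word y xi0 by exact: word_pad_l.
have w1 : word yz eta1 = word z xi1 by exact: word_pad_r.
rewrite -w0 in x0; rewrite -w1 in x1.
have r0' : Re (qform yz (Psi - Psi_ n) eta0) <= e.
  rewrite qformB ReD ReN !qform_pad_l; move: r0.
  by rewrite ltr_norml => /andP[]; lra.
have rpos zeta : 0 <= Re (qform yz (Psi - Psi_ n) zeta).
  by rewrite qformB ReD ReN subr_ge0 lePsi.
have rle zeta : Re (qform yz (Psi - Psi_ n) zeta) <= hn (word yz zeta) ^+ 2.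
  rewrite qformB ReD ReN; apply: le_trans (B_le1 _).
  rewrite -(qform_hi zeta Myz B_comm PsiE) lerBlDr lerDl.
  by have := qform_ge0 Myz zeta (cPn n); rewrite cplx_ge0 => /andP[].
have r1 := qform_quad eta1 eta0 rpos.
have r2 := rle (fun a => eta1 a - eta0 a); rewrite wordB in r2.
have r3 : hn (word yz eta1 - word yz eta0) ^+ 2 <= 4 * e.
  have := hn_sqr_quad (x - word yz eta0) (x - word yz eta1).
  have -> : x - word yz eta0 - (x - word yz eta1) = word yz eta1 - word yz eta0.
    by rewrite opprB [LHS]addrC subrKA.
  lra.
have p1 : Re (qform yz (Psi_ n) eta1) <= e.
  have := qform_le eta1 Myz (le n); rewrite qformZ ReM /= mul0r subr0.
  move=> /le_trans; apply; rewrite (qform_hi eta1 Myz A_comm PhiE).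
  have -> : hi (A (word yz eta1)) (word yz eta1) =
      hi (A (x - word yz eta1)) (x - word yz eta1).
    rewrite bopB Ax sub0r !hiE (psd_sym A_psd (word yz eta1) x) Ax hi0r.
    by rewrite oppr0 sub0r opprK.
  rewrite mulrC -ler_pdivlMr//; apply: le_trans (A_le1 _) _; apply: le_trans x1 _.
  by rewrite ge_min lexx orbT.
(* One e for Psi_n and ten for Psi - Psi_n: twice its value e at the first word, plus twice the 4 e
   of [r3] for the change of word. *)
have p2 : hi (B (word yz eta1)) (word yz eta1) <= 11 * e.
  rewrite -(qform_hi eta1 Myz B_comm PsiE).
  have : Re (qform yz Psi eta1) = Re (qform yz (Psi_ n) eta1) + Re (qform yz (Psi - Psi_ n) eta1).
    by rewrite qformB ReD ReN addrC subrK.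
  lra.
have := psd_quad_le (word yz eta1) (x - word yz eta1) B_psd.
have -> : word yz eta1 + (x - word yz eta1) = x by rewrite addrC subrK.
have := B_le1 (x - word yz eta1); lra.
Qed.

Lemma cp_le_Phi T n : bicomm T -> op_le T (nA n) -> cp_le M N (cpmap T) (rc n%:R *: Phi).
Proof.
move=> gT le; have := cpmap_le gT (bicomm_nA n) le; apply: CP_ext => //.
by move=> x Mx; rewrite !fctE PhiE// /nA cpmapZ.
Qed.

Lemma cp_le_Psi T : bicomm T -> op_le T B -> cp_le M N (cpmap T) Psi.
Proof.
move=> gT le; have := cpmap_le gT bicomm_B le; apply: CP_ext => //.
by move=> x Mx; rewrite !fctE PsiE.
Qed.

(** A near-optimal splitting for m A competes for n A, at no larger cost. *)
Lemma par_op_mono n m : (n <= m)%N -> op_le (par_op n) (par_op m).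
Proof.
move=> nm; apply: psd_op_le; [exact/psd_sym/par_op_psd|exact/psd_sym/par_op_psd|].
move=> x; apply: (@le_eps _ _ _ 1) => e e0; rewrite mul1r.
have [y yP] := is_par_op_approx x (nA_psd m) B_psd (nA_comm m) (par_opP m) e0.
apply: le_trans yP.
apply: le_trans (is_par_op_le x y (nA_psd n) B_psd (nA_comm n) (par_opP n)) _.
rewrite /par_cost lerD2r /nA !bopZE !hiZl ler_wpM2r ?psd_hi ?ler_nat//.
exact: A_psd.
Qed.

(** Since x - P x lies in ker A, the hypothesis gives B P = B, and the parallel sums increase to Psi
    itself. Indices start at 1 so that alpha n is positive. *)
Lemma ker_abs_cont : (forall x, A x = 0 -> B x = 0) -> cp_abs_cont M N Psi Phi.
Proof.
move=> AB; exists (fun n => cpmap (par_op n.+1)), (fun n => n.+1%:R); split.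
- by move=> n; apply: cpmap_CP; [exact: par_op_psd|exact: bicomm_par_op].
- by move=> n; rewrite ltr0n.
- split=> [n|x Mx].
    by apply: cpmap_le; [exact: bicomm_par_op|exact: bicomm_par_op|exact: par_op_mono].
  have -> : Psi x = cpmap ac_op x.
    rewrite PsiE//; have -> : ac_op = B; last by [].
    apply: bop_eqP => u; rewrite ac_opE; apply/eqP; rewrite -subr_eq0 -bopB.
    by rewrite AB// bopB A_acproj subrr.
  by apply: (@cpmap_par_uw (fun n => n.+1)) => n; exact: leqnSn.
- move=> n; apply: cp_le_Phi; first exact: bicomm_par_op.
  by case: (par_opP n.+1).
Qed.

Lemma singular_AB : cp_singular M N Psi Phi -> A \ob B = 0.
Proof.
move=> sing.
have [p1 TA TB CT _] := par_opP 1.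
have nA1 : nA 1 = A by rewrite /nA rc1 scale1r.
have T0 : par_op 1 = 0.
  apply: eq_on_orbit => x xi Mx; rewrite bop0E; apply: orth_orbit => y eta My.
  have Myx : M (adj y \ob x) by apply: (vn_comp vM) => //; exact: vn_adj.
  rewrite -cpmapE//; last exact/bicomm_pi_comm/bicomm_par_op.
  have c1 : CP M N (cpmap (par_op 1)).
    by apply: cpmap_CP; [exact: par_op_psd|exact: bicomm_par_op].
  have c2 : cp_le M N (cpmap (par_op 1)) Phi.
    by have := cp_le_Phi (bicomm_par_op 1) TA; rewrite rc1 scale1r.
  have c3 := cp_le_Psi (bicomm_par_op 1) TB.
  by rewrite (sing _ c1 c2 c3 _ Myx) bop0E inner0l.
by rewrite -nA1 -CT T0; apply: bop_eqP => x; rewrite bcompE !bop0E bop0.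
Qed.

(** Every w splits as A w + B w. The form of Psi vanishes at A w because B A = 0, that of Phi at B w
    because A B = 0, and Theta is below both. As A w need not be a word, it is replaced by a nearby
    one. *)
Lemma AB_singular : A \ob B = 0 -> cp_singular M N Psi Phi.
Proof.
move=> AB0 Theta cT TPhi TPsi; apply: qform_eq0 => // I y xi My.
have ABx u : A (B u) = 0 by rewrite -bcompE AB0.
have BAx u : B (A u) = 0 by rewrite -bcompE -AB_comm AB0.
suff re : Re (qform y Theta xi) <= 0.
  have := qform_ge0 My xi cT => q0; rewrite (cplx_ge0E q0).
  have -> : Re (qform y Theta xi) = 0; last by [].
  by apply/le_anti; rewrite re; move: q0; rewrite cplx_ge0 => /andP[].
set w := word y xi.
(* With u the error in approximating A w, the bound is 2 <B u, u> + 2 <A u, u>, and each form is at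
   most |u|^2 <= e. *)
apply: (@le_eps _ _ _ 4) => e' e'0; rewrite add0r.
pose e := Num.min 1 e'.
have e0 : 0 < e by rewrite lt_min ltr01.
have e1 : e <= 1 by rewrite ge_min lexx.
have ee' : e <= e' by rewrite ge_min lexx orbT.
have [J [z [xi1 [Mz w1e]]]] := word_near (A w) e0 e1.
pose yz := cat_word y z; pose eta0 := pad_l (J := J) xi; pose eta1 := pad_r (I := I) xi1.
have Myz s : M (yz s) by case: s.
have w0 : word yz eta0 = w by exact: word_pad_l.
have w1 : word yz eta1 = word z xi1 by exact: word_pad_r.
have <- : qform yz Theta eta0 = qform y Theta xi by exact: qform_pad_l.
have pos zeta : 0 <= Re (qform yz Theta zeta).
  by have := qform_ge0 Myz zeta cT; rewrite cplx_ge0 => /andP[].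
have h := qform_quad eta0 eta1 pos.
have h1 := qform_le eta1 Myz TPsi.
have h2 := qform_le (fun a => eta0 a - eta1 a) Myz TPhi.
rewrite (qform_hi eta1 Myz B_comm PsiE) w1 in h1.
rewrite (qform_hi _ Myz A_comm PhiE) wordB w0 w1 in h2.
have [u uE] : exists u, u = A w - word z xi1 by eexists.
rewrite -uE in w1e.
have h3 : hi (B (word z xi1)) (word z xi1) = hi (B u) u.
  have -> : word z xi1 = A w - u by rewrite uE subKr.
  by rewrite bopB BAx sub0r !hiE (psd_sym B_psd u (A w)) BAx hi0r oppr0 sub0r opprK.
have h4 : hi (A (w - word z xi1)) (w - word z xi1) = hi (A u) u.
  have -> : w - word z xi1 = u + B w.
    by rewrite uE BE [RHS]addrC subrKA.
  by rewrite bopD ABx addr0 !hiE (psd_sym A_psd u (B w)) ABx hi0r addr0.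
rewrite h3 in h1; rewrite h4 in h2.
have := A_le1 u; have := B_le1 u; lra.
Qed.

End StinespringRepresentation.

(** * Inclusion, order and orthogonality of support projections *)

Section SupportProjections.
Variables (R : realType) (H : hilb R).
Implicit Types (A B : bop H H).

Lemma supp_proj_contr A x : hn (supp_proj A x) <= hn x.
Proof.
have : hn (supp_proj A x) ^+ 2 <= hn (supp_proj A x) * hn x.
  by rewrite -hi_sqr -supp_proj_sym supp_proj_idem hi_le.
have [->|n0] := eqVneq (hn (supp_proj A x)) 0; first by rewrite hn_ge0.
by rewrite expr2 ler_pM2l// lt_neqAle eq_sym n0 hn_ge0.
Qed.

Lemma hi_supp_proj A x : hi (supp_proj A x) x = hn (supp_proj A x) ^+ 2.
Proof. by rewrite -hi_sqr -supp_proj_sym supp_proj_idem. Qed.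

Lemma supp_range_sub A B : (forall x, A x = 0 -> B x = 0) <->
  range (supp_proj B) `<=` range (supp_proj A).
Proof.
split=> [AB u /supp_rangeP uB|sub x Ax].
  apply/supp_rangeP/supp_proj_id => v /AB Bv; rewrite -uB.
  exact: (supp_projP B u).1.
apply: supp_proj_eq0; apply: hn_eq0; apply/eqP; rewrite -sqrf_eq0 -hi_supp_proj.
have /supp_rangeP <- : range (supp_proj A) (supp_proj B x) by apply: sub; exists x.
by rewrite supp_proj_sym (supp_proj_ker Ax) hi0r.
Qed.

(** For the converse, u in the range of P_B satisfies |u|^2 = <P_B u, u> <= |P_A u|^2, while |u -
    P_A u|^2 = |u|^2 - |P_A u|^2. *)
Lemma supp_range_le A B : range (supp_proj B) `<=` range (supp_proj A) <->
  op_le (supp_proj B) (supp_proj A).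
Proof.
split=> [sub|le u /supp_rangeP uB].
  apply: psd_op_le; [exact: supp_proj_sym|exact: supp_proj_sym|move=> x].
  have BA : supp_proj B (supp_proj A x) = supp_proj B x.
    apply: hi_eqP => y; rewrite !supp_proj_sym.
    by have /supp_rangeP -> : range (supp_proj A) (supp_proj B y) by apply: sub; exists y.
  rewrite !hi_supp_proj -BA ler_pXn2r ?nnegrE ?hn_ge0//.
  exact: supp_proj_contr.
apply/supp_rangeP/eqP; rewrite -subr_eq0; apply/eqP/hn_eq0/eqP.
rewrite -sqrf_eq0 eq_le sqr_ge0 andbT.
have := op_le_hi u le; rewrite uB hi_supp_proj hi_sqr.
rewrite -[X in _ -> X <= _]hi_sqr !hiE hi_sqr hi_sqr (hiC u) hi_supp_proj; lra.
Qed.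

Lemma supp_orth A B :
  (forall u v, range (supp_proj B) u -> range (supp_proj A) v -> inner u v = 0) <->
  supp_proj B \ob supp_proj A = 0.
Proof.
split=> [orth|BA0 _ _ [u _ <-] [v _ <-]].
  apply: bop_eqP => x; apply: hi_eqP => y.
  by rewrite bcompE bop0E hi0l supp_proj_sym hiC /hi orth; [|exists y|exists x].
rewrite (sym_inner (@supp_proj_sym _ _ B)) -bcompE BA0 bop0E; exact: inner0r.
Qed.

(** A B = 0 puts ran B inside ker A, to which P_A x is orthogonal, so P_A x lies in ker B.
    Conversely <A B x, y> = <B x, A y> = <P_B B x, P_A A y>. *)
Lemma mul_eq0_supp A B : sym A -> sym B -> A \ob B = 0 <->
  supp_proj B \ob supp_proj A = 0.
Proof.
move=> sA sB; split=> [AB0|BA0].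
  apply: bop_eqP => x; rewrite bcompE bop0E; apply: supp_proj_ker.
  apply: hi_eqP => y; rewrite hi0l sB /hi (supp_projP A x).1//.
  by rewrite /ker /= -bcompE AB0.
apply: bop_eqP => x; apply: hi_eqP => y; rewrite bop0E hi0l bcompE sA.
rewrite -(supp_proj_ran x sB) supp_proj_sym -(supp_proj_ran y sA) -bcompE BA0.
by rewrite bop0E hi0r.
Qed.

End SupportProjections.

(** * The Lebesgue decomposition and the two criteria *)

Theorem theorem7p5 (R : realType) (H L G : hilbertType (Cplx R))
    (M : set (bop H H)) (N : set (bop L L)) (J : L -> L) (P : set L)
    (Phi Psi : bop H H -> bop L L)
    (pi : bop H H -> bop G G) (V : bop L G) (A B : bop G G) :
  von_neumann_algebra M ->
  standard_form N J P ->
  CP M N Phi ->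
  CP M N Psi ->
  minimal_stinespring M (Phi + Psi) pi V ->
  radon_nikodym M pi V Phi A ->
  radon_nikodym M pi V Psi B ->
  let PPhi := supp_proj A in
  let PPsi := supp_proj B in
  let EPhi := range PPhi in
  let EPsi := range PPsi in
  [/\ A + B = bid G,
      forall x, M x ->
        cp_ac M N Phi Psi x = adj V \ob (PPhi \ob B \ob PPhi) \ob pi x \ob V /\
        cp_s M N Phi Psi x
          = adj V \ob ((bid G - PPhi) \ob B \ob (bid G - PPhi)) \ob pi x \ob V,
      (cp_abs_cont M N Psi Phi <-> EPsi `<=` EPhi) /\
      (cp_abs_cont M N Psi Phi <-> op_le PPsi PPhi) &
      (cp_singular M N Psi Phi <->
         forall u v, EPsi u -> EPhi v -> inner u v = 0) /\
      (cp_singular M N Psi Phi <-> PPsi \ob PPhi = 0)].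
Proof.
move=> vM [vN _ _ _] cPhi cPsi st rnA rnB PPhi PPsi EPhi EPsi.
have sA : sym A := psd_sym (A_psd rnA).
have sB : sym B := psd_sym (B_psd rnB).
have ac : cp_abs_cont M N Psi Phi <-> EPsi `<=` EPhi.
  apply: iff_trans (supp_range_sub A B); split.
    exact: (abs_cont_ker vM st rnA rnB).
  exact: (ker_abs_cont vM vN cPhi cPsi st rnA rnB).
have sing : cp_singular M N Psi Phi <-> PPsi \ob PPhi = 0.
  apply: iff_trans (mul_eq0_supp sA sB); split.
    exact: (singular_AB vM vN cPhi cPsi st rnA rnB).
  exact: (AB_singular vM st rnA rnB).
split.
- exact: (AB_id vM st rnA rnB).
- move=> x Mx; split.
    exact: (cp_acE vM vN cPhi cPsi st rnA rnB Mx).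
  exact: (cp_sE vM vN cPhi cPsi st rnA rnB Mx).
- by split=> //; apply: (iff_trans ac); exact: supp_range_le.
- by split=> //; apply: (iff_trans sing); apply: iff_sym; exact: supp_orth.
Qed.
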